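(* Suppose Assumptions A1, A3, A4 and A5 of the context hold. Then for every $N\ge1$ and stepsize $\tau\in(0,1]$, with the SPIDER parameters $B=\frac{2\sigma^2}{\tau^2}$, $b=\frac{2LM\sigma}{\tau}$, $T=\frac{\sigma}{LM\tau}$, the random point $x^R$ generated by the SCS algorithm with SPIDER described in the context, where $R$ is uniformly sampled from $\{0,1,\dots,N-1\}$ independently of the trajectory, satisfies $$\mathbb{E}\big[\|\nabla\varphi_{1/\bar\rho}(x^R)\|^2\big]\le 2\,\frac{\varphi_{1/\bar\rho}(x^0)-\min_{x\in X}F(x)+NC_4\tau^2}{N\tau},$$ where $\rho=(1+2\varkappa)\delta$, $\bar\rho=\rho+(1+\varkappa)\delta$, $C_4=2\bar\rho\big(\tfrac14M^2+1\big)$, and the expectation is taken with respect to the trajectory generated by the algorithm and $R$.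
   Context: Setting. $D$ is a random vector in $\mathbb{R}^d$ with law $\mathbb{P}$, $\ell:\mathbb{R}^n\times\mathbb{R}^d\to\mathbb{R}$ is a loss function, $X\subset\mathbb{R}^n$ is the feasible set, $\varkappa\in[0,1]$, and $$h(x)=\mathbb{E}[\ell(x,D)],\qquad f(x,u)=\mathbb{E}\big[u+\varkappa\max(0,\ell(x,D)-u)\big],\qquad F(x)=f(x,h(x)).$$ Moreau envelope. $\varphi(x)=F(x)+r(x)$, where $r(x)=0$ if $x\in X$ and $r(x)=+\infty$ otherwise. For $\lambda>0$, $\varphi_\lambda(x)=\min_y\{\varphi(y)+\frac1{2\lambda}\|y-x\|^2\}$ and $\mathrm{prox}_{\lambda\varphi}(x)=\arg\min_y\{\varphi(y)+\frac1{2\lambda}\|y-x\|^2\}$. $F$ is $\rho$-weakly convex with $\rho=(1+2\varkappa)\delta$, and for $\lambda\in(0,\rho^{-1})$, $\varphi_\lambda$ is continuously differentiable with $\nabla\varphi_\lambda(x)=\lambda^{-1}(x-\mathrm{prox}_{\lambda\varphi}(x))$. A function $q:\mathbb{R}^n\to\mathbb{R}$ is $\delta$-weakly convex if $q(\cdot)+\frac{\delta}{2}\|\cdot\|^2$ is convex; its subdifferential $\partial q(x)$ is the set of $g$ with $q(y)\ge q(x)+\langle g,y-x\rangle-\frac{\delta}{2}\|y-x\|^2$ for all $y$ (it coincides with the Clarke subdifferential). $\Pi_X$ denotes Euclidean projection onto $X$. For a finite batch $\mathcal{B}$ of independent samples of $D$, $\ell_{\mathcal{B}}(x)=\frac1{|\mathcal{B}|}\sum_{D\in\mathcal{B}}\ell(x,D)$.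 SCS algorithm with SPIDER. Inputs: $x^0\in X$, constant stepsize $\tau\in(0,1]$, epoch length $T$, large batch size $B$, small batch size $b$. For $k=0,1,\dots,N-1$: - if $k \bmod T=0$, sample a random batch $\mathcal{B}^k$ with $|\mathcal{B}^k|=B$ and set $u^k=\ell_{\mathcal{B}^k}(x^k)$; otherwise sample a random batch $\mathcal{B}^k$ with $|\mathcal{B}^k|=b$ and set $u^k=u^{k-1}+\ell_{\mathcal{B}^k}(x^k)-\ell_{\mathcal{B}^k}(x^{k-1})$; - randomly sample $D_1^{k+1},D_2^{k+1}$ from the law of $D$ and take $G^k\in\partial_x\ell(x^k,D_1^{k+1})$; set $\tilde g_{fx}^k=0$, $\tilde g_{fu}^k=1$ if $\ell(x^k,D_1^{k+1})<u^k$, and $\tilde g_{fx}^k=\varkappa G^k$, $\tilde g_{fu}^k=1-\varkappa$ if $\ell(x^k,D_1^{k+1})\ge u^k$; take $\tilde g_h^k\in\partial_x\ell(x^k,D_2^{k+1})$; - set $x^{k+1}=\Pi_X\big(x^k-\tau(\tilde g_{fx}^k+\tilde g_{fu}^k\tilde g_h^k)\big)$. Write $\tilde g_f^k=(\tilde g_{fx}^k,\tilde g_{fu}^k)$, and let $\mathcal{F}_k$ be the $\sigma$-algebra generated by $\{x^0,u^0,\dots,x^k,u^k\}$. Assumption A1. $X\subset\mathbb{R}^n$ is convex and compact. Assumption A3. There is a constant $\sigma$ such that for all $k$: - $\tilde g_f^k=g_f^k+e_f^k$ with $g_f^k\in\partial f(x^k,u^k)$, $\mathbb{E}[e_f^k|\mathcal{F}_k]=0$,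 $\mathbb{E}[\|e_f^k\|^2|\mathcal{F}_k]\le\sigma^2$; - $\tilde g_h^k=g_h^k+e_h^k$ with $g_h^k\in\partial h(x^k)$, $\mathbb{E}[e_h^k|\mathcal{F}_k]=0$, $\mathbb{E}[\|e_h^k\|^2|\mathcal{F}_k]\le\sigma^2$; - a stochastic loss value $\tilde h^k$ (here a single-sample value $\ell(x^k,D)$ with a fresh sample $D$) satisfies $\tilde h^k=h(x^k)+e_\ell^k$ with $\mathbb{E}[e_\ell^k|\mathcal{F}_k]=0$, $\mathbb{E}[|e_\ell^k|^2|\mathcal{F}_k]\le\sigma^2$; - there is a random vector $\tilde J^k=g_h^k+E^k$ (not used by this algorithm) with $\mathbb{E}[E^k|\mathcal{F}_k]=0$, $\mathbb{E}[\|E^k\|^2|\mathcal{F}_k]\le\sigma^2$; and the errors $e_f^k,e_h^k,e_\ell^k,E^k$ are conditionally independent given $\mathcal{F}_k$. Assumption A4. For all $x$ in a neighborhood of $X$: (i) $\ell(x,\cdot)$ is integrable; (ii) $\ell(\cdot,D)$ is weakly convex with an integrable constant $\tilde\delta(D)$. Set $\delta=\mathbb{E}[\tilde\delta(D)]$. Assumption A5. The Lipschitz constant $\tilde L(D)$ of $\ell(\cdot,D)$ on $X$ is square-integrable: $L^2:=\mathbb{E}[\tilde L^2(D)]<+\infty$. Constants. $\Delta_{fx}$ and $\Delta_h$ are bounds with $\|\partial_xf(x,u)\|\le\Delta_{fx}$ and $\|\partial h(x)\|\le\Delta_h$ for all $x\in X$, $u\in\mathbb{R}$; and $M\ge0$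 is given by $M^2=(\Delta_{fx}+\Delta_h)^2+2\sigma^2+2\sigma\Delta_h$, for which the paper uses the bound $\mathbb{E}[\|\tilde g_{fx}^k+\tilde g_{fu}^k\tilde g_h^k\|^2|\mathcal{F}_k]\le M^2$. *)

(* Defs.v *)
From HB Require Import structures.
From mathcomp Require Export all_boot all_order all_algebra.
From mathcomp Require Export all_classical all_reals all_analysis.

Set Implicit Arguments.
Unset Strict Implicit.
Unset Printing Implicit Defensive.

Export Order.TTheory GRing.Theory Num.Theory.
Export numFieldNormedType.Exports.

Local Open Scope classical_set_scope.
Local Open Scope ring_scope.

(* The norm carried by 'rV[R]_n in the library is the sup norm, hence the
   explicit Euclidean norm. *)
Definition dotv (R : realType) (n : nat) (v w : 'rV[R]_n) : R :=
  \sum_(i < n) v 0 i * w 0 i.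

Definition enorm (R : realType) (n : nat) (v : 'rV[R]_n) : R :=
  Num.sqrt (dotv v v).

Section WeakConvexity.
Context {R : realType} {n : nat}.
Implicit Types (U X : set 'rV[R]_n) (q : 'rV[R]_n -> R) (x : 'rV[R]_n).

Definition weakly_convex U (c : R) q : Prop :=
  convex_function U (fun x => q x + c / 2 * enorm x ^+ 2 : R^o).

(* For q weakly convex on the open convex set U and x in U, the set of g
   satisfying the inequality is the same for every admissible constant c. *)
Definition subdiff U q x : set 'rV[R]_n :=
  [set g | exists2 c : R, weakly_convex U c q &
     forall y, U y ->
       q x + dotv g (y - x) - c / 2 * enorm (y - x) ^+ 2 <= q y].

Definition eproj X (z : 'rV[R]_n) : set 'rV[R]_n :=
  [set p | X p /\ forall y, X y -> enorm (p - z) <= enorm (y - z)].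

Definition constrained X q (y : 'rV[R]_n) : \bar R :=
  if y \in X then (q y)%:E else +oo%E.

Definition moreau (phi : 'rV[R]_n -> \bar R) (lambda : R) x : R :=
  fine (ereal_inf (range
    (fun y => (phi y + ((2 * lambda)^-1 * enorm (y - x) ^+ 2)%:E)%E))).

Definition gradient q x : 'rV[R]_n :=
  \row_(i < n) 'D_(delta_mx 0 i) (q : 'rV[R]_n -> R^o) x.

End WeakConvexity.

Section Probability.
Context {R : realType} {disp : measure_display} {Omega : measurableType disp}.
Variable P : probability Omega R.
Implicit Types (F : set (set Omega)) (S : set (Omega -> R)).

Definition coords (m : nat) (e : Omega -> 'rV[R]_m) : set (Omega -> R) :=
  range (fun (i : 'I_m) w => e w 0 i).

Definition tcoords (d : nat) (z : Omega -> d.-tuple R) : set (Omega -> R) :=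
  range (fun (i : 'I_d) w => tnth (z w) i).

Definition sigma_of S : set (set Omega) :=
  <<s \bigcup_(f in S) preimage_set_system setT f measurable >>.

Definition adapted F (m : nat) (e : Omega -> 'rV[R]_m) : Prop :=
  forall A, sigma_of (coords e) A -> F A.

(* Y is a version of E[Z | F]. *)
Definition is_condexp F (Z Y : Omega -> R) : Prop :=
  [/\ P.-integrable setT (EFin \o Z),
      P.-integrable setT (EFin \o Y),
      (forall B, measurable B -> F (Y @^-1` B)) &
      forall A, F A ->
        (\int[P]_(w in A) (Z w)%:E = \int[P]_(w in A) (Y w)%:E)%E].

Definition cond_noise F (sigma : R) (m : nat) (e : Omega -> 'rV[R]_m) : Prop :=
  (forall i, is_condexp F (fun w => e w 0 i) (cst 0)) /\
  exists2 Y, is_condexp F (fun w => enorm (e w) ^+ 2) Y &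
             {ae P, forall w, Y w <= sigma ^+ 2}.

Definition cond_independent F (I : finType) (G : I -> set (set Omega)) : Prop :=
  forall A : I -> set Omega, (forall i, G i (A i)) ->
    exists2 Y : I -> Omega -> R,
      (forall i, is_condexp F (\1_(A i)) (Y i)) &
      is_condexp F (\1_(\bigcap_i A i)) (fun w => \prod_i Y i w).

(* The z i are i.i.d. with the given law, and jointly independent of F. *)
Definition fresh_samples F (d : nat) (law : probability (d.-tuple R) R)
    (I : finType) (z : I -> Omega -> d.-tuple R) : Prop :=
  (forall i, measurable_fun setT (z i)) /\
  forall A (E : I -> set (d.-tuple R)), F A -> (forall i, measurable (E i)) ->
    (P (A `&` \bigcap_i (z i @^-1` E i)) = P A * \prod_i law (E i))%E.

End Probability.

Section Model.
Context {R : realType} {n d : nat}.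
Variable law : probability (d.-tuple R) R.
Variable loss : 'rV[R]_n -> d.-tuple R -> R.
Variable kappa : R.

Definition risk (x : 'rV[R]_n) : R := (\int[law]_z loss x z)%R.

Definition semidev (x : 'rV[R]_n) (v : R) : R :=
  (\int[law]_z (v + kappa * Num.max 0 (loss x z - v)))%R.

Definition mean_semidev (x : 'rV[R]_n) : R := semidev x (risk x).

(* semidev as a function of the concatenated vector (x, u) in R^(n+1). *)
Definition semidev_joint (p : 'rV[R]_(n + 1)) : R :=
  semidev (lsubmx p) (rsubmx p 0 0).

End Model.

Section Algorithm.
Context {R : realType} {n d : nat}.
Context {disp : measure_display} {Omega : measurableType disp}.

(* The samples D_1^{k+1}, D_2^{k+1} and the subgradients drawn at them during
   iteration k are indexed by k; the first m entries of batch k are the m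
   samples of the k-th batch. *)
Record process := Process {
  iter_x : nat -> Omega -> 'rV[R]_n;
  iter_u : nat -> Omega -> R;
  batch : nat -> nat -> Omega -> d.-tuple R;
  sample1 : nat -> Omega -> d.-tuple R;
  sample2 : nat -> Omega -> d.-tuple R;
  subgrad1 : nat -> Omega -> 'rV[R]_n;
  subgrad2 : nat -> Omega -> 'rV[R]_n }.

Variable P : probability Omega R.
Variable law : probability (d.-tuple R) R.
Variable loss : 'rV[R]_n -> d.-tuple R -> R.
Variables (kappa tau : R) (T B b : nat).
Variables (U X : set 'rV[R]_n) (x0 : 'rV[R]_n).
Variable s : process.

Definition batch_size (k : nat) : nat := if (k %% T == 0)%N then B else b.

Definition batch_loss (k : nat) (x : 'rV[R]_n) (w : Omega) : R :=
  (batch_size k)%:R^-1 * \sum_(i < batch_size k) loss x (batch s k i w).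

Definition dir_fx (k : nat) (w : Omega) : 'rV[R]_n :=
  if loss (iter_x s k w) (sample1 s k w) < iter_u s k w then 0
  else kappa *: subgrad1 s k w.

Definition dir_fu (k : nat) (w : Omega) : R :=
  if loss (iter_x s k w) (sample1 s k w) < iter_u s k w then 1 else 1 - kappa.

Definition direction (k : nat) (w : Omega) : 'rV[R]_n :=
  dir_fx k w + dir_fu k w *: subgrad2 s k w.

Definition Fk (k : nat) : set (set Omega) :=
  sigma_of (\bigcup_(j in `I_k.+1)
    (coords (iter_x s j) `|` [set iter_u s j])).

(* All the quantities generated before the k-th batch is drawn, and before
   sample1 k and sample2 k are drawn. *)
Definition past (k : nat) : set (Omega -> R) :=
  \bigcup_(j in `I_k.+1) coords (iter_x s j) `|`
  \bigcup_(j in `I_k)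
    ([set iter_u s j] `|`
     \bigcup_(i in `I_(batch_size j)) tcoords (batch s j i) `|`
     tcoords (sample1 s j) `|` tcoords (sample2 s j) `|`
     coords (subgrad1 s j) `|` coords (subgrad2 s j)).

Definition past_batch (k : nat) : set (Omega -> R) :=
  past k `|` [set iter_u s k] `|`
  \bigcup_(i in `I_(batch_size k)) tcoords (batch s k i).

(* The process s is a run of the first N iterations of the algorithm. *)
Record scs_spider (N : nat) : Prop := ScsSpider {
  scs_meas_x : forall k i, (k <= N)%N ->
    measurable_fun setT (fun w => iter_x s k w 0 i);
  scs_meas_u : forall k, (k < N)%N -> measurable_fun setT (iter_u s k);
  scs_meas_subgrad1 : forall k i, (k < N)%N ->
    measurable_fun setT (fun w => subgrad1 s k w 0 i);
  scs_meas_subgrad2 : forall k i, (k < N)%N ->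
    measurable_fun setT (fun w => subgrad2 s k w 0 i);
  scs_init : forall w, iter_x s 0 w = x0;
  scs_batch : forall k, (k < N)%N ->
    fresh_samples P (sigma_of (past k)) law
      (fun i : 'I_(batch_size k) => batch s k i);
  scs_refresh : forall k w, (k < N)%N -> (k %% T == 0)%N ->
    iter_u s k w = batch_loss k (iter_x s k w) w;
  scs_track : forall k w, (k < N)%N -> (k %% T != 0)%N ->
    iter_u s k w = iter_u s k.-1 w +
      batch_loss k (iter_x s k w) w - batch_loss k (iter_x s k.-1 w) w;
  scs_samples : forall k, (k < N)%N ->
    fresh_samples P (sigma_of (past_batch k)) law
      (fun c : bool => if c then sample1 s k else sample2 s k);
  scs_subgrad1 : forall k, (k < N)%N -> {ae P, forall w,
    subdiff U (loss ^~ (sample1 s k w)) (iter_x s k w) (subgrad1 s k w)};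
  scs_subgrad2 : forall k, (k < N)%N -> {ae P, forall w,
    subdiff U (loss ^~ (sample2 s k w)) (iter_x s k w) (subgrad2 s k w)};
  scs_step : forall k w, (k < N)%N ->
    eproj X (iter_x s k w - tau *: direction k w) (iter_x s k.+1 w) }.

Definition dir_f (k : nat) (w : Omega) : 'rV[R]_(n + 1) :=
  row_mx (dir_fx k w) (const_mx (dir_fu k w)).

(* gf, gh are the true subgradients, Dl the fresh sample behind the stochastic
   loss value and Jt the stochastic subgradient of the inner function. *)
Definition stochastic_oracles (N : nat) (sigma : R) : Prop :=
  exists (gf : nat -> Omega -> 'rV[R]_(n + 1)) (gh : nat -> Omega -> 'rV[R]_n)
         (Dl : nat -> Omega -> d.-tuple R) (Jt : nat -> Omega -> 'rV[R]_n),
  let ef k w := dir_f k w - gf k w in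
  let eh k w := subgrad2 s k w - gh k w in
  let el k w : 'rV[R]_1 :=
    const_mx (loss (iter_x s k w) (Dl k w) - risk law loss (iter_x s k w)) in
  let eJ k w := Jt k w - gh k w in
  forall k, (k < N)%N ->
  [/\ adapted (Fk k) (gf k) /\ {ae P, forall w,
        subdiff [set p | U (lsubmx p)] (semidev_joint law loss kappa)
          (row_mx (iter_x s k w) (const_mx (iter_u s k w))) (gf k w)},
      adapted (Fk k) (gh k) /\ {ae P, forall w,
        subdiff U (risk law loss) (iter_x s k w) (gh k w)},
      fresh_samples P (sigma_of (past_batch k)) law (fun _ : unit => Dl k),
      [/\ cond_noise P (Fk k) sigma (ef k), cond_noise P (Fk k) sigma (eh k),
          cond_noise P (Fk k) sigma (el k) & cond_noise P (Fk k) sigma (eJ k)] &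
      cond_independent P (Fk k)
        (tnth [tuple sigma_of (coords (ef k)); sigma_of (coords (eh k));
                     sigma_of (coords (el k)); sigma_of (coords (eJ k))])].

(* The trajectory up to the last sampled iterate is described by Fk N.-1 *)
Definition uniform_index (N : nat) (J : Omega -> 'I_N) : Prop :=
  forall i, [/\ measurable (J @^-1` [set i]),
    P (J @^-1` [set i]) = (N%:R^-1)%:E &
    forall A, Fk N.-1 A ->
      (P (A `&` J @^-1` [set i]) = P A * P (J @^-1` [set i]))%E].

End Algorithm.

(* For 0 <= r, the least positive integer that is at least r: batch sizes and epoch lengths
   given by real formulas are rounded up, and are at least 1 *)
Definition ceil_pos (R : realType) (r : R) : nat :=
  maxn 1 `|Num.ceil r|%N.

(* Main.v *)
(** Write r for rhobar, p for the proximal point of x^k, and err for u^k - h(x^k).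
    Since f is kappa delta-weakly convex, h is delta-weakly convex and f is monotone
    and 1-Lipschitz in u, any g_f in df(x^k, u^k) and g_h in dh(x^k) satisfy
      <g_fx + g_fu g_h, p - x^k> <= F(p) - F(x^k) + |err| + (1 + kappa) delta/2 |p - x^k|^2,
    and strong convexity of the proximal problem bounds the right-hand side by
    |err| - r/2 |p - x^k|^2.  As the projection is nonexpansive, conditioning on F_k
    gives a descent of E[phi_{1/r}(x^k)] by tau/2 E|r (x^k - p)|^2, up to
    r tau E|err| + r tau^2 M^2 / 2.  The SPIDER increments are centred given the past,
    so E[err^2] is at most sigma^2/B plus L^2 tau^2 M^2 / b per step within an epoch,
    which the choice of batch sizes keeps below tau^2. *)
From mathcomp Require Import ring lra measurable_realfun.
Require Import Defs.

Set Implicit Arguments.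
Unset Strict Implicit.
Unset Printing Implicit Defensive.

Local Open Scope classical_set_scope.
Local Open Scope ring_scope.

(** * Euclidean norm *)

(** Conditional expectations are replaced by integrals over the events of a sub-sigma-algebra
    ([null_on]); versions appear only when the assumptions are unfolded. The main obstacle is
    measurability: [h], the proximal map and the loss are all evaluated at random points. Each is
    Lipschitz on [X], and a Lipschitz function of a random point is an infimum over a countable
    dense set, which gives measurability, jointly in the point and the sample. The loss is Lipschitz
    only for almost every sample, hence a modified loss that is Lipschitz for all of them.
    Conditional independence enters through one fact: e_h stays centred on the join of F_k and e_f,
    which kills the product of the errors of g_fu and g_h. The variance bound sigma^2 is assumed for
    one extra sample at x^k and reaches the batch because both have the same joint law with the
    past. When delta = 0 the Moreau parameter 1/rhobar is 0 by convention and strong convexity of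
    the proximal problem is lost; the envelope is then constant, and this case is settled apart. *)

Section Euclid.
Context {R : realType} {n : nat}.
Implicit Types (u v w x y z : 'rV[R]_n) (a c t : R).

Lemma dotvC v w : dotv v w = dotv w v.
Proof. by apply: eq_bigr => i _; rewrite mulrC. Qed.

Lemma dotvDl u v w : dotv (u + v) w = dotv u w + dotv v w.
Proof. by rewrite -big_split; apply: eq_bigr => i _; rewrite !mxE mulrDl. Qed.

Lemma dotvZl a v w : dotv (a *: v) w = a * dotv v w.
Proof. by rewrite /dotv big_distrr; apply: eq_bigr => i _ /=; rewrite !mxE mulrA. Qed.

Lemma dotvNl v w : dotv (- v) w = - dotv v w.
Proof. by rewrite -scaleN1r dotvZl mulN1r. Qed.

Lemma dotvDr u v w : dotv w (u + v) = dotv w u + dotv w v.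
Proof. by rewrite dotvC dotvDl !(dotvC w). Qed.

Lemma dotvZr a v w : dotv w (a *: v) = a * dotv w v.
Proof. by rewrite dotvC dotvZl dotvC. Qed.

Lemma dotvNr v w : dotv w (- v) = - dotv w v.
Proof. by rewrite dotvC dotvNl dotvC. Qed.

Definition dotvE := (dotvDl, dotvDr, dotvNl, dotvNr, dotvZl, dotvZr).

Lemma dotv0l v : dotv 0 v = 0.
Proof. by rewrite -(scale0r 0) dotvZl mul0r. Qed.

Lemma dotvv_ge0 v : 0 <= dotv v v.
Proof. by apply: sumr_ge0 => i _; rewrite -expr2 sqr_ge0. Qed.

Lemma enorm_sqr v : enorm v ^+ 2 = dotv v v.
Proof. by rewrite sqr_sqrtr // dotvv_ge0. Qed.

Lemma enorm_ge0 v : 0 <= enorm v.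
Proof. exact: sqrtr_ge0. Qed.

Lemma enormN v : enorm (- v) = enorm v.
Proof. by rewrite /enorm dotvNl dotvNr opprK. Qed.

Lemma enorm_sub x y : enorm (x - y) = enorm (y - x).
Proof. by rewrite -enormN opprB. Qed.

Lemma enorm0 : enorm (0 : 'rV[R]_n) = 0.
Proof. by rewrite /enorm dotv0l sqrtr0. Qed.

Lemma enormZ a v : enorm (a *: v) = `|a| * enorm v.
Proof. by rewrite /enorm dotvZl dotvZr mulrA -expr2 sqrtrM ?sqr_ge0 // sqrtr_sqr. Qed.

Lemma ler_coord_enorm v i : `|v 0 i| <= enorm v.
Proof.
rewrite -(ler_pXn2r (ltn0Sn 1)) ?nnegrE ?enorm_ge0 // enorm_sqr real_normK ?num_real //.
rewrite /dotv (bigD1 i) //= expr2 lerDl.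
by apply: sumr_ge0 => j _; rewrite -expr2 sqr_ge0.
Qed.

Lemma enorm_eq0 v : enorm v = 0 -> v = 0.
Proof.
move=> v0; apply/rowP => i; rewrite mxE; apply/eqP; rewrite -normr_le0.
by rewrite -v0 ler_coord_enorm.
Qed.

Lemma dotv_le v w : dotv v w <= enorm v * enorm w.
Proof.
have [v0|v0] := eqVneq (enorm v) 0.
  by rewrite (enorm_eq0 v0) dotv0l enorm0 mul0r.
have [w0|w0] := eqVneq (enorm w) 0.
  by rewrite (enorm_eq0 w0) dotvC dotv0l enorm0 mulr0.
have vp : 0 < enorm v by rewrite lt_def v0 enorm_ge0.
have wp : 0 < enorm w by rewrite lt_def w0 enorm_ge0.
have := dotvv_ge0 (enorm w *: v - enorm v *: w).
rewrite !dotvE (dotvC w v) -!enorm_sqr => h.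
suff: 0 <= 2 * (enorm v * enorm w) * (enorm v * enorm w - dotv v w).
  by rewrite pmulr_rge0 ?subr_ge0 // mulr_gt0 // mulr_gt0.
by apply: (le_trans h); rewrite le_eqVlt; apply/orP; left; apply/eqP; ring.
Qed.

Lemma dotv_abs_le v w : `|dotv v w| <= enorm v * enorm w.
Proof. by rewrite ler_norml dotv_le andbT lerNl -dotvNl -(enormN v) dotv_le. Qed.

Lemma enormD v w : enorm (v + w) <= enorm v + enorm w.
Proof.
rewrite -(ler_pXn2r (ltn0Sn 1)) ?nnegrE ?addr_ge0 ?enorm_ge0 //.
rewrite sqrrD !enorm_sqr !dotvE (dotvC w v).
by have := dotv_le v w; lra.
Qed.

Lemma enorm_triangle x y z : enorm (x - z) <= enorm (x - y) + enorm (y - z).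
Proof. by rewrite -{1}(subrK y x) -addrA enormD. Qed.

Lemma enorm_sqD v w :
  enorm (v + w) ^+ 2 = enorm v ^+ 2 + 2 * dotv v w + enorm w ^+ 2.
Proof. by rewrite !enorm_sqr !dotvE (dotvC w v); ring. Qed.

Lemma enorm_sq_conv t x y z :
  enorm ((1 - t) *: x + t *: y - z) ^+ 2 = (1 - t) * enorm (x - z) ^+ 2 +
    t * enorm (y - z) ^+ 2 - t * (1 - t) * enorm (x - y) ^+ 2.
Proof.
by rewrite !enorm_sqr !dotvE (dotvC y x) (dotvC z x) (dotvC z y); ring.
Qed.

(** The topology on row vectors is that of the sup norm; compactness and continuity pass to [enorm]
    through this bound, for which the crude factor [n] suffices. *)
Lemma enorm_le_norm v : enorm v <= n%:R * `|v|.
Proof.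
have coordn i : `|v 0 i| <= `|v|.
  rewrite [leRHS]/Num.norm/= mx_normrE.
  exact: (le_bigmax _ (fun ij => `|v ij.1 ij.2|) (0, i)).
rewrite -(ler_pXn2r (ltn0Sn 1)) ?nnegrE ?mulr_ge0 ?enorm_ge0 //.
rewrite enorm_sqr /dotv; apply: (@le_trans _ _ (\sum_(i < n) `|v| ^+ 2)).
  apply: ler_sum => i _; rewrite -expr2 -real_normK ?num_real //.
  by rewrite ler_pXn2r ?nnegrE.
rewrite sumr_const card_ord exprMn -[leLHS]mulr_natl ler_wpM2r ?sqr_ge0 //.
by rewrite -natrX ler_nat; case: (n) => // k; rewrite leq_pmulr.
Qed.

End Euclid.

(** * Weak convexity and the Moreau envelope *)

(** The limit t -> 0 in elementary form: dividing a segment inequality by [t] leaves a remainder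
    [t * k], which this removes. *)
Lemma le_of_le_addt (R : realFieldType) (a c k : R) :
  (forall t, 0 < t < 1 -> a <= c + t * k) -> a <= c.
Proof.
move=> h; apply/ler_addgt0Pr => e e0.
(* The witness t satisfies t |k| <= e; halving keeps it strictly below 1 when [k = 0]. *)
have d0 : 0 < e / (e + `|k|) / 2.
  by rewrite divr_gt0 // divr_gt0 // ltr_wpDr.
have d1 : e / (e + `|k|) / 2 < 1.
  by rewrite ltr_pdivrMr // mul1r ltr_pdivrMr ?ltr_wpDr //; have := normr_ge0 k; lra.
apply: (le_trans (h (e / (e + `|k|) / 2) _)); first by rewrite d0.
rewrite lerD2l; apply: (@le_trans _ _ (e / (e + `|k|) / 2 * `|k|)).
  by rewrite ler_pM2l // ler_norm.
rewrite -mulrA mulrAC ler_pdivrMr; last by rewrite ltr_wpDr.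
have := normr_ge0 k; nra.
Qed.

Section Convexity.
Context {R : realType} {n : nat}.
Implicit Types (X U : set 'rV[R]_n) (q : 'rV[R]_n -> R) (x y : 'rV[R]_n) (t c : R).

Lemma convex_set_comb X x y t : convex_set X -> X x -> X y -> 0 <= t <= 1 ->
  X ((1 - t) *: x + t *: y).
Proof.
move=> cX Xx Xy /andP[t0 t1].
have := cX y x (Itv01 t0 t1); rewrite !inE => /(_ Xy Xx).
by rewrite /conv/= addrC.
Qed.

(** The added quadratic has an exact defect on segments ([enorm_sq_conv] at [z = 0]), so convexity
    of the sum becomes a bound on [q] with that defect on the right. *)
Lemma weakly_convexP U c q : weakly_convex U c q -> forall x y t,
  U x -> U y -> 0 <= t <= 1 ->
  q ((1 - t) *: x + t *: y) <=
    (1 - t) * q x + t * q y + c / 2 * (t * (1 - t) * enorm (x - y) ^+ 2).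
Proof.
move=> cq x y t Ux Uy /andP[t0 t1].
have := cq (Itv01 t0 t1) y x; rewrite !inE => /(_ Uy Ux).
rewrite /conv/= [t *: _ + _]addrC.
have := enorm_sq_conv t x y 0; rewrite !subr0 => ->.
move=> h; have {h} : _ <= t * _ + (1 - t) * _ := h.
by rewrite /unstable.onem; lra.
Qed.

(* Rewritten along the segment, the local quadratic minorant of a subgradient
   becomes global because its quadratic term is of higher order. *)
Lemma subdiff_segment U q x y g K : subdiff U q x g -> U x -> U y ->
  convex_set U ->
  (forall t, 0 <= t <= 1 -> q ((1 - t) *: x + t *: y) <=
     (1 - t) * q x + t * q y + t * (1 - t) * K) ->
  q x + dotv g (y - x) - K <= q y.
Proof.
move=> [c _ hg] Ux Uy cU hq.
pose D := enorm (y - x) ^+ 2.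
suff h : q x + dotv g (y - x) - K <= q y by [].
apply: (@le_of_le_addt _ _ _ (c / 2 * D - K)) => t /andP[t0 t1].
have t01 : 0 <= t <= 1 by rewrite !ltW.
have := hg _ (convex_set_comb cU Ux Uy t01); have := hq t t01.
have -> : (1 - t) *: x + t *: y - x = t *: (y - x).
  by apply/rowP => i; rewrite !mxE; ring.
rewrite dotvZr enormZ exprMn -normrX ger0_norm ?sqr_ge0 // -/D => h1 h2.
have := le_trans h2 h1; rewrite -subr_ge0 => h3.
rewrite -subr_ge0 -(pmulr_rge0 _ t0); apply: (le_trans h3).
by rewrite le_eqVlt; apply/orP; left; apply/eqP; ring.
Qed.

Lemma compact_enorm_bounded X : compact X ->
  exists2 D, 0 <= D & forall x, X x -> enorm x <= D.
Proof.
move=> /compact_bounded[D [_ /(_ (`|D| + 1))]] h.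
exists (n%:R * (`|D| + 1)); first by rewrite mulr_ge0 // addr_ge0.
move=> x Xx; apply: (le_trans (enorm_le_norm x)); rewrite ler_wpM2l //.
by apply: h => //; rewrite (le_lt_trans (ler_norm D)) // ltrDl.
Qed.

Lemma lipschitz_within_continuous X q C :
  (forall x y, X x -> X y -> `|q x - q y| <= C * enorm (x - y)) ->
  {within X, continuous q}.
Proof.
move=> lq; apply/subspace_continuousP => x Xx; apply/cvgrPdist_le => e e0.
rewrite near_withinE.
(* The added ones keep the denominator positive when [C = 0] or [n = 0]. *)
have p0 : 0 < e / ((`|C| + 1) * (n%:R + 1)).
  by rewrite divr_gt0 // mulr_gt0 // ltr_wpDl.
near=> y => Xy; apply: (le_trans (lq _ _ Xx Xy)).
apply: (@le_trans _ _ ((`|C| + 1) * ((n%:R + 1) * `|x - y|))).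
  apply: (@le_trans _ _ ((`|C| + 1) * enorm (x - y))).
    by rewrite ler_wpM2r ?enorm_ge0 // (le_trans (ler_norm C)) // lerDl.
  rewrite ler_wpM2l ?addr_ge0 // (le_trans (enorm_le_norm _)) //.
  by rewrite ler_wpM2r // lerDl.
by rewrite mulrA mulrC -ler_pdivlMr ?mulr_gt0 ?ltr_wpDl.
Unshelve. all: by end_near. Qed.

End Convexity.

(** Obtuse angle property: comparing [p] with the segment from [p] to [y] and letting t -> 0 gives
    |p - z|^2 + |p - y|^2 <= |y - z|^2. It is applied with [y] a proximal point and with [y] the
    current iterate. *)
Lemma eproj_nonexpansive (R : realType) (n : nat) (X : set 'rV[R]_n) z p y :
  convex_set X -> eproj X z p -> X y -> enorm (p - y) <= enorm (z - y).
Proof.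
move=> cX [Xp hp] Xy.
rewrite -(ler_pXn2r (ltn0Sn 1)) ?nnegrE ?enorm_ge0 // (enorm_sub z).
suff : enorm (p - z) ^+ 2 + enorm (p - y) ^+ 2 <= enorm (y - z) ^+ 2.
  by have := sqr_ge0 (enorm (p - z)); lra.
apply: (@le_of_le_addt _ _ _ (enorm (p - y) ^+ 2)) => t /andP[t0 t1].
have t01 : 0 <= t <= 1 by rewrite !ltW.
have := hp _ (convex_set_comb cX Xp Xy t01).
rewrite -(ler_pXn2r (ltn0Sn 1)) ?nnegrE ?enorm_ge0 // enorm_sq_conv.
set a := enorm (p - z) ^+ 2; set c := enorm (y - z) ^+ 2; set e := enorm (p - y) ^+ 2.
move=> h; rewrite -subr_ge0 -(pmulr_rge0 _ t0); lra.
Qed.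

(** * The proximal map and the gradient of the Moreau envelope *)

Section Prox.
Context {R : realType} {n : nat}.
Variables (X : set 'rV[R]_n) (G : 'rV[R]_n -> R) (b : R).
Implicit Types (x y p : 'rV[R]_n).

(** [b] is the inverse of the Moreau parameter: with lambda = 1/b the weight 1/(2 lambda) equals
    [b / 2]. *)
Definition prox_obj x y : R := G y + b / 2 * enorm (y - x) ^+ 2.

(** A classically chosen minimiser over [X]. Its uniqueness and Lipschitz dependence on [x] come
    from strong convexity, once [rho < b]. *)
Definition proxmap x : 'rV[R]_n :=
  xget 0 [set p | X p /\ forall y, X y -> prox_obj x p <= prox_obj x y].

Variable C : R.
Hypotheses (X0 : X !=set0) (cX : convex_set X) (kX : compact X).
Hypothesis lG : forall x y, X x -> X y -> `|G x - G y| <= C * enorm (x - y).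

Lemma proxmapP x : X (proxmap x) /\
  forall y, X y -> prox_obj x (proxmap x) <= prox_obj x y.
Proof.
rewrite /proxmap; case: xgetP => [p _ //|none].
have [D D0 hD] := compact_enorm_bounded kX.
suff : {within X, continuous (prox_obj x)}.
  move=> /(compact_EVT_min X0 kX)[p]; rewrite inE => Xp hp.
  by case: (none p); split => // y Xy; apply: hp; rewrite inE.
(* The difference of two squared distances to [x] factors: on [X] one factor is at most 2 (D + |x|),
   the other at most |y - z|. *)
apply: (@lipschitz_within_continuous _ _ _ _ (C + `|b| / 2 * (2 * D + 2 * enorm x))) => y z Xy Xz.
rewrite /prox_obj opprD addrACA -mulrBr.
apply: (le_trans (ler_normD _ _)); rewrite mulrDl lerD ?lG // normrM.
rewrite normrM normfV (ger0_norm (_ : 0 <= 2)) // -[leRHS]mulrA ler_wpM2l ?mulr_ge0 //.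
rewrite subr_sqr normrM mulrC; apply: ler_pM => //.
- rewrite ger0_norm ?addr_ge0 ?enorm_ge0 //.
  have := enormD y (- x); have := enormD z (- x).
  by rewrite enormN; have := hD _ Xy; have := hD _ Xz; lra.
- have := enorm_triangle y z x; have := enorm_triangle z y x.
  by rewrite (enorm_sub z y) ler_norml; lra.
Qed.

Lemma moreau_eq x p : X p -> (forall y, X y -> prox_obj x p <= prox_obj x y) ->
  moreau (constrained X G) b^-1 x = prox_obj x p.
Proof.
move=> Xp hp; rewrite /moreau.
have -> : (2 * b^-1)^-1 = b / 2 by rewrite invfM invrK mulrC.
suff -> : ereal_inf (range (fun y => (constrained X G y +
   (b / 2 * enorm (y - x) ^+ 2)%:E)%E)) = (prox_obj x p)%:E by [].
apply/eqP; rewrite eq_le; apply/andP; split.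
  by apply: ereal_inf_lbound; exists p => //; rewrite /constrained mem_set.
apply: le_ereal_inf_tmp => _ [y _ <-]; rewrite /constrained.
by case: ifPn => [/set_mem Xy|_]; rewrite ?addye ?leey // -EFinD lee_fin hp.
Qed.

Lemma moreau_prox x :
  moreau (constrained X G) b^-1 x = prox_obj x (proxmap x).
Proof. by have [Xp hp] := proxmapP x; exact: moreau_eq. Qed.

Lemma moreau_le x y : X y -> moreau (constrained X G) b^-1 x <= prox_obj x y.
Proof. by rewrite moreau_prox; have [_] := proxmapP x; exact. Qed.

(** As [0^-1 = 0], the weight of the quadratic vanishes when [b = 0], and the envelope is the
    constant min of [G] over [X]. *)
Lemma gradient_moreau0 x : b = 0 ->
  gradient (moreau (constrained X G) b^-1) x = 0.
Proof.
move=> b0; have le y z : moreau (constrained X G) b^-1 y <= moreau (constrained X G) b^-1 z.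
  have [Xp _] := proxmapP z; apply: (le_trans (moreau_le y Xp)).
  by rewrite moreau_prox /prox_obj b0 !mul0r.
have -> : moreau (constrained X G) b^-1 = cst (moreau (constrained X G) b^-1 x).
  by apply/funext => y; apply/eqP; rewrite eq_le !le.
by apply/rowP => i; rewrite !mxE derive_cst.
Qed.

Variable rho : R.
Hypothesis wG : forall x y t, X x -> X y -> 0 <= t <= 1 ->
  G ((1 - t) *: x + t *: y) <=
    (1 - t) * G x + t * G y + rho / 2 * (t * (1 - t) * enorm (x - y) ^+ 2).

(** On segments the quadratic adds curvature [b] and [G] loses at most [rho]. Comparing the
    minimiser with the segment towards [y] and letting t -> 0 leaves quadratic growth with modulus
    [b - rho]. *)
Lemma prox_strong_min x y : X y ->
  prox_obj x (proxmap x) + (b - rho) / 2 * enorm (proxmap x - y) ^+ 2 <=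
  prox_obj x y.
Proof.
move=> Xy; have [Xp hp] := proxmapP x; set p := proxmap x in Xp hp *.
apply: (@le_of_le_addt _ _ _ ((b - rho) / 2 * enorm (p - y) ^+ 2)).
move=> t /andP[t0 t1]; have t01 : 0 <= t <= 1 by rewrite !ltW.
have := hp _ (convex_set_comb cX Xp Xy t01); rewrite {2}/prox_obj.
rewrite enorm_sq_conv => h1; have h2 := wG Xp Xy t01.
rewrite -subr_ge0 -(pmulr_rge0 _ t0).
move: h1 h2; rewrite /prox_obj.
set a := enorm (p - y) ^+ 2; set d := enorm (p - x) ^+ 2; set e := enorm (y - x) ^+ 2.
by move=> h1 h2; lra.
Qed.

(** At [y = x], the b/2 of the objective and the (b - rho)/2 of the growth add up to b - rho/2. *)
Lemma prox_decrease x : X x ->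
  G (proxmap x) - G x <= - (b - rho / 2) * enorm (proxmap x - x) ^+ 2.
Proof.
move=> Xx; have := prox_strong_min x Xx; rewrite /prox_obj subrr enorm0.
by move: (G _) (G _) (enorm _) => f g e; lra.
Qed.

(** The proximal point of [x] is a competitor for the envelope at [y]. As it lies in [X], projecting
    [x - t *: v] brings it no further away, and expanding the square separates the linear term from
    the one in t^2. *)
Lemma moreau_descent x y v t : 0 <= b -> X x -> eproj X (x - t *: v) y ->
  moreau (constrained X G) b^-1 y <= moreau (constrained X G) b^-1 x +
    b * t * dotv (proxmap x - x) v + b / 2 * t ^+ 2 * enorm v ^+ 2.
Proof.
move=> b0 Xx hy; have [Xp _] := proxmapP x.
apply: (le_trans (moreau_le y Xp)); rewrite moreau_prox /prox_obj.
have := eproj_nonexpansive cX hy Xp.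
rewrite -ler_sqr ?nnegrE ?enorm_ge0 // (enorm_sub y) (enorm_sub (x - _)).
have -> : proxmap x - (x - t *: v) = (proxmap x - x) + t *: v.
  by rewrite opprB addrCA addrC.
have b2 : 0 <= b / 2 by rewrite divr_ge0.
move: (proxmap x) Xp => p Xp.
rewrite (enorm_sqD (p - x)) dotvZr enormZ exprMn real_normK ?num_real // => /(ler_wpM2l b2).
move: (G p) (enorm (p - y) ^+ 2) (enorm (p - x) ^+ 2) (dotv _ _) (enorm v ^+ 2).
by move=> f a e g o; lra.
Qed.

Hypothesis rho_b : rho < b.
Hypothesis rho0 : 0 <= rho.

(** Adding the two growth inequalities, the four squared distances polarise into (b - rho) |p - q|^2
    <= b <p - q, x - y>; Cauchy-Schwarz concludes. Both the gradient formula and measurability of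
    the proximal map rest on this. *)
Lemma prox_lipschitz x y :
  enorm (proxmap x - proxmap y) <= b / (b - rho) * enorm (x - y).
Proof.
have [Xp _] := proxmapP x; have [Xq _] := proxmapP y.
have := prox_strong_min x Xq; have := prox_strong_min y Xp.
set p := proxmap x in Xp *; set q := proxmap y in Xq *.
rewrite /prox_obj; clearbody p q; rewrite (enorm_sub q p) => h1 h2.
have m0 : 0 < b - rho by rewrite subr_gt0.
rewrite mulrAC ler_pdivlMr //.
have := enorm_ge0 (p - q); rewrite le_eqVlt => /orP[/eqP <-|pq].
  by rewrite mul0r mulr_ge0 ?enorm_ge0 // (le_trans rho0) // ltW.
rewrite -(ler_pM2l pq).
have cs := dotv_le (p - q) (x - y).
have b0 : 0 <= b by rewrite (le_trans rho0) // ltW.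
have := ler_wpM2l b0 cs.
have : dotv (p - q) (x - y) = (enorm (q - x) ^+ 2 - enorm (p - x) ^+ 2 +
    enorm (p - y) ^+ 2 - enorm (q - y) ^+ 2) / 2.
  by rewrite !enorm_sqr !dotvE (dotvC x p) (dotvC x q) (dotvC y p) (dotvC y q); field.
move=> ->; move: h1 h2.
set A := enorm (q - x) ^+ 2; set B := enorm (p - x) ^+ 2.
set E := enorm (p - y) ^+ 2; set H := enorm (q - y) ^+ 2.
set D := enorm (p - q); set W := enorm (x - y).
by lra.
Qed.

(** Each of the proximal points of [x] and of [x + h e] is a competitor at the other base point.
    This squeezes the increment of the envelope between two expressions that are linear in h up to
    O(h^2). *)
Lemma gradient_moreau x :
  gradient (moreau (constrained X G) b^-1) x = b *: (x - proxmap x).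
Proof.
apply/rowP => i; rewrite !mxE.
set e := delta_mx 0 i; set phi := moreau _ _.
have b0 : 0 <= b by rewrite (le_trans rho0) // ltW.
have dote v : dotv v e = v 0 i.
  rewrite /dotv (bigD1 i) //= big1 ?addr0.
    by rewrite /e mxE !eqxx mulr1.
  by move=> j ji; rewrite /e mxE (negbTE ji) andbF mulr0.
pose L := b / (b - rho).
have L0 : 0 <= L by rewrite divr_ge0 // subr_ge0 ltW.
have e1 : e 0 i = 1 by rewrite mxE !eqxx.
have ee : enorm e = 1 by rewrite /enorm dote e1 sqrtr1.
(* The part [b * L] pays for the displacement of the proximal point, at most L |h|; the part [b]
   covers the quadratic in h. *)
have bound h : `|phi (h *: e + x) - phi x - h * (b * (x - proxmap x) 0 i)| <=
    b * (1 + L) * h ^+ 2.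
  have [Xp _] := proxmapP x; have [Xq _] := proxmapP (h *: e + x).
  have := moreau_le x Xq; have := moreau_le (h *: e + x) Xp.
  rewrite -/phi; have := moreau_prox x; have := moreau_prox (h *: e + x).
  rewrite -/phi /prox_obj.
  have := prox_lipschitz (h *: e + x) x; rewrite -/L => lip.
  move: Xp Xq lip; move: (proxmap x) (proxmap (h *: e + x)) (phi x) (phi _).
  move=> p q phx phy Xp Xq; rewrite addrK enormZ ee mulr1 => lip.
  have -> : (p - (h *: e + x)) = p - x - h *: e by rewrite opprD addrCA addrC.
  have -> : (q - (h *: e + x)) = q - x - h *: e by rewrite opprD addrCA addrC.
  have sq (v : 'rV[R]_n) : enorm (v - h *: e) ^+ 2 = enorm v ^+ 2 - 2 * h * v 0 i + h ^+ 2.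
    by rewrite !enorm_sqr !dotvE (dotvC e v) !dote e1; ring.
  rewrite !sq.
  have := ler_coord_enorm (q - p) i; rewrite !mxE => cq.
  have : `|q 0 i - p 0 i| * `|h| <= L * h ^+ 2.
    rewrite -[h ^+ 2]real_normK ?num_real // expr2 mulrA ler_wpM2r //.
    exact: le_trans cq lip.
  rewrite -normrM => /(ler_wpM2l b0).
  have := ler_norm ((q 0 i - p 0 i) * h); have := ler_norm (- ((q 0 i - p 0 i) * h)).
  rewrite normrN.
  move=> /(ler_wpM2l b0) n1 /(ler_wpM2l b0) n2 n3 h1 h2 h3 h4.
  have h0 := mulr_ge0 b0 (sqr_ge0 h); have hL := mulr_ge0 L0 h0.
  by rewrite ler_norml; apply/andP; split; lra.
have K0 : 0 < b * (1 + L) + 1 by rewrite ltr_wpDl // mulr_ge0 // addr_ge0.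
apply: cvg_lim => //; apply/cvgrPdist_le => eps eps0.
near=> h.
have h0 : h != 0 by near: h; exact: nbhs_dnbhs_neq.
rewrite distrC -(ler_pM2r (_ : 0 < `|h|)) ?normr_gt0 // -normrM mulrBl.
rewrite [X in X - _](_ : _ = phi (h *: e + x) - phi x); last first.
  by rewrite /GRing.scale/= mulrC mulVKf.
rewrite [_ * h]mulrC; have := bound h; rewrite !mxE => bh.
apply: (le_trans bh).
rewrite -[h ^+ 2]real_normK ?num_real // expr2 mulrA ler_wpM2r //.
apply: (@le_trans _ _ ((b * (1 + L) + 1) * `|h|)).
  by rewrite ler_wpM2r // lerDl.
rewrite mulrC -ler_pdivlMr //; near: h.
exact: (dnbhs0_le (divr_gt0 eps0 K0)).
Unshelve. all: by end_near. Qed.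

End Prox.

(** * Joint measurability of Lipschitz functions *)

(** [X] may contain no rational point. For each rational centre and radius 1/(m+1), a point of [X]
    in that ball is chosen if there is one, and a fixed point of [X] otherwise. *)
Lemma countable_dense_subset (R : realType) (n : nat) (X : set 'rV[R]_n) :
  X !=set0 -> exists2 p : nat -> 'rV[R]_n, forall j, X (p j) &
    forall x e, X x -> 0 < e -> exists j, enorm (x - p j) < e.
Proof.
move=> [x0 Xx0].
pose A (i : 'rV[rat]_n * nat) := [set y | X y /\
  enorm (y - map_mx ratr i.1) < i.2.+1%:R^-1].
have XA i : X (xget x0 (A i)) by case: xgetP => [y _ []|].
exists (fun j => if unpickle j is Some i then xget x0 (A i) else x0).
  by move=> j; case: unpickle => //.
move=> x e Xx e0.
pose m := Num.truncn (2 / e).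
have em : m.+1%:R^-1 < e / 2.
  by rewrite invf_plt ?posrE ?divr_gt0 // invf_div truncnS_gt.
(* A coordinatewise error [r] gives Euclidean error at most n r < 1/(m+1) < e/2; the chosen point of
   [X] is within the same radius of the centre. *)
pose r : R := m.+1%:R^-1 / n.+1%:R.
have r0 : 0 < r by rewrite divr_gt0 // invr_gt0.
have hq i : exists q : rat, `|x 0 i - ratr q| < r.
  have [q] : exists q, ratr q \in `](x 0 i - r), (x 0 i + r)[%R.
    by apply: rat_in_itvoo; rewrite ltrBlDr -addrA ltrDl addr_gt0.
  rewrite in_itv /= => /andP[q1 q2]; exists q.
  by rewrite ltr_norml; lra.
pose a : 'rV[rat]_n := \row_i xchoose (hq i).
have xa : enorm (x - map_mx ratr a) < m.+1%:R^-1.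
  apply: (le_lt_trans (enorm_le_norm _)).
  apply: (@le_lt_trans _ _ (n%:R * r)).
    rewrite ler_wpM2l // [leLHS]/Num.norm/= mx_normrE.
    apply: bigmax_le => [|[i j] _ /=]; first exact: ltW.
    by rewrite (ord1 i) !mxE ltW // (xchooseP (hq j)).
  rewrite /r mulrCA gtr_pMr ?invr_gt0 //.
  by rewrite ltr_pdivrMr // mul1r ltr_nat.
exists (pickle (a, m)); rewrite pickleK.
have Ax : A (a, m) x by [].
case: xgetP => [y _ [_ /= ya]|/(_ x)] //.
apply: (le_lt_trans (enorm_triangle _ (map_mx ratr a) _)).
rewrite (enorm_sub _ y) [ltRHS]splitr.
by apply: ltrD; [exact: lt_trans xa em|exact: lt_trans ya em].
Qed.

Section Measurability.
Context {R : realType} {n : nat} {d : measure_display} {T : measurableType d}.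

Lemma measurable_dotv (v w : T -> 'rV[R]_n) :
  (forall i, measurable_fun setT (fun t => v t 0 i)) ->
  (forall i, measurable_fun setT (fun t => w t 0 i)) ->
  measurable_fun setT (fun t => dotv (v t) (w t)).
Proof.
by move=> mv mw; apply: measurable_sum => i; exact: measurable_funM.
Qed.

Lemma measurable_enorm (v : T -> 'rV[R]_n) :
  (forall i, measurable_fun setT (fun t => v t 0 i)) ->
  measurable_fun setT (fun t => enorm (v t)).
Proof.
move=> mv; apply: (measurableT_comp (f := @Num.sqrt R)).
  by apply: continuous_measurable_fun; exact: sqrt_continuous.
exact: measurable_dotv.
Qed.

Lemma measurable_enorm_sub (v : T -> 'rV[R]_n) p :
  (forall i, measurable_fun setT (fun t => v t 0 i)) ->
  measurable_fun setT (fun t => enorm (v t - p)).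
Proof.
move=> mv; apply: measurable_enorm => i.
by under eq_fun do rewrite !mxE; exact: measurable_funB.
Qed.

(* q (v t) t = inf_j (q p_j t + K t |v t - p_j|) over a countable dense p. *)
Lemma measurable_lipschitz_comp (X : set 'rV[R]_n) (v : T -> 'rV[R]_n)
    (q : 'rV[R]_n -> T -> R) (K : T -> R) :
  (forall t, X (v t)) -> (forall i, measurable_fun setT (fun t => v t 0 i)) ->
  (forall p, X p -> measurable_fun setT (q p)) -> measurable_fun setT K ->
  (forall t x y, X x -> X y -> `|q x t - q y t| <= K t * enorm (x - y)) ->
  measurable_fun setT (fun t => q (v t) t).
Proof.
(* A point of [T] supplies the point of [X] from which the dense sequence starts; on an empty [T]
   the claim is trivial. *)
move=> Xv mv mq mK lq; have [//|t0] := pselect (exists t : T, True); last first.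
  by move=> _ B mB; rewrite (_ : _ `&` _ = set0) // -subset0 => t; case: t0; exists t.
case=> t1 _; have [p Xp dp] := @countable_dense_subset _ _ X (ex_intro _ _ (Xv t1)).
pose h j t := q (p j) t + K t * enorm (v t - p j).
have lb t j : q (v t) t <= h j t.
  by have := lq t _ _ (Xv t) (Xp j); rewrite ler_norml => /andP[_]; rewrite /h; lra.
have lbt t : lbound (range (h ^~ t)) (q (v t) t) by move=> _ [j _ <-].
rewrite (_ : (fun t => _) = (fun t => infs (h ^~ t) 0)).
  apply: measurable_fun_infs => [t _|j]; first by exists (q (v t) t).
  apply: measurable_funD; first exact: mq.
  by apply: measurable_funM => //; exact: measurable_enorm_sub.
apply/funext => t; rewrite /infs /= (_ : sdrop _ _ = range (h ^~ t)); last first.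
  by apply/seteqP; split => [_ [j _ <-]|_ [j _ <-]]; exists j.
apply/eqP; rewrite eq_le; apply/andP; split.
  by apply: lb_le_inf => //; exists (h 0 t); exists 0%N.
apply/ler_addgt0Pr => e e0.
(* The Lipschitz constant is paid twice, in moving [q] to [p j] and in the penalty of [h j]: each
   costs at most e/2. *)
have d0 : 0 < e / (2 * (`|K t| + 1)) by rewrite divr_gt0 // mulr_gt0 // ltr_wpDl.
have [j hj] := dp _ _ (Xv t) d0.
apply: (@le_trans _ _ (h j t)).
  by apply: ge_inf; [exists (q (v t) t)|exists j].
have := lq t _ _ (Xp j) (Xv t); rewrite ler_norml => /andP[_].
rewrite (enorm_sub (p j)) => h1.
have h2 : K t * enorm (v t - p j) <= e / 2.
  apply: (@le_trans _ _ ((`|K t| + 1) * enorm (v t - p j))).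
    by rewrite ler_wpM2r ?enorm_ge0 // (le_trans (ler_norm _)) // lerDl.
  rewrite mulrC -ler_pdivlMr ?ltr_wpDl //.
  by move: hj; rewrite invfM mulrA => /ltW.
by rewrite /h; lra.
Qed.

End Measurability.

(** * Means of integrable functions *)

Section Mean.
Context {R : realType} {d : measure_display} {T : measurableType d}.
Variable P : probability T R.
Implicit Types (f g e : T -> R) (c k : R) (A : set T).

Definition L1 f : Prop := P.-integrable setT (EFin \o f).

Definition mean f : R := (\int[P]_w f w)%R.

Lemma L1_measurable f : L1 f -> measurable_fun setT f.
Proof. by move=> /(measurable_int P)/measurable_EFinP. Qed.

Lemma L1_dominated f g : measurable_fun setT f ->
  {ae P, forall w, `|f w| <= g w} -> L1 g -> L1 f.
Proof.
move=> mf fg /integrableP[mg ig]; apply/integrableP; split.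
  exact/measurable_EFinP.
apply: le_lt_trans ig; apply: ae_ge0_le_integral => //.
- exact: measurableT_comp (measurableT_comp _ _).
- exact: measurableT_comp.
- move: fg; apply: filterS => w fgw _ /=.
  by rewrite lee_fin (le_trans fgw) // ler_norm.
Qed.

Lemma L1_ae f g : measurable_fun setT f -> {ae P, forall w, f w = g w} -> L1 g -> L1 f.
Proof.
move=> mf fg Lg; apply: (L1_dominated mf (g := fun w => `|g w|)).
  by move: fg; apply: filterS => w ->.
exact: integrable_norm.
Qed.

Lemma L1D f g : L1 f -> L1 g -> L1 (fun w => f w + g w).
Proof. by move=> Lf Lg; have := integrableD measurableT Lf Lg. Qed.

Lemma L1B f g : L1 f -> L1 g -> L1 (fun w => f w - g w).
Proof. by move=> Lf Lg; have := integrableB measurableT Lf Lg. Qed.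

Lemma L1Zl k f : L1 f -> L1 (fun w => k * f w).
Proof. by move=> Lf; have := integrableZl measurableT k Lf. Qed.

Lemma L1_norm f : L1 f -> L1 (fun w => `|f w|).
Proof. exact: integrable_norm. Qed.

Lemma L1_cst c : L1 (fun=> c).
Proof. exact: finite_measure_integrable_cst. Qed.

Lemma L1_sum (I : Type) (s : seq I) (p : pred I) (h : I -> T -> R) :
  (forall i, p i -> L1 (h i)) -> L1 (fun w => \sum_(i <- s | p i) h i w).
Proof.
move=> Lh; elim: s => [|i s ih].
  by under eq_fun do rewrite big_nil; exact: L1_cst.
under eq_fun do rewrite big_cons.
by case pi : (p i) => //; apply: L1D => //; exact: Lh.
Qed.

Lemma L1_bounded f c : measurable_fun setT f ->
  {ae P, forall w, `|f w| <= c} -> L1 f.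
Proof. by move=> mf fc; exact: L1_dominated mf fc (L1_cst c). Qed.

Lemma L1_mul_bounded f e c : measurable_fun setT f ->
  {ae P, forall w, `|f w| <= c} -> L1 e -> L1 (fun w => f w * e w).
Proof.
move=> mf fc Le; have me := L1_measurable Le.
apply: (L1_dominated (g := fun w => c * `|e w|)); first exact: measurable_funM.
  by move: fc; apply: filterS => w fcw; rewrite normrM ler_wpM2r.
exact/L1Zl/L1_norm.
Qed.

Lemma L1_mul_sqr f g : measurable_fun setT f -> measurable_fun setT g ->
  L1 (fun w => f w ^+ 2) -> L1 (fun w => g w ^+ 2) -> L1 (fun w => f w * g w).
Proof.
move=> mf mg Lf Lg.
apply: (L1_dominated (g := fun w => f w ^+ 2 + g w ^+ 2)).
- exact: measurable_funM.
- apply: aeW => w; have := sqr_ge0 (`|f w| - `|g w|).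
  rewrite sqrrB !real_normK ?num_real // -normrM.
  by have := sqr_ge0 (f w); have := sqr_ge0 (g w); have := normr_ge0 (f w * g w); lra.
- exact: L1D.
Qed.

Lemma L1_of_sqr f : measurable_fun setT f -> L1 (fun w => f w ^+ 2) -> L1 f.
Proof.
move=> mf Lf; have := @L1_mul_sqr f (fun=> 1) mf (measurable_cst _) Lf.
have -> : (fun w => f w * 1) = f by apply/funext => w; rewrite mulr1.
by apply; exact: L1_cst.
Qed.

Lemma meanD f g : L1 f -> L1 g -> mean (fun w => f w + g w) = mean f + mean g.
Proof. by move=> Lf Lg; exact: RintegralD. Qed.

Lemma meanB f g : L1 f -> L1 g -> mean (fun w => f w - g w) = mean f - mean g.
Proof. by move=> Lf Lg; exact: RintegralB. Qed.

Lemma meanZl k f : L1 f -> mean (fun w => k * f w) = k * mean f.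
Proof. by move=> Lf; exact: RintegralZl. Qed.

Lemma mean_cst c : mean (fun=> c) = c.
Proof. by rewrite /mean Rintegral_cst // [X in fine X](@probability_setT _ _ _ P) mulr1. Qed.

Lemma mean_sum (I : Type) (s : seq I) (p : pred I) (h : I -> T -> R) :
  (forall i, p i -> L1 (h i)) ->
  mean (fun w => \sum_(i <- s | p i) h i w) = \sum_(i <- s | p i) mean (h i).
Proof.
move=> Lh; elim: s => [|i s ih].
  by under eq_fun do rewrite big_nil; rewrite big_nil mean_cst.
under eq_fun do rewrite big_cons.
rewrite big_cons; case pi : (p i) => //; rewrite meanD ?ih //; first exact: Lh.
exact: L1_sum.
Qed.

Lemma mean_ae f g : L1 f -> L1 g -> {ae P, forall w, f w = g w} -> mean f = mean g.
Proof.
move=> Lf Lg fg; congr fine; apply: ae_eq_integral => //.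
- exact: measurable_int Lf.
- exact: measurable_int Lg.
- by move: fg; apply: filterS => w /= -> .
Qed.

Lemma mean_ge0 f : (forall w, 0 <= f w) -> 0 <= mean f.
Proof. by move=> f0; apply: Rintegral_ge0 => w _. Qed.

Lemma mean_le f g : L1 f -> L1 g -> {ae P, forall w, f w <= g w} -> mean f <= mean g.
Proof.
move=> Lf Lg fg; rewrite -subr_ge0 -meanB //.
have Lgf := L1B Lg Lf.
(* [mean_ge0] asks for a sign at every point; the difference agrees almost everywhere with its
   absolute value. *)
rewrite (@mean_ae _ (fun w => `|g w - f w|)) //.
- by apply: mean_ge0 => w.
- exact: L1_norm.
- by move: fg; apply: filterS => w fgw; rewrite ger0_norm // subr_ge0.
Qed.

(** Nonnegativity of the variance. *)
Lemma mean_sqr_le f : L1 f -> L1 (fun w => f w ^+ 2) ->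
  mean f ^+ 2 <= mean (fun w => f w ^+ 2).
Proof.
move=> Lf Lf2; set c := mean f.
have := @mean_ge0 (fun w => (f w - c) ^+ 2) (fun w => sqr_ge0 _).
have -> : (fun w => (f w - c) ^+ 2) = (fun w => f w ^+ 2 - (2 * c) * f w + c ^+ 2).
  by apply/funext => w; ring.
rewrite (meanD (L1B Lf2 (L1Zl _ Lf)) (L1_cst _)) (meanB Lf2 (L1Zl _ Lf)).
by rewrite meanZl // mean_cst -/c; lra.
Qed.

Lemma mean_norm_le f c : 0 <= c -> L1 f -> L1 (fun w => f w ^+ 2) ->
  mean (fun w => f w ^+ 2) <= c ^+ 2 -> mean (fun w => `|f w|) <= c.
Proof.
move=> c0 Lf Lf2 fc; have E2 : (fun w => `|f w| ^+ 2) = fun w => f w ^+ 2.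
  by apply/funext => w; rewrite real_normK // num_real.
rewrite -ler_sqr ?nnegrE ?mean_ge0 //; apply: le_trans fc; rewrite -E2.
by apply: mean_sqr_le; [exact: L1_norm|rewrite E2].
Qed.

Lemma mean_fin f : L1 f -> (\int[P]_w (f w)%:E = (mean f)%:E)%E.
Proof. by move=> Lf; rewrite /mean /Rintegral fineK // integrable_fin_num. Qed.

Lemma mean_indic A : measurable A -> mean (\1_A) = fine (P A).
Proof. by move=> mA; rewrite /mean /Rintegral integral_indic // setIT. Qed.

Lemma mean_restrict A f : measurable A -> L1 f ->
  (\int[P]_(w in A) (f w)%:E = (mean (fun w => \1_A w * f w))%:E)%E.
Proof.
move=> mA Lf; rewrite integral_mkcond -mean_fin; last first.
  apply: (@L1_mul_bounded _ _ 1) => //; apply: aeW => w.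
  by rewrite indicE; case: (_ \in _); rewrite ?normr1 ?normr0.
apply: eq_integral => w _; rewrite patchE indicE.
by case: ifP; rewrite ?mul1r ?mul0r.
Qed.

End Mean.

(** * Functions with null integral over a sub-sigma-algebra *)

Import HBNNSimple.

Section SubSigma.
Context {R : realType} {d : measure_display} {T : measurableType d}.
Implicit Types (G H : set (set T)) (W : T -> R).

(** The source is retyped with the sigma-algebra generated by [G], so every library lemma on
    measurable functions applies to sub-sigma-algebras. *)
Definition measurable_wrt G {d'} {U : measurableType d'} (W : T -> U) : Prop :=
  measurable_fun setT (W : g_sigma_algebraType G -> U).

Lemma measurable_wrtS G H {d'} {U : measurableType d'} (W : T -> U) :
  <<s G >> `<=` <<s H >> -> measurable_wrt G W -> measurable_wrt H W.
Proof. by move=> GH mW _ B mB; apply: GH; exact: mW. Qed.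

Lemma measurable_wrtW G {d'} {U : measurableType d'} (W : T -> U) :
  <<s G >> `<=` measurable -> measurable_wrt G W -> measurable_fun setT W.
Proof. by move=> GH mW _ B mB; apply: GH; exact: mW. Qed.

Variable P : probability T R.

(** This is E[e | G] = 0, without choosing a version of the conditional expectation. *)
Definition null_on G (e : T -> R) : Prop :=
  forall A, <<s G >> A -> mean P (fun w => \1_A w * e w) = 0.

Lemma indic_le1 (A : set T) w : `|\1_A w : R| <= 1.
Proof. by rewrite indicE; case: (_ \in _); rewrite ?normr1 ?normr0. Qed.

Lemma L1_indic_mul (A : set T) (e : T -> R) : measurable A -> L1 P e ->
  L1 P (fun w => \1_A w * e w).
Proof.
by move=> mA Le; apply: (@L1_mul_bounded _ _ _ _ _ _ 1) => //; apply: aeW => w; exact: indic_le1.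
Qed.

(** True for indicators of events of [G], hence for the simple functions increasing to [W], which
    are themselves measurable for [G]; |W e| dominates in the limit. *)
Lemma null_on_mul_nneg G (e W : T -> R) : <<s G >> `<=` measurable ->
  L1 P e -> null_on G e -> measurable_wrt G W -> (forall w, 0 <= W w) ->
  L1 P (fun w => W w * e w) -> mean P (fun w => W w * e w) = 0.
Proof.
move=> Gm Le Ge mW W0 LWe.
have mW' : measurable_fun setT (EFin \o (W : g_sigma_algebraType G -> R)).
  exact/measurable_EFinP.
pose Wm := nnsfun_approx measurableT mW'.
have cW w : EFin \o (fun m => Wm m w) @ \oo --> (W w)%:E.
  by apply: cvg_nnsfun_approx => // x _; rewrite lee_fin.
have ndW p q w : (p <= q)%N -> Wm p w <= Wm q w.
  by move=> pq; have := nd_nnsfun_approx measurableT mW' pq => /lefP; exact.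
have cWr w : (fun m => Wm m w) @ \oo --> W w by exact: (fine_cvg (cW w)).
have Wm_le m w : Wm m w <= W w.
  have cv : cvgn (fun m => Wm m w) by apply/cvg_ex; exists (W w); exact: cWr.
  have nd : nondecreasing_seq (fun m => Wm m w) by move=> p q; exact: ndW.
  by have := nondecreasing_cvgn_le nd cv m; rewrite (cvg_lim _ (cWr w)).
have mWm m : measurable_fun setT (Wm m : T -> R).
  exact: (@measurable_wrtW G _ _ (Wm m) Gm (measurable_funP (Wm m))).
have Wm0 m w : 0 <= Wm m w by exact: fun_ge0.
have Wme m : mean P (fun w => Wm m w * e w) = 0.
  under eq_fun do rewrite fimfunEord big_distrl /=.
  have mA (c : R) : <<s G >> (Wm m @^-1` [set c]) by exact: (measurable_funPTI (Wm m)).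
  rewrite mean_sum => [|i _].
    rewrite big1 // => i _; under eq_fun do rewrite -mulrA.
    rewrite meanZl ?Ge ?mulr0 //.
    by apply: L1_indic_mul => //; exact: Gm (mA _).
  under eq_fun do rewrite -mulrA.
  by apply/L1Zl/L1_indic_mul => //; exact: Gm (mA _).
have me := L1_measurable Le.
have mWf : measurable_fun setT W by exact: measurable_wrtW mW.
have Lm m : L1 P (fun w => Wm m w * e w).
  apply: (L1_dominated (g := fun w => `|W w * e w|)).
  - exact: measurable_funM.
  - by apply: aeW => w; rewrite !normrM (ger0_norm (Wm0 m w)) (ger0_norm (W0 w)) ler_wpM2r.
  - exact: L1_norm.
have h : (fun m => \int[P]_w (Wm m w * e w)%:E)%E @ \oo --> (\int[P]_w (W w * e w)%:E)%E.
  apply: (@dominated_cvg _ _ _ P setT measurableT (fun m w => (Wm m w * e w)%:E)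
            (fun w => (W w * e w)%:E) (fun w => `|W w * e w|%:E)) => //.
  - by move=> m; exact: (measurable_int P (Lm m)).
  - move=> w _; apply: cvg_EFin; first exact: nearW.
    exact: cvgMl (cWr w).
  - exact: L1_norm.
  - by move=> m w _; rewrite /= lee_fin !normrM (ger0_norm (Wm0 m w)) (ger0_norm (W0 w)) ler_wpM2r.
move: h; under eq_fun do rewrite mean_fin // Wme.
move=> /(cvg_lim (@ereal_hausdorff R)); rewrite lim_cst //.
by rewrite mean_fin // => -[].
Qed.

(** Positive and negative parts. [W] may be unbounded as long as the product is integrable: the
    noise terms are only square-integrable. *)
Lemma null_on_mul G (e W : T -> R) : <<s G >> `<=` measurable ->
  L1 P e -> null_on G e -> measurable_wrt G W ->
  L1 P (fun w => W w * e w) -> mean P (fun w => W w * e w) = 0.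
Proof.
move=> Gm Le Ge mW LWe; have mWf := measurable_wrtW Gm mW.
have me := L1_measurable Le.
have Wpos : L1 P (fun w => W^\+ w * e w).
  apply: (L1_dominated (g := fun w => `|W w * e w|)).
  - by apply: measurable_funM => //; exact: measurable_funrpos.
  - apply: aeW => w; rewrite !normrM ler_wpM2r // ger0_norm ?funrpos_ge0 //.
    by rewrite /funrpos ge_max ler_norm normr_ge0.
  - exact: L1_norm.
have Wneg : L1 P (fun w => W^\- w * e w).
  apply: (L1_dominated (g := fun w => `|W w * e w|)).
  - by apply: measurable_funM => //; exact: measurable_funrneg.
  - apply: aeW => w; rewrite !normrM ler_wpM2r // ger0_norm ?funrneg_ge0 //.
    by rewrite /funrneg ge_max -normrN ler_norm normr_ge0.
  - exact: L1_norm.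
have -> : (fun w => W w * e w) = (fun w => W^\+ w * e w - W^\- w * e w).
  apply/funext => w; rewrite -mulrBl; congr (_ * _).
  by rewrite -{1}(funrposBneg W).
have mp : measurable_wrt G W^\+ by exact: measurable_funrpos.
have mn : measurable_wrt G W^\- by exact: measurable_funrneg.
rewrite meanB // (null_on_mul_nneg Gm Le Ge mp (funrpos_ge0 W) Wpos).
by rewrite (null_on_mul_nneg Gm Le Ge mn (funrneg_ge0 W) Wneg) subrr.
Qed.

(* The sets A `&` B form a pi-system generating the join of the two sigma-algebras. *)
Lemma null_on_join G H (e : T -> R) :
  <<s G >> `<=` measurable -> <<s H >> `<=` measurable -> L1 P e ->
  (forall A B, <<s G >> A -> <<s H >> B ->
    mean P (fun w => \1_(A `&` B) w * e w) = 0) ->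
  null_on (G `|` H) e.
Proof.
move=> Gm Hm Le GHe.
pose I := [set C | exists A B, [/\ <<s G >> A, <<s H >> B & C = A `&` B]].
have sG A B : <<s G >> A -> <<s G >> B -> <<s G >> (A `&` B).
  exact: (@measurableI _ (g_sigma_algebraType G)).
have sH A B : <<s H >> A -> <<s H >> B -> <<s H >> (A `&` B).
  exact: (@measurableI _ (g_sigma_algebraType H)).
have II : setI_closed I.
  move=> _ _ [A [B [GA HB ->]]] [A' [B' [GA' HB' ->]]].
  by exists (A `&` A'), (B `&` B'); split; [exact: sG|exact: sH|rewrite setIACA].
have GT : <<s G >> setT by exact: (@measurableT _ (g_sigma_algebraType G)).
have HT : <<s H >> setT by exact: (@measurableT _ (g_sigma_algebraType H)).
have GHI : <<s G `|` H >> `<=` <<s I >>.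
  apply: smallest_sub; first exact: smallest_sigma_algebra.
  move=> A [GA|HA]; apply: sub_sigma_algebra.
    by exists A, setT; split; rewrite ?setIT //; exact: sub_sigma_algebra.
  by exists setT, A; split; rewrite ?setTI //; exact: sub_sigma_algebra.
have Im : I `<=` measurable.
  by move=> _ [A [B [GA HB ->]]]; apply: measurableI; [exact: Gm|exact: Hm].
(* The events over which [e] has null mean form a Dynkin class: the whole space is the case A = B =
   setT, complements use it, disjoint unions use countable additivity. *)
pose D := [set A | measurable A /\ mean P (fun w => \1_A w * e w) = 0].
suff : <<s I >> `<=` D by move=> ID A /GHI/ID[].
have DT : mean P e = 0.
  have := GHe setT setT GT HT; rewrite setIT => <-.
  by congr mean; apply/funext => w; rewrite indicE in_setT mul1r.
apply: lambda_system_subset; [exact: II| | |by []].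
  apply/dynkin_lambda_system; split => /=.
  - split => //; rewrite -[RHS]DT; congr mean.
    by apply/funext => w; rewrite indicE in_setT mul1r.
  - move=> A [mA A0]; split; first exact: measurableC.
    rewrite -[RHS]subr0 -{1}DT -A0 -meanB //; last exact: L1_indic_mul.
    congr mean; apply/funext => w; rewrite !indicE in_setC.
    by case: (w \in A); rewrite /= ?mul1r ?mul0r ?subrr ?subr0.
  - move=> F tF DF; have mF k : measurable (F k) by case: (DF k).
    have mU : measurable (\bigcup_k F k) by exact: bigcup_measurable.
    split=> //; apply: EFin_inj; rewrite -mean_restrict //.
    rewrite integral_bigcup //; last first.
      by apply: integrableS Le.
    rewrite eseries0 // => k _ _.
    by rewrite mean_restrict //; case: (DF k) => _ ->.
move=> C IC; split; first exact: Im.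
by case: IC => A [B [GA HB ->]]; exact: GHe.
Qed.

End SubSigma.

(** * Independent samples *)

Section Independence.
Context {R : realType} {d d' : measure_display}.
Context {T : measurableType d} {S : measurableType d'}.
Variables (P : probability T R) (law : probability S R).
Implicit Types (G H : set (set T)) (Z : T -> S).

(** With [C] the whole space this also says that [Z] has law [law]. *)
Definition indep_of G Z : Prop := forall C E, <<s G >> C -> measurable E ->
  (P (C `&` Z @^-1` E) = P C * law E)%E.

Lemma indep_ofS G H Z : <<s G >> `<=` <<s H >> -> indep_of H Z -> indep_of G Z.
Proof. by move=> GH iZ C E GC mE; apply: iZ => //; exact: GH. Qed.

Section Fubini.
Variables (G : set (set T)) (Z : T -> S).
Hypotheses (Gm : <<s G >> `<=` measurable) (mZ : measurable_fun setT Z).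
Hypothesis iZ : indep_of G Z.
Variable g : g_sigma_algebraType G * S -> R.
Hypothesis mg : measurable_fun setT g.

Let mid : measurable_fun setT (id : T -> g_sigma_algebraType G).
Proof. by move=> _ B mB; rewrite setTI preimage_id; exact: Gm. Qed.

Let mpair : measurable_fun setT (fun w => (w, Z w) : g_sigma_algebraType G * S).
Proof. by apply/measurable_fun_pairP; split. Qed.

(** [Q] is [P] restricted to the sigma-algebra of [G], seen as the law of the identity; [Jt] is the
    joint law of the past and the sample. Independence says that [Jt] is the product of [Q] and
    [law]. *)
Let Q := distribution P (mfun_Sub (mem_set mid)).
Let Jt := distribution P (mfun_Sub (mem_set mpair)).

Let joint X : measurable X -> (Q \x law)%E X = Jt X.
Proof.
apply: product_measure_unique => A B mA mB.
by rewrite -iZ.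
Qed.

Lemma indep_measurable_fun : measurable_fun setT (fun w => g (w, Z w)).
Proof. exact: measurableT_comp mpair. Qed.

Lemma indep_integral_ge0 : (forall p, 0 <= g p) ->
  (\int[P]_w (g (w, Z w))%:E = \int[P]_w \int[law]_z (g (w, z))%:E)%E.
Proof.
move=> g0; have mgE : measurable_fun setT (EFin \o g) by exact/measurable_EFinP.
have gE0 p : (0 <= (EFin \o g) p)%E by rewrite lee_fin.
transitivity (\int[Jt]_p (g p)%:E)%E.
  by rewrite ge0_integral_distribution.
transitivity (\int[(Q \x law)%E]_p (g p)%:E)%E.
  by apply: eq_measure_integral => A mA _; exact: (esym (joint mA)).
rewrite fubini_tonelli1 // /fubini_F ge0_integral_distribution //.
  exact: (@measurable_fun_fubini_tonelli_F _ _ _ _ R law _ mgE gE0).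
by move=> w; apply: integral_ge0 => z _; exact: (gE0 (w, z)).
Qed.

(** Freezing the past: by Fubini the mean is that of the inner integrals at fixed [w], which all
    vanish. *)
Lemma indep_mean_eq0 : (forall w, law.-integrable setT (fun z => (g (w, z))%:E)) ->
  (forall w, mean law (fun z => g (w, z)) = 0) ->
  L1 P (fun w => g (w, Z w)) -> mean P (fun w => g (w, Z w)) = 0.
Proof.
move=> Lg g0 LgP; have mgE : measurable_fun setT (EFin \o g) by exact/measurable_EFinP.
apply: EFin_inj; rewrite -mean_fin //.
transitivity (\int[Jt]_p (g p)%:E)%E.
  by rewrite integral_distribution.
have LJ : Jt.-integrable setT (EFin \o g).
  by apply: integrable_pushforward.
transitivity (\int[(Q \x law)%E]_p (g p)%:E)%E.
  by apply: eq_measure_integral => A mA _; exact: (esym (joint mA)).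
have LQ : (Q \x law)%E.-integrable setT (EFin \o g).
  apply/integrableP; split => //; have /integrableP[_] := LJ.
  by rewrite [X in (_ -> X < _)%E](eq_measure_integral Jt) // => A mA _; exact: joint.
rewrite -(integral12_prod_meas1 LQ) /fubini_F.
rewrite (eq_integral (cst 0%E)) ?integral0 // => w _.
exact: (etrans (mean_fin (Lg w)) (congr1 EFin (g0 w))).
Qed.

End Fubini.

End Independence.

(** * Batches of independent samples: variances add up *)

Section Sampling.
Context {R : realType} {disp : measure_display} {T : measurableType disp} {d : nat}.
Variables (P : probability T R) (law : probability (d.-tuple R) R).
Variables (G : set (set T)) (I : finType) (Z : I -> T -> d.-tuple R).
Hypotheses (Gm : <<s G >> `<=` measurable) (fZ : fresh_samples P <<s G >> law Z).

Lemma fresh_measurable i : measurable_fun setT (Z i).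
Proof. by case: fZ. Qed.

Lemma fresh_indep i : indep_of P law G (Z i).
Proof.
move=> C E GC mE; have [_ /(_ C (fun j => if j == i then E else setT))] := fZ.
rewrite (bigD1 i) //= eqxx big1 ?mule1; last first.
  by move=> j ji; rewrite (negbTE ji) probability_setT.
move=> <- //; last by move=> j; case: ifP.
congr (P (_ `&` _)); apply/seteqP; split=> [w Ew j _ /=|w /(_ i Logic.I)/=].
  by case: eqP => [->|].
by rewrite eqxx.
Qed.

Definition preimages (i : I) : set (set T) := preimage_set_system setT (Z i) measurable.

Lemma sub_preimages i : <<s preimages i >> `<=` measurable.
Proof.
apply: smallest_sub; first exact: sigma_algebra_measurable.
by move=> _ [B mB <-]; apply: fresh_measurable.
Qed.

Lemma sub_join i : <<s G `|` preimages i >> `<=` measurable.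
Proof.
apply: smallest_sub; first exact: sigma_algebra_measurable.
move=> A [GA|IA]; first by apply: Gm; exact: sub_sigma_algebra.
by apply: (@sub_preimages i); exact: sub_sigma_algebra.
Qed.

(** The centred indicator of an event of [Z j] has null mean on the rectangles built from [G] and
    [Z i], so [null_on_join] applies. Sample [i] may thus be counted as part of the past of sample
    [j]. *)
Lemma fresh_indep_pair i j : i != j ->
  indep_of P law (G `|` preimages i) (Z j).
Proof.
move=> ij C E GC mE; set e := fun w => \1_(Z j @^-1` E) w - fine (law E).
have mZE k B : measurable B -> measurable (Z k @^-1` B).
  by move=> mB; rewrite -[X in measurable X]setTI; exact: fresh_measurable.
have finP (A : set T) : measurable A -> (P A = (fine (P A))%:E)%E.
  by move=> mA; rewrite fineK // fin_num_measure.
have finL : (law E = (fine (law E))%:E)%E by rewrite fineK // fin_num_measure.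
have Li A : measurable A -> L1 P (\1_A) by move=> mA; exact: integrable_indic.
have Le : L1 P e by apply: L1B; [apply: Li; exact: mZE|exact: L1_cst].
have eA A : measurable A -> mean P (fun w => \1_A w * e w) =
    fine (P (A `&` Z j @^-1` E)) - fine (P A) * fine (law E).
  move=> mA; rewrite -(mean_indic P mA) -(mean_indic P (measurableI _ _ mA (mZE j E mE))).
  rewrite mulrC -meanZl; last exact: Li.
  rewrite -meanB; last 2 first.
  - by apply: Li; apply: measurableI => //; exact: mZE.
  - by apply: L1Zl; exact: Li.
  by congr mean; apply/funext => w; rewrite indicI /= mulrBr [fine _ * _]mulrC.
have mC := @sub_join i _ GC.
suff /(_ C GC) : null_on P (G `|` preimages i) e.
  rewrite eA // => /eqP; rewrite subr_eq0 => /eqP h.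
  by rewrite (finP C mC) finL (finP _ (measurableI _ _ mC (mZE j E mE))) -EFinM h.
apply: null_on_join => //; first exact: sub_preimages.
(* Preimages of measurable sets already form a sigma-algebra, so every generated event is one of
   them. *)
move=> A B GA; rewrite sigma_algebra_id; last first.
  exact/sigma_algebra_preimage/sigma_algebra_measurable.
move=> [B' mB' <-]; rewrite setTI eA; last first.
  by apply: measurableI; [exact: Gm|exact: mZE].
rewrite (fresh_indep i) //.
have [_ /(_ A (fun k => if k == i then B' else if k == j then E else setT))] := fZ.
rewrite (bigD1 i) //= eqxx (bigD1 j) /=; last by rewrite eq_sym.
rewrite eq_sym (negbTE ij) eqxx big1 ?mule1; last first.
  by move=> k /andP[/negbTE -> /negbTE ->]; rewrite probability_setT.
rewrite (_ : \bigcap_ _ _ = Z i @^-1` B' `&` Z j @^-1` E); last first.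
  apply/seteqP; split=> [w h|w [h1 h2] k _ /=].
    have := h i Logic.I; have := h j Logic.I.
    by rewrite /= !eqxx (eq_sym j) (negbTE ij).
  by case: eqP => [->//|_]; case: eqP => [->|].
rewrite setIA => -> //; last by move=> k; case: ifP => // _; case: ifP.
have -> : (law B' = (fine (law B'))%:E)%E by rewrite fineK // fin_num_measure.
rewrite finL (finP A (Gm GA)).
by rewrite -?EFinM /= mulrA subrr.
Qed.

End Sampling.

Section SampleMean.
Context {R : realType} {disp : measure_display} {T : measurableType disp} {d : nat}.
Variables (P : probability T R) (law : probability (d.-tuple R) R).
Variables (G : set (set T)) (I : finType) (Z : I -> T -> d.-tuple R).
Hypotheses (Gm : <<s G >> `<=` measurable) (fZ : fresh_samples P <<s G >> law Z).
Variable psi : g_sigma_algebraType G * (d.-tuple R) -> R.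
Hypothesis mpsi : measurable_fun setT psi.
Hypothesis Lpsi : forall w, L1 law (fun z => psi (w, z)).
Hypothesis psi0 : forall w, mean law (fun z => psi (w, z)) = 0.
Variables (v : R) (Y : T -> R).
Hypothesis Lpsi2 : forall i, L1 P (fun w => psi (w, Z i w) ^+ 2).
Hypothesis psi2v : forall i, mean P (fun w => psi (w, Z i w) ^+ 2) <= v.
Hypotheses (mY : measurable_wrt G Y) (LY2 : L1 P (fun w => Y w ^+ 2)).

Let xi i w := psi (w, Z i w).

Let mxi i : measurable_fun setT (xi i).
Proof. exact: indep_measurable_fun Gm (fresh_measurable fZ i) _ mpsi. Qed.

Let mYf : measurable_fun setT Y. Proof. exact: measurable_wrtW Gm mY. Qed.

Let LYxi i : L1 P (fun w => Y w * xi i w).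
Proof. by apply: L1_mul_sqr => //; exact: Lpsi2. Qed.

Let Lxixi i j : L1 P (fun w => xi i w * xi j w).
Proof. by apply: L1_mul_sqr => //; exact: Lpsi2. Qed.

Let Yxi i : mean P (fun w => Y w * xi i w) = 0.
Proof.
pose g (p : g_sigma_algebraType G * (d.-tuple R)) := Y p.1 * psi p.
have mg : measurable_fun setT g.
  by apply: measurable_funM => //; exact: measurableT_comp measurable_fst.
apply: (indep_mean_eq0 Gm (fresh_measurable fZ i) (fresh_indep fZ i) mg).
- by move=> w; exact: (L1Zl (Y w) (Lpsi w)).
- by move=> w; rewrite /g /= meanZl ?psi0 ?mulr0 //; exact: Lpsi.
- exact: LYxi.
Qed.

(** Once sample [i] is adjoined to the past, [xi i] is known while [Z j] is still independent, and
    freezing applies as for [Y]. *)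
Let xixj i j : i != j -> mean P (fun w => xi i w * xi j w) = 0.
Proof.
move=> ij; pose G' := G `|` preimages Z i.
have G'm := sub_join Gm fZ (i := i).
have GG' : <<s G >> `<=` <<s G' >> by apply: sub_sigma_algebra2; exact: subsetUl.
pose g (p : g_sigma_algebraType G' * (d.-tuple R)) := xi i p.1 * psi p.
have mid : measurable_fun setT (id : g_sigma_algebraType G' -> g_sigma_algebraType G).
  by move=> _ B mB; rewrite setTI preimage_id; exact: GG'.
have mZ : measurable_fun setT (Z i : g_sigma_algebraType G' -> _).
  by move=> _ B mB; apply: sub_sigma_algebra; right; exists B.
have mxi' : measurable_fun setT (xi i : g_sigma_algebraType G' -> R).
  have mp : measurable_fun setT (fun w : g_sigma_algebraType G' =>
      (w, Z i w) : g_sigma_algebraType G * _) by apply/measurable_fun_pairP; split.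
  exact: (measurableT_comp mpsi mp).
have mpsi' : measurable_fun setT (psi : g_sigma_algebraType G' * _ -> R).
  have mp : measurable_fun setT (fun p : g_sigma_algebraType G' * (d.-tuple R) =>
      (p.1, p.2) : g_sigma_algebraType G * _).
    apply/measurable_fun_pairP; split; last exact: measurable_snd.
    exact: (measurableT_comp mid measurable_fst).
  by have := measurableT_comp mpsi mp; apply: eq_measurable_fun => -[].
have mg : measurable_fun setT g.
  by apply: measurable_funM => //; exact: measurableT_comp measurable_fst.
apply: (indep_mean_eq0 G'm (fresh_measurable fZ j) (fresh_indep_pair Gm fZ ij) mg).
- by move=> w; exact: (L1Zl (xi i w) (Lpsi w)).
- by move=> w; rewrite /g /= meanZl ?psi0 ?mulr0 //; exact: Lpsi.
- exact: Lxixi.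
Qed.

(** All cross terms vanish, so only the diagonal remains. With [c] the inverse of the batch size the
    extra term is [v] over that size; [Y] is 0 at a refresh and the preceding error otherwise. *)
Lemma sample_mean_sqr c :
  L1 P (fun w => (Y w + c * \sum_i psi (w, Z i w)) ^+ 2) /\
  mean P (fun w => (Y w + c * \sum_i psi (w, Z i w)) ^+ 2) <=
    mean P (fun w => Y w ^+ 2) + c ^+ 2 * (#|I|%:R * v).
Proof.
have -> : (fun w => (Y w + c * \sum_i psi (w, Z i w)) ^+ 2) =
   (fun w => Y w ^+ 2 + (2 * c) * (\sum_i Y w * xi i w) +
             c ^+ 2 * (\sum_i \sum_j xi i w * xi j w)).
  apply/funext => w; rewrite sqrrD exprMn; congr (_ + _ + _ * _).
    by rewrite mulr_sumr /xi -mulr_natl !mulr_sumr; apply: eq_bigr => i _; ring.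
  by rewrite expr2 mulr_suml; apply: eq_bigr => i _; rewrite mulr_sumr.
have L1s : L1 P (fun w => (2 * c) * (\sum_i Y w * xi i w)) by apply/L1Zl/L1_sum.
have L2s : L1 P (fun w => \sum_i \sum_j xi i w * xi j w).
  by apply: L1_sum => i _; apply: L1_sum.
have L12 := L1D LY2 L1s.
split; first exact: L1D L12 (L1Zl _ L2s).
rewrite (meanD L12 (L1Zl _ L2s)) (meanD LY2 L1s) meanZl; last exact: L1_sum.
rewrite mean_sum // big1 // mulr0 addr0 lerD2l meanZl // ler_wpM2l ?sqr_ge0 //.
rewrite mean_sum => [|i _]; last exact: L1_sum.
apply: (@le_trans _ _ (\sum_(i : I) v)); last first.
  by rewrite sumr_const mulr_natl.
apply: ler_sum => i _; rewrite mean_sum // (bigD1 i) //= big1 ?addr0.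
  by have := psi2v i; under eq_fun do rewrite expr2.
by move=> j ji; rewrite xixj // eq_sym.
Qed.

End SampleMean.

(** * Conditional noise and conditional independence *)

Section CondExp.
Context {R : realType} {disp : measure_display} {T : measurableType disp}.
Variable P : probability T R.
Implicit Types (G : set (set T)) (f e V Z Y : T -> R).

(** The event where [V] is positive belongs to [G]; there the integral of [V] is both nonnegative
    and at most 0, so the event is null. *)
Lemma cond_le0 G V : <<s G >> `<=` measurable -> measurable_wrt G V -> L1 P V ->
  (forall A, <<s G >> A -> mean P (fun w => \1_A w * V w) <= 0) ->
  {ae P, forall w, V w <= 0}.
Proof.
move=> Gm mV LV hV; pose A := [set w | 0 < V w].
have GA : <<s G >> A.
  have -> : A = V @^-1` `]0, +oo[%classic.
    by apply/seteqP; split => w; rewrite /A /= in_itv /= andbT.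
  rewrite -[X in <<s _ >> X]setTI; apply: mV => //; exact: measurable_itv.
have LAV := L1_indic_mul (Gm _ GA) LV.
have AV0 w : 0 <= \1_A w * V w.
  rewrite indicE; case: (boolP (w \in A)) => [/set_mem|_]; rewrite ?mul0r // mul1r.
  exact: ltW.
have m0 : mean P (fun w => \1_A w * V w) = 0.
  by apply/eqP; rewrite eq_le hV //= mean_ge0.
have : ae_eq P setT (fun w => (\1_A w * V w)%:E) (cst 0%E).
  apply/(ae_eq_integral_abs P measurableT (measurable_int P LAV)).
  rewrite (eq_integral (fun w => (\1_A w * V w)%:E)).
    by rewrite mean_fin // m0.
  by move=> w _; rewrite /= ger0_norm.
apply: filterS => w /(_ Logic.I) [h]; rewrite leNgt; apply/negP => Vw.
move: h; rewrite indicE mem_set // mul1r => h.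
by move: Vw; rewrite h ltxx.
Qed.

Lemma cond_le G f g : <<s G >> `<=` measurable -> measurable_wrt G f ->
  measurable_wrt G g -> L1 P f -> L1 P g ->
  (forall A, <<s G >> A ->
    mean P (fun w => \1_A w * f w) <= mean P (fun w => \1_A w * g w)) ->
  {ae P, forall w, f w <= g w}.
Proof.
move=> Gm mf mg Lf Lg fg.
have : {ae P, forall w, f w - g w <= 0}.
  apply: (cond_le0 Gm); [exact: measurable_funB|exact: L1B|] => A GA.
  have mA := Gm _ GA.
  under eq_fun do rewrite mulrBr.
  by rewrite meanB ?subr_le0 ?fg //; exact: L1_indic_mul.
by apply: filterS => w; rewrite subr_le0.
Qed.

Lemma condexpP G Z Y : <<s G >> `<=` measurable -> is_condexp P <<s G >> Z Y ->
  [/\ L1 P Z, L1 P Y, measurable_wrt G Y & forall A, <<s G >> A ->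
    mean P (fun w => \1_A w * Z w) = mean P (fun w => \1_A w * Y w)].
Proof.
move=> Gm [LZ LY mY h]; split => //.
  by move=> _ B mB; rewrite setTI; exact: mY.
move=> A GA; have mA := Gm _ GA; apply: EFin_inj.
by rewrite -!mean_restrict // h.
Qed.

(** The conditional bound on the second moment is used only integrated over the whole space. *)
Lemma cond_noiseP G sigma (m : nat) (e : T -> 'rV[R]_m) :
  <<s G >> `<=` measurable -> cond_noise P <<s G >> sigma e ->
  [/\ forall i, L1 P (fun w => e w 0 i), forall i, null_on P G (fun w => e w 0 i),
      L1 P (fun w => enorm (e w) ^+ 2) &
      mean P (fun w => enorm (e w) ^+ 2) <= sigma ^+ 2].
Proof.
move=> Gm [he [Y cY Ys]]; split.
- by move=> i; have [] := condexpP Gm (he i).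
- move=> i A GA; have [_ _ _ ->] := condexpP Gm (he i) => //.
  under eq_fun do rewrite mulr0.
  exact: mean_cst.
- by have [] := condexpP Gm cY.
- have [LZ LY _ h] := condexpP Gm cY.
  have GT : <<s G >> setT by exact: (@measurableT _ (g_sigma_algebraType G)).
  have T1 (f : T -> R) : (fun w => \1_[set: T] w * f w) = f.
    by apply/funext => w; rewrite indicE in_setT mul1r.
  have := h _ GT; rewrite !T1.
  move=> ->; rewrite -[leRHS](mean_cst P); apply: mean_le => //.
  exact: L1_cst.
Qed.

Lemma L1_sqr_coord (m : nat) (e : T -> 'rV[R]_m) i :
  measurable_fun setT (fun w => e w 0 i) -> L1 P (fun w => enorm (e w) ^+ 2) ->
  L1 P (fun w => e w 0 i ^+ 2).
Proof.
move=> me; apply: L1_dominated; first exact: measurable_funX.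
apply: aeW => w; rewrite ger0_norm ?sqr_ge0 // -real_normK ?num_real //.
by rewrite ler_pXn2r ?nnegrE ?enorm_ge0 // ler_coord_enorm.
Qed.

(* Conditionally on G, e is independent of H i1 with zero mean, so it also has
   zero mean conditionally on the join of G and H i1. *)
Lemma cond_independent_null_on G (I : finType) (H : I -> set (set T)) i1 i2 e :
  <<s G >> `<=` measurable -> (forall i, <<s H i >> `<=` measurable) ->
  cond_independent P <<s G >> (fun i => <<s H i >>) -> i1 != i2 ->
  measurable_wrt (H i2) e -> L1 P e -> null_on P G e ->
  null_on P (G `|` H i1) e.
Proof.
move=> Gm Hm ci i12 me Le Ge.
have HT i : <<s H i >> setT by exact: (@measurableT _ (g_sigma_algebraType (H i))).
have L1A A : measurable A -> L1 P (\1_A) by move=> mA; exact: integrable_indic.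
apply: null_on_join => // C A GC HA.
have mC := Gm _ GC; have mA := Hm _ _ HA.
(* The whole space at the other indices, whose conditional probability is 1, reduces the family to
   the pair i1, i2. *)
pose fam A B i := if i == i1 then A else if i == i2 then B else setT : set T.
have Hfam B : <<s H i2 >> B -> forall i, <<s H i >> (fam A B i).
  by move=> HB i; rewrite /fam; case: eqP => [->//|_]; case: eqP => [->|].
have fam_cap B : \bigcap_i fam A B i = A `&` B.
  apply/seteqP; split=> [w h|w [h1 h2] k _ /=].
    have := h i1 Logic.I; have := h i2 Logic.I.
    by rewrite /fam /= !eqxx (eq_sym i2) (negbTE i12).
  by rewrite /fam; case: eqP => // _; case: eqP.
have bounds (A' : set T) Y : measurable A' -> is_condexp P <<s G >> \1_A' Y ->
    {ae P, forall w, `|Y w| <= 1}.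
  move=> mA' /(condexpP Gm)[LZ LY mY h].
  have : {ae P, forall w, Y w <= 1}.
    apply: (cond_le Gm mY (measurable_cst _) LY (L1_cst _ _)) => B GB.
    rewrite -h //; apply: mean_le.
    - exact: L1_indic_mul (Gm _ GB) LZ.
    - exact: L1_indic_mul (Gm _ GB) (L1_cst _ _).
    - apply: aeW => w; rewrite ler_wpM2l //.
      exact: le_trans (ler_norm _) (indic_le1 _ _).
  have : {ae P, forall w, 0 <= Y w}.
    apply: (cond_le Gm (measurable_cst _) mY (L1_cst _ _) LY) => B GB.
    rewrite -h //; apply: mean_le.
    - exact: L1_indic_mul (Gm _ GB) (L1_cst _ _).
    - exact: L1_indic_mul (Gm _ GB) LZ.
    - by apply: aeW => w; rewrite mulr0 mulr_ge0 // indicE.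
  by apply: filterS2 => w Y0 Y1; rewrite ger0_norm.
(* Fixes one version [YA] of P(A | G); those supplied later for each [B] agree with it almost
   everywhere. *)
have [Y0 Y0c _] := ci _ (Hfam setT (HT i2)).
have := Y0c i1; rewrite /fam eqxx; set YA := Y0 i1 => YAc.
have [_ LYA mYA hYA] := condexpP Gm YAc.
have bYA := bounds _ _ mA YAc.
pose V w := \1_C w * YA w.
have mV : measurable_wrt G V.
  have m1 : measurable_wrt G (\1_C : T -> R).
    by apply: (@measurable_indic _ (g_sigma_algebraType G)).
  exact: (measurable_funM m1 mYA).
have bV : {ae P, forall w, `|V w| <= 1}.
  move: bYA; apply: filterS => w h; rewrite /V normrM.
  by rewrite mulr_ile1 // indic_le1.
have mVf := measurable_wrtW Gm mV.
have LV : L1 P V by exact: L1_bounded mVf bV.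
(* [D] is the indicator of C and A minus 1_C P(A | G). If it is null on [H i2], then E[e D] = 0; the
   part with P(A | G) vanishes as [e] is null on [G], leaving the integral of [e] over the
   rectangle. *)
pose D w := \1_(C `&` A) w - V w.
have mCA : measurable (C `&` A) by exact: measurableI.
have LD : L1 P D by apply: L1B => //; exact: L1A.
suff HD : null_on P (H i2) D.
  have LeD : L1 P (fun w => e w * D w).
    under eq_fun do rewrite mulrC.
    apply: (@L1_mul_bounded _ _ _ _ _ _ 2) => //; first exact: L1_measurable LD.
    move: bV; apply: filterS => w h; rewrite /D (le_trans (ler_normB _ _)) //.
    by have := indic_le1 (C `&` A) w (R := R); lra.
  have := null_on_mul (Hm i2) LD HD me LeD.
  have LVe : L1 P (fun w => V w * e w) by exact: L1_mul_bounded mVf bV Le.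
  have Ve := null_on_mul Gm Le Ge mV LVe.
  have -> : (fun w => e w * D w) = (fun w => \1_(C `&` A) w * e w - V w * e w).
    by apply/funext => w; rewrite /D; ring.
  by rewrite meanB ?Ve ?subr0 //; exact: L1_indic_mul.
move=> B HB; have mB := Hm _ _ HB.
have [Y Yc] := ci _ (Hfam B HB); rewrite fam_cap => /(condexpP Gm)[_ LprodY mprodY hprod].
have famm i : measurable (fam A B i) by apply: (Hm i); exact: Hfam.
have Y1 : {ae P, forall w, Y i1 w = YA w}.
  have := Yc i1; rewrite /fam eqxx => /(condexpP Gm)[_ LY1 mY1 hY1].
  have a : {ae P, forall w, Y i1 w <= YA w}.
    by apply: (cond_le Gm) => // B' GB'; rewrite -hY1 // hYA.
  have b : {ae P, forall w, YA w <= Y i1 w}.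
    by apply: (cond_le Gm) => // B' GB'; rewrite -hY1 // hYA.
  by move: a b; apply: filterS2 => w a b; apply/eqP; rewrite eq_le a b.
have Yother i : i != i1 -> i != i2 -> {ae P, forall w, Y i w = 1}.
  move=> ni1 ni2; have := Yc i; rewrite /fam (negbTE ni1) (negbTE ni2).
  move=> /(condexpP Gm)[_ LYi mYi hYi].
  have hT B' : mean P (fun w => \1_B' w * \1_[set: T] w) = mean P (fun w => \1_B' w * 1).
    by congr mean; apply/funext => w; rewrite [\1_[set: T] w]indicE in_setT.
  have a : {ae P, forall w, Y i w <= 1}.
    apply: (cond_le Gm mYi (measurable_cst _) LYi (L1_cst _ _)) => B' GB'.
    by rewrite -hYi // hT.
  have b : {ae P, forall w, 1 <= Y i w}.
    apply: (cond_le Gm (measurable_cst _) mYi (L1_cst _ _) LYi) => B' GB'.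
    by rewrite -hYi // hT.
  by move: a b; apply: filterS2 => w a b; apply/eqP; rewrite eq_le a b.
have prodE : {ae P, forall w, \prod_i Y i w = YA w * Y i2 w}.
  have h : {ae P, forall w, forall i, i != i1 -> i != i2 -> Y i w = 1}.
    apply: filter_forall => i.
    have [->|ni1] := eqVneq i i1; first exact: aeW.
    have [->|ni2] := eqVneq i i2; first exact: aeW.
    by apply: filterS (Yother i ni1 ni2) => w ->.
  move: Y1 h; apply: filterS2 => w Y1w h.
  rewrite (bigD1 i1) //= (bigD1 i2) /=; last by rewrite eq_sym.
  by rewrite big1 ?mulr1 ?Y1w // => i /andP[i1' i2']; exact: h.
have := Yc i2; rewrite /fam (eq_sym i2) (negbTE i12) eqxx.
move=> /(condexpP Gm)[L1B' LY2 mY2 hY2].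
(* Since 1_B - P(B | G) is null on [G] and [V] is measurable for [G], P(B | G) may be replaced by
   1_B in the factorised probability. *)
pose e2 w := \1_B w - Y i2 w.
have Le2 : L1 P e2 by exact: L1B.
have Ge2 : null_on P G e2.
  move=> B' GB'; have mB' := Gm _ GB'; rewrite /e2.
  under eq_fun do rewrite mulrBr.
  by rewrite meanB ?hY2 ?subrr //; exact: L1_indic_mul.
have LVe2 : L1 P (fun w => V w * e2 w) by exact: L1_mul_bounded mVf bV Le2.
have Ve2 := null_on_mul Gm Le2 Ge2 mV LVe2.
have LVB : L1 P (fun w => V w * \1_B w) by exact: L1_mul_bounded mVf bV (L1A _ mB).
have LVY : L1 P (fun w => V w * Y i2 w) by exact: L1_mul_bounded mVf bV LY2.
have VBY : mean P (fun w => V w * \1_B w) = mean P (fun w => V w * Y i2 w).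
  apply/eqP; rewrite -subr_eq0 -meanB // -[X in _ == X]Ve2; apply/eqP; congr mean.
  by apply/funext => w; rewrite /e2 mulrBr.
have CAB : mean P (fun w => \1_B w * \1_(C `&` A) w) = mean P (fun w => V w * Y i2 w).
  transitivity (mean P (fun w => \1_C w * \1_(A `&` B) w)).
    by congr mean; apply/funext => w; rewrite !indicI /=; ring.
  rewrite hprod //; apply: mean_ae => //; first exact: L1_indic_mul.
  by move: prodE; apply: filterS => w ->; rewrite /V mulrA.
rewrite /D; under eq_fun do rewrite mulrBr.
rewrite meanB; last 2 first.
- by apply: L1_indic_mul => //; exact: L1A.
- exact: L1_indic_mul.
rewrite CAB -VBY; apply/eqP; rewrite subr_eq0; apply/eqP; congr mean.
by apply/funext => w; rewrite mulrC.
Qed.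

End CondExp.

(** * The mean-semideviation risk *)

Lemma weakly_convexI (R : realType) (n : nat) (U : set 'rV[R]_n) (c : R)
    (q : 'rV[R]_n -> R) :
  (forall x y t, U x -> U y -> 0 <= t <= 1 ->
    q ((1 - t) *: x + t *: y) <=
      (1 - t) * q x + t * q y + c / 2 * (t * (1 - t) * enorm (x - y) ^+ 2)) ->
  weakly_convex U c q.
Proof.
move=> h t x y; rewrite !inE => Ux Uy.
have t01 : 0 <= t%:num <= 1 by apply/andP; split.
have := h y x t%:num Uy Ux t01.
rewrite addrC => h1.
suff : q (t%:num *: x + (1 - t%:num) *: y) +
    c / 2 * enorm (t%:num *: x + (1 - t%:num) *: y) ^+ 2 <=
  t%:num * (q x + c / 2 * enorm x ^+ 2) +
    (1 - t%:num) * (q y + c / 2 * enorm y ^+ 2) by [].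
have := enorm_sq_conv t%:num y x 0; rewrite !subr0 addrC => ->.
by lra.
Qed.

Section Joint.
Context {R : realType} {n : nat}.
Implicit Types (x : 'rV[R]_n) (g h : 'rV[R]_(n + 1)) (u : R).

Lemma dotv_joint g h :
  dotv g h = dotv (lsubmx g) (lsubmx h) + rsubmx g 0 0 * rsubmx h 0 0.
Proof.
rewrite /dotv big_split_ord /=; congr (_ + _).
  by apply: eq_bigr => i _; rewrite !mxE.
by rewrite big_ord1 !mxE.
Qed.

Lemma enorm_lsubmx_le g : enorm (lsubmx g) ^+ 2 <= enorm g ^+ 2.
Proof. by rewrite !enorm_sqr [leRHS]dotv_joint lerDl -expr2 sqr_ge0. Qed.

End Joint.

Section Model.
Context {R : realType} {n d : nat}.
Variable law : probability (d.-tuple R) R.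
Variable loss : 'rV[R]_n -> d.-tuple R -> R.
Variables (kappa : R) (U : set 'rV[R]_n) (deltat : d.-tuple R -> R).
Hypothesis kappa01 : 0 <= kappa <= 1.
Hypothesis cU : convex_set U.
Hypothesis Lloss : forall x, U x -> law.-integrable setT (EFin \o loss x).
Hypothesis Ldelta : law.-integrable setT (EFin \o deltat).
Hypothesis wloss :
  {ae law, forall z, 0 <= deltat z /\ weakly_convex U (deltat z) (loss ^~ z)}.

Local Notation delta := (mean law deltat).
Local Notation h := (risk law loss).
Local Notation f := (semidev law loss kappa).
Local Notation F := (mean_semidev law loss kappa).

Lemma delta_ge0 : 0 <= delta.
Proof.
rewrite -(mean_cst law 0); apply: mean_le => //; first exact: L1_cst.
by move: wloss; apply: filterS => z [].
Qed.

Lemma L1_semidev x v : U x -> L1 law (fun z => v + kappa * Num.max 0 (loss x z - v)).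
Proof.
move=> Ux; have Lx := Lloss Ux; have mx := L1_measurable Lx.
apply: L1D; first exact: L1_cst.
apply: L1Zl; apply: (L1_dominated (g := fun z => `|loss x z - v|)).
- by apply: measurable_maxr => //; exact: measurable_funB.
- apply: aeW => z; rewrite ger0_norm ?le_max ?lexx //.
  by rewrite ge_max normr_ge0 ler_norm.
- by apply: L1_norm; apply: L1B => //; exact: L1_cst.
Qed.

Lemma risk_segment x y t : U x -> U y -> 0 <= t <= 1 ->
  h ((1 - t) *: x + t *: y) <=
    (1 - t) * h x + t * h y + delta / 2 * (t * (1 - t) * enorm (x - y) ^+ 2).
Proof.
move=> Ux Uy t01; set D := t * (1 - t) * enorm (x - y) ^+ 2.
have Ut := convex_set_comb cU Ux Uy t01.
have Lx : L1 law (loss x) by exact: Lloss.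
have Ly : L1 law (loss y) by exact: Lloss.
have -> : (1 - t) * h x + t * h y + delta / 2 * D =
  mean law (fun z => (1 - t) * loss x z + t * loss y z + D / 2 * deltat z).
  rewrite (meanD (L1D (L1Zl _ Lx) (L1Zl _ Ly)) (L1Zl _ Ldelta)).
  rewrite (meanD (L1Zl _ Lx) (L1Zl _ Ly)) (meanZl _ Lx) (meanZl _ Ly) (meanZl _ Ldelta).
  by rewrite /mean /risk; ring.
apply: mean_le; first exact: Lloss.
- exact: (L1D (L1D (L1Zl _ Lx) (L1Zl _ Ly)) (L1Zl _ Ldelta)).
- move: wloss; apply: filterS => z [_ /weakly_convexP] /(_ _ _ _ Ux Uy t01).
  by rewrite -/D; lra.
Qed.

(** The positive part is convex and nondecreasing, so it inherits the defect of the loss,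
    nonnegative as [deltat z >= 0]. Only this part carries a defect, with weight [kappa]: the
    modulus is kappa delta, with no quadratic in the second variable. *)
Lemma semidev_segment x y v w t : U x -> U y -> 0 <= t <= 1 ->
  f ((1 - t) *: x + t *: y) ((1 - t) * v + t * w) <=
    (1 - t) * f x v + t * f y w +
    kappa * delta / 2 * (t * (1 - t) * enorm (x - y) ^+ 2).
Proof.
move=> Ux Uy t01; set D := t * (1 - t) * enorm (x - y) ^+ 2.
have /andP[t0 t1] := t01; have /andP[k0 k1] := kappa01.
have D0 : 0 <= D by rewrite mulr_ge0 ?sqr_ge0 // mulr_ge0 // subr_ge0.
have Ut := convex_set_comb cU Ux Uy t01.
have -> : (1 - t) * f x v + t * f y w + kappa * delta / 2 * D =
  mean law (fun z => (1 - t) * (v + kappa * Num.max 0 (loss x z - v)) +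
    t * (w + kappa * Num.max 0 (loss y z - w)) + kappa * D / 2 * deltat z).
  rewrite (meanD (L1D (L1Zl _ (L1_semidev _ Ux)) (L1Zl _ (L1_semidev _ Uy))) (L1Zl _ Ldelta)).
  rewrite (meanD (L1Zl _ (L1_semidev _ Ux)) (L1Zl _ (L1_semidev _ Uy))).
  rewrite (meanZl _ (L1_semidev _ Ux)) (meanZl _ (L1_semidev _ Uy)) (meanZl _ Ldelta).
  by rewrite /semidev /mean; ring.
apply: mean_le; first exact: L1_semidev.
- exact: (L1D (L1D (L1Zl _ (L1_semidev _ Ux)) (L1Zl _ (L1_semidev _ Uy))) (L1Zl _ Ldelta)).
- move: wloss; apply: filterS => z [d0 /weakly_convexP] /(_ _ _ _ Ux Uy t01).
  rewrite -/D => hz.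
  set a := Num.max 0 (loss x z - v); set b := Num.max 0 (loss y z - w).
  suff : Num.max 0 (loss ((1 - t) *: x + t *: y) z - ((1 - t) * v + t * w)) <=
     (1 - t) * a + t * b + D / 2 * deltat z.
    by move=> /(ler_wpM2l k0); lra.
  have a0 : 0 <= a by rewrite le_max lexx.
  have b0 : 0 <= b by rewrite le_max lexx.
  have a1 : loss x z - v <= a by rewrite le_max lexx orbT.
  have b1 : loss y z - w <= b by rewrite le_max lexx orbT.
  have Dd : 0 <= D * deltat z by rewrite mulr_ge0.
  have t1' : 0 <= 1 - t by rewrite subr_ge0.
  have := ler_wpM2l t0 b1; have := ler_wpM2l t1' a1.
  have := mulr_ge0 t0 b0; have := mulr_ge0 t1' a0 => *.
  by rewrite ge_max; apply/andP; split; lra.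
Qed.

(** As a function of v, v + kappa max(0, l - v) has slopes in [1 - kappa, 1]. *)
Lemma semidev_mono x v w : U x -> v <= w -> f x v <= f x w <= f x v + (w - v).
Proof.
move=> Ux vw; have /andP[k0 k1] := kappa01; apply/andP; split.
  apply: mean_le; [exact: L1_semidev|exact: L1_semidev|apply: aeW => z].
  have : Num.max 0 (loss x z - v) <= Num.max 0 (loss x z - w) + (w - v).
    rewrite ge_max; apply/andP; split.
      by apply: addr_ge0; rewrite ?subr_ge0 // le_max lexx.
    have : loss x z - w <= Num.max 0 (loss x z - w) by rewrite le_max lexx orbT.
    by lra.
  move=> /(ler_wpM2l k0); have : kappa * (w - v) <= w - v by rewrite ler_piMl ?subr_ge0.
  by lra.
rewrite -(mean_cst law (w - v)) -meanD; [|exact: L1_semidev|exact: L1_cst].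
apply: mean_le; [exact: L1_semidev| |apply: aeW => z].
  by apply: L1D; [exact: L1_semidev|exact: L1_cst].
suff : Num.max 0 (loss x z - w) <= Num.max 0 (loss x z - v).
  by move=> /(ler_wpM2l k0); lra.
rewrite ge_max le_max lexx /= le_max; apply/orP; right.
by rewrite lerB.
Qed.

(** The defect kappa delta comes from [f], and delta from [h] through its second argument. Their sum
    (1 + kappa) delta is relaxed to the stated rho. *)
Lemma mean_semidev_segment x y t : U x -> U y -> 0 <= t <= 1 ->
  F ((1 - t) *: x + t *: y) <= (1 - t) * F x + t * F y +
    (1 + 2 * kappa) * delta / 2 * (t * (1 - t) * enorm (x - y) ^+ 2).
Proof.
move=> Ux Uy t01; have := semidev_segment (h x) (h y) Ux Uy t01.
have := risk_segment Ux Uy t01.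
set D := t * (1 - t) * enorm (x - y) ^+ 2 => h1 h2.
have /andP[t0 t1] := t01; have /andP[k0 k1] := kappa01.
have D0 : 0 <= D by rewrite mulr_ge0 ?sqr_ge0 // mulr_ge0 // subr_ge0.
have dD := mulr_ge0 delta_ge0 D0.
have kdD := mulr_ge0 k0 dD.
have Ut := convex_set_comb cU Ux Uy t01.
have /andP[m1 _] := semidev_mono Ut h1.
move: Ut h1 h2 m1; rewrite /mean_semidev.
move: (_ + t * h y) (_ + t *: y) => v xt Ut h1 h2 m1; clearbody D.
have vv : v <= v + delta / 2 * D by rewrite lerDl mulrAC divr_ge0.
have /andP[_ m2] := semidev_mono Ut vv.
apply: (le_trans m1); apply: (le_trans m2); apply: (le_trans (lerD h2 (lexx _))).
rewrite -addrA lerD2l; clear h1 h2 m1 m2 vv.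
by move: dD kdD; move: (mean _ _) => dl dD kdD; lra.
Qed.

Lemma joint_segment p p' t : U (lsubmx p) -> U (lsubmx p') -> 0 <= t <= 1 ->
  semidev_joint law loss kappa ((1 - t) *: p + t *: p') <=
  (1 - t) * semidev_joint law loss kappa p + t * semidev_joint law loss kappa p' +
  t * (1 - t) * (kappa * delta / 2 * enorm (lsubmx p - lsubmx p') ^+ 2).
Proof.
move=> Up Up' t01; have := semidev_segment (rsubmx p 0 0) (rsubmx p' 0 0) Up Up' t01.
rewrite /semidev_joint linearD !linearZ /= linearD !linearZ /= !mxE; lra.
Qed.

Lemma convex_cylinder : convex_set [set p : 'rV[R]_(n + 1) | U (lsubmx p)].
Proof.
move=> p q t; rewrite !inE /= => Up Uq.
have := cU t (mem_set Up) (mem_set Uq); rewrite inE.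
by congr (U _); rewrite /conv /= linearD !linearZ.
Qed.

Section Subgradients.
Variables (x : 'rV[R]_n) (u : R) (gf : 'rV[R]_(n + 1)).
Hypothesis Ux : U x.
Hypothesis hgf : subdiff [set p | U (lsubmx p)] (semidev_joint law loss kappa)
  (row_mx x (const_mx u)) gf.

(** [subdiff] only provides some constant, with a quadratic in the whole vector; the segment
    inequality trades it for kappa delta acting on x alone. *)
Lemma joint_subgradient y v : U y ->
  f x u + dotv (lsubmx gf) (y - x) + rsubmx gf 0 0 * (v - u) -
    kappa * delta / 2 * enorm (y - x) ^+ 2 <= f y v.
Proof.
move=> Uy.
have := @subdiff_segment _ _ _ _ _ (row_mx y (const_mx v)) _
  (kappa * delta / 2 * enorm (x - y) ^+ 2) hgf.
rewrite /= !row_mxKl => /(_ Ux Uy convex_cylinder).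
rewrite dotv_joint !linearB /= !row_mxKl !row_mxKr !mxE (enorm_sub y x).
rewrite /semidev_joint !row_mxKl !row_mxKr !mxE addrA; apply.
move=> t t01; have := @joint_segment (row_mx x (const_mx u)) (row_mx y (const_mx v)) t.
by rewrite /semidev_joint !row_mxKl !row_mxKr !mxE; apply.
Qed.

(** Testing at the same point with v = u + 1 and v = u - 1 against the slopes of [f] in its second
    variable. *)
Lemma joint_subgradient_u : 0 <= rsubmx gf 0 0 <= 1.
Proof.
have := joint_subgradient (u + 1) Ux; have := joint_subgradient (u - 1) Ux.
rewrite subrr enorm0 dotvC dotv0l.
have /andP[_] := @semidev_mono x u (u + 1) Ux ltac:(lra).
have /andP[+ _] := @semidev_mono x (u - 1) u Ux ltac:(lra).
by move=> *; apply/andP; split; lra.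
Qed.

(** Freezing u makes the bound [Dfx], stated for partial subgradients, available for the x-block of
    a joint one. *)
Lemma joint_subgradient_x : subdiff U (f ^~ u) x (lsubmx gf).
Proof.
exists (kappa * delta).
  apply: weakly_convexI => y z t Uy Uz t01.
  have := semidev_segment u u Uy Uz t01.
  by rewrite (_ : (1 - t) * u + t * u = u) //; ring.
by move=> y Uy; have := joint_subgradient u Uy; rewrite subrr mulr0 addr0.
Qed.

Lemma composite_subgradient gh y : subdiff U h x gh -> U y ->
  dotv (lsubmx gf + rsubmx gf 0 0 *: gh) (y - x) <=
    F y - F x + `|h x - u| + (1 + kappa) * delta / 2 * enorm (y - x) ^+ 2.
Proof.
move=> hgh Uy.
have h1 : h x + dotv gh (y - x) - delta / 2 * enorm (y - x) ^+ 2 <= h y.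
  apply: (subdiff_segment hgh Ux Uy cU) => t t01.
  by have := risk_segment Ux Uy t01; rewrite (enorm_sub x y); lra.
have /andP[g0 g1] := joint_subgradient_u.
have h2 := joint_subgradient (h y) Uy.
have h3 := ler_wpM2l g0 h1.
set e := enorm (y - x) ^+ 2 in h1 h2 h3 *.
have de : 0 <= delta * e by rewrite mulr_ge0 ?delta_ge0 ?sqr_ge0.
have h4 : rsubmx gf 0 0 * (delta * e) <= delta * e by rewrite ler_piMl.
(* The error is paid only once. If u <= h(x), the slope bound pays it and the linear term is
   nonnegative; otherwise monotonicity of [f] is free and g_fu <= 1 pays. *)
have h5 : F x - `|h x - u| <= f x u + rsubmx gf 0 0 * (h x - u).
  rewrite /mean_semidev; have [hu|/ltW hu] := leP u (h x).
    have /andP[_] := semidev_mono Ux hu.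
    have : 0 <= rsubmx gf 0 0 * (h x - u) by rewrite mulr_ge0 // subr_ge0.
    rewrite ger0_norm ?subr_ge0 //; clear hu h1 h2 h3 h4 de.
    by move: (f x u) (f x (h x)) (h x) (rsubmx gf 0 0 * _) => a b c k; lra.
  have /andP[+ _] := semidev_mono Ux hu.
  have : rsubmx gf 0 0 * (u - h x) <= u - h x by rewrite ler_piMl // subr_ge0.
  have -> : rsubmx gf 0 0 * (h x - u) = - (rsubmx gf 0 0 * (u - h x)) by rewrite -mulrN opprB.
  rewrite ler0_norm ?subr_le0 //; clear hu h1 h2 h3 h4 de.
  by move: (f x u) (f x (h x)) (h x) (rsubmx gf 0 0 * _) => a b c k; lra.
rewrite dotvDl dotvZl; clear h1; move: h2 h3 h4 h5 de; rewrite /mean_semidev.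
move: (f x u) (f x (h x)) (f y (h y)) `|h x - u| (h x) (h y) (mean _ _) (rsubmx gf 0 0) => *.
lra.
Qed.

End Subgradients.

Section Lipschitz.
Variables (X : set 'rV[R]_n) (Lt : d.-tuple R -> R).
Hypothesis XU : X `<=` U.
Hypothesis LLt : L1 law Lt.
Hypothesis lloss : {ae law, forall z, forall x y, X x -> X y ->
    `|loss x z - loss y z| <= Lt z * enorm (x - y)}.

Lemma risk_lipschitz x y : X x -> X y ->
  `|h x - h y| <= mean law Lt * enorm (x - y).
Proof.
move=> Xx Xy; have Lx := Lloss (XU Xx); have Ly := Lloss (XU Xy).
rewrite [mean law Lt * _]mulrC -meanZl // ler_norml; apply/andP; split.
  rewrite lerNl opprB -meanB //; apply: mean_le; [exact: L1B|exact: L1Zl|].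
  move: lloss; apply: filterS => z /(_ _ _ Xx Xy); rewrite ler_norml; lra.
rewrite -meanB //; apply: mean_le; [exact: L1B|exact: L1Zl|].
by move: lloss; apply: filterS => z /(_ _ _ Xx Xy); rewrite ler_norml; lra.
Qed.

Lemma semidev_lipschitz_le x y v : X x -> X y ->
  f x v - f y v <= mean law Lt * enorm (x - y).
Proof.
move=> Xx Xy; have Lx := L1_semidev v (XU Xx); have Ly := L1_semidev v (XU Xy).
have /andP[k0 k1] := kappa01.
rewrite [mean law Lt * _]mulrC -meanZl // -meanB //.
apply: mean_le; [exact: L1B|exact: L1Zl|].
move: lloss; apply: filterS => z /(_ _ _ Xx Xy) hz.
suff : Num.max 0 (loss x z - v) - Num.max 0 (loss y z - v) <= Lt z * enorm (x - y).
  move=> h1; have h0 := le_trans (normr_ge0 _) hz.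
  have := ler_wpM2l k0 h1; have := ler_piMl h0 k1; lra.
have h0 := le_trans (normr_ge0 _) hz.
rewrite lerBlDr ge_max; apply/andP; split; first by rewrite addr_ge0 // le_max lexx.
have : loss y z - v <= Num.max 0 (loss y z - v) by rewrite le_max lexx orbT.
by move: hz; rewrite ler_norml; lra.
Qed.

(** One copy of the mean for the direct dependence on x, one through h(x). The constant never enters
    the rate: it only serves existence, measurability and integrability. *)
Lemma mean_semidev_lipschitz x y : X x -> X y ->
  `|F x - F y| <= 2 * mean law Lt * enorm (x - y).
Proof.
have half a b : X a -> X b -> F a - F b <= 2 * mean law Lt * enorm (a - b).
  move=> Xa Xb; have := risk_lipschitz Xa Xb; rewrite ler_norml => /andP[r1 r2].
  have := semidev_lipschitz_le (h a) Xa Xb; rewrite /mean_semidev.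
  have [hh|/ltW hh] := leP (h a) (h b).
    have /andP[+ _] := semidev_mono (XU Xb) hh; clear hh.
    move: (f a (h a)) (f b (h a)) (f b (h b)) (mean _ _) r1 r2 => p q r l.
    by move: (h a) (h b) => ha hb; lra.
  have /andP[_ +] := semidev_mono (XU Xb) hh; clear hh.
  move: (f a (h a)) (f b (h a)) (f b (h b)) (mean _ _) r1 r2 => p q r l.
  by move: (h a) (h b) => ha hb; lra.
move=> Xx Xy; rewrite ler_norml half // andbT lerNl opprB (enorm_sub x).
exact: half.
Qed.

End Lipschitz.
End Model.

(** * The stochastic direction *)

Section Generators.
Context {R : realType} {disp : measure_display} {T : measurableType disp}.
Implicit Types S : set (T -> R).

(** The generators inside [sigma_of], exposed because the lemmas on sub-sigma-algebras take
    generators. *)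
Definition gens S : set (set T) :=
  \bigcup_(f in S) preimage_set_system setT f measurable.

Lemma gens_measurable S f : S f -> measurable_wrt (gens S) f.
Proof. by move=> Sf _ B mB; apply: sub_sigma_algebra; exists f => //; exists B. Qed.

Lemma sub_gens_measurable S : (forall f, S f -> measurable_fun setT f) ->
  <<s gens S >> `<=` measurable.
Proof.
move=> mS; apply: smallest_sub; first exact: sigma_algebra_measurable.
by move=> A [f Sf [B mB <-]]; apply: mS.
Qed.

Lemma gensS S S' : S `<=` S' -> <<s gens S >> `<=` <<s gens S' >>.
Proof. by move=> SS'; apply: sub_sigma_algebra2 => A [f /SS' S'f fA]; exists f. Qed.

Lemma measurable_wrtD G (f g : T -> R) : measurable_wrt G f ->
  measurable_wrt G g -> measurable_wrt G (fun w => f w + g w).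
Proof. exact: measurable_funD. Qed.

Lemma measurable_wrtB G (f g : T -> R) : measurable_wrt G f ->
  measurable_wrt G g -> measurable_wrt G (fun w => f w - g w).
Proof. exact: measurable_funB. Qed.

Lemma measurable_wrtM G (f g : T -> R) : measurable_wrt G f ->
  measurable_wrt G g -> measurable_wrt G (fun w => f w * g w).
Proof. exact: measurable_funM. Qed.

Lemma eq_measurable_wrt G (f g : T -> R) : f =1 g ->
  measurable_wrt G f -> measurable_wrt G g.
Proof. by move=> /funext ->. Qed.

End Generators.

Section Direction.
Context {R : realType} {n : nat} {disp : measure_display} {T : measurableType disp}.
Variables (P : probability T R) (G : set (set T)) (sigma Dfx Dh : R).
Variables (dfx sg gh : T -> 'rV[R]_n) (dfu : T -> R) (gf : T -> 'rV[R]_(n + 1)).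
Let ef w := row_mx (dfx w) (const_mx (dfu w)) - gf w.
Let eh w := sg w - gh w.
Let gfx w := lsubmx (gf w).
Let gfu w := rsubmx (gf w) 0 0.
Let dir w := dfx w + dfu w *: sg w.

Hypotheses (Gm : <<s G >> `<=` measurable) (sigma0 : 0 <= sigma) (Dh0 : 0 <= Dh).
Hypothesis dfu01 : forall w, 0 <= dfu w <= 1.
Hypothesis nef : cond_noise P <<s G >> sigma ef.
Hypothesis neh : cond_noise P <<s G >> sigma eh.
Hypothesis ieh : forall i, null_on P (G `|` gens (coords ef)) (fun w => eh w 0 i).
Hypothesis mgf : forall i, measurable_wrt G (fun w => gf w 0 i).
Hypothesis mgh : forall i, measurable_wrt G (fun w => gh w 0 i).
Hypothesis bgfx : {ae P, forall w, enorm (gfx w) <= Dfx}.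
Hypothesis bgh : {ae P, forall w, enorm (gh w) <= Dh}.

(** The past enlarged by e_f: [dfx] and [dfu] are known on it, while e_h is still centred. *)
Let H := G `|` gens (coords ef).

Let Lef i : L1 P (fun w => ef w 0 i).
Proof. by have [+ _ _ _] := cond_noiseP Gm nef; exact. Qed.

Let Leh i : L1 P (fun w => eh w 0 i).
Proof. by have [+ _ _ _] := cond_noiseP Gm neh; exact. Qed.

Let mef i : measurable_fun setT (fun w => ef w 0 i).
Proof. exact: L1_measurable (Lef i). Qed.

Let meh i : measurable_fun setT (fun w => eh w 0 i).
Proof. exact: L1_measurable (Leh i). Qed.

Let Hm : <<s H >> `<=` measurable.
Proof.
apply: smallest_sub; first exact: sigma_algebra_measurable.
move=> A [GA|EA]; first by apply: Gm; exact: sub_sigma_algebra.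
have : <<s gens (coords ef) >> A by exact: sub_sigma_algebra.
by apply: sub_gens_measurable => _ [i _ <-].
Qed.

Let GH : <<s G >> `<=` <<s H >>.
Proof. by apply: sub_sigma_algebra2; exact: subsetUl. Qed.

Let mHgf i : measurable_wrt H (fun w => gf w 0 i).
Proof. exact: measurable_wrtS GH (mgf i). Qed.

Let mHgh i : measurable_wrt H (fun w => gh w 0 i).
Proof. exact: measurable_wrtS GH (mgh i). Qed.

Let mHef i : measurable_wrt H (fun w => ef w 0 i).
Proof.
apply: (@measurable_wrtS _ _ (gens (coords ef)) H).
  by apply: sub_sigma_algebra2; exact: subsetUr.
by apply: gens_measurable; exists i.
Qed.

Let efx w := lsubmx (ef w).
Let efu w := rsubmx (ef w) 0 0.

Let dfxE w : dfx w = gfx w + efx w.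
Proof. by rewrite /gfx /efx /ef linearB /= row_mxKl addrC subrK. Qed.

Let dfuE w : dfu w = gfu w + efu w.
Proof. by rewrite /gfu /efu /ef linearB /= row_mxKr !mxE; ring. Qed.

Let mHdfu : measurable_wrt H dfu.
Proof.
have -> : dfu = fun w => gf w 0 (rshift n 0) + ef w 0 (rshift n 0).
  by apply/funext => w; rewrite dfuE /gfu /efu !mxE.
by apply: measurable_wrtD.
Qed.

Let mHdfx i : measurable_wrt H (fun w => dfx w 0 i).
Proof.
have -> : (fun w => dfx w 0 i) = fun w => gf w 0 (lshift 1 i) + ef w 0 (lshift 1 i).
  by apply/funext => w; rewrite dfxE /gfx /efx !mxE.
by apply: measurable_wrtD.
Qed.

(** The direction with the inner subgradient replaced by [gh]; the remainder is [dfu] times e_h. *)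
Let p w := dfx w + dfu w *: gh w.

Let mHp i : measurable_wrt H (fun w => p w 0 i).
Proof.
have -> : (fun w => p w 0 i) = fun w => dfx w 0 i + dfu w * gh w 0 i.
  by apply/funext => w; rewrite !mxE.
by apply: measurable_wrtD => //; exact: measurable_wrtM.
Qed.

Let dirE w : dir w = p w + dfu w *: eh w.
Proof. by rewrite /dir /p /eh scalerBr addrACA subrr addr0. Qed.

Let mefx : measurable_fun setT (fun w => enorm (efx w)).
Proof.
apply: measurable_enorm => i.
by apply: eq_measurable_fun (mef (lshift 1 i)) => w _; rewrite /efx !mxE.
Qed.

Let Lefx2 : L1 P (fun w => enorm (efx w) ^+ 2).
Proof.
have [_ _ + _] := cond_noiseP Gm nef; apply: L1_dominated.
  exact: measurable_funX.
by apply: aeW => w; rewrite ger0_norm ?sqr_ge0 // enorm_lsubmx_le.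
Qed.

Let efx2 : mean P (fun w => enorm (efx w) ^+ 2) <= sigma ^+ 2.
Proof.
have [_ _ L h] := cond_noiseP Gm nef; apply: le_trans h.
by apply: mean_le => //; apply: aeW => w; exact: enorm_lsubmx_le.
Qed.

Let Lefx : L1 P (fun w => enorm (efx w)).
Proof. exact: L1_of_sqr. Qed.

Let efx1 : mean P (fun w => enorm (efx w)) <= sigma.
Proof.
rewrite -(ler_pXn2r (ltn0Sn 1)) ?nnegrE ?mean_ge0 //; last first.
  by move=> w; exact: enorm_ge0.
exact: le_trans (mean_sqr_le Lefx Lefx2) efx2.
Qed.

Let pE w : p w = (gfx w + dfu w *: gh w) + efx w.
Proof. by rewrite /p dfxE addrAC. Qed.

Let q w := gfx w + dfu w *: gh w.

Let bq : {ae P, forall w, enorm (q w) <= Dfx + Dh}.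
Proof.
move: bgfx bgh; apply: filterS2 => w h1 h2; apply: (le_trans (enormD _ _)).
apply: lerD => //; rewrite enormZ; have /andP[d0 d1] := dfu01 w.
by rewrite ger0_norm // (le_trans _ h2) // ler_piMl // enorm_ge0.
Qed.

Let Lp2 : L1 P (fun w => enorm (p w) ^+ 2).
Proof.
apply: (L1_dominated (g := fun w => 2 * ((Dfx + Dh) ^+ 2 + enorm (efx w) ^+ 2))).
- apply: measurable_funX; apply: measurable_enorm => i.
  exact: measurable_wrtW Hm (mHp i).
- move: bq; apply: filterS => w h; rewrite ger0_norm ?sqr_ge0 // pE -/(q w).
  have := enorm_ge0 (q w); have := enorm_ge0 (efx w).
  rewrite enorm_sqD; have := dotv_le (q w) (efx w).
  move: h; move: (enorm (q w)) (enorm (efx w)) (dotv _ _) => a b c h1 h2 h3 h4.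
  have := sqr_ge0 (a - b); have : a ^+ 2 <= (Dfx + Dh) ^+ 2.
    by rewrite ler_pXn2r ?nnegrE // (le_trans h4 h1).
  by nra.
- by apply: L1Zl; apply: L1D => //; exact: L1_cst.
Qed.

Let Leh2 : L1 P (fun w => enorm (eh w) ^+ 2).
Proof. by have [_ _ + _] := cond_noiseP Gm neh. Qed.

Let coord_sqr (e : T -> 'rV[R]_n) i : measurable_fun setT (fun w => e w 0 i) ->
  L1 P (fun w => enorm (e w) ^+ 2) -> L1 P (fun w => e w 0 i ^+ 2).
Proof. exact: L1_sqr_coord. Qed.

(* e_h stays centred against anything built from the past and from e_f. *)
Let cross_eh (W : T -> 'rV[R]_n) : (forall i, measurable_wrt H (fun w => W w 0 i)) ->
  L1 P (fun w => enorm (W w) ^+ 2) ->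
  L1 P (fun w => dotv (W w) (eh w)) /\ mean P (fun w => dotv (W w) (eh w)) = 0.
Proof.
move=> mW LW; have LWi i : L1 P (fun w => W w 0 i * eh w 0 i).
  have mWi := measurable_wrtW Hm (mW i).
  by apply: L1_mul_sqr => //; exact: coord_sqr.
split; first exact: L1_sum.
by rewrite mean_sum // big1 // => i _; rewrite (null_on_mul Hm (Leh i)).
Qed.

Let cross_efx (W : T -> 'rV[R]_n) c : (forall i, measurable_wrt G (fun w => W w 0 i)) ->
  {ae P, forall w, enorm (W w) <= c} ->
  L1 P (fun w => dotv (W w) (efx w)) /\ mean P (fun w => dotv (W w) (efx w)) = 0.
Proof.
move=> mW bW; have LWi i : L1 P (fun w => W w 0 i * ef w 0 (lshift 1 i)).
  apply: (@L1_mul_bounded _ _ _ _ _ _ c) => //.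
    exact: measurable_wrtW Gm (mW i).
  by move: bW; apply: filterS => w; apply: le_trans; exact: ler_coord_enorm.
have -> : (fun w => dotv (W w) (efx w)) =
    fun w => \sum_i (W w 0 i * ef w 0 (lshift 1 i)).
  by apply/funext => w; apply: eq_bigr => i _; rewrite !mxE.
split; first exact: L1_sum.
rewrite mean_sum // big1 // => i _; rewrite (null_on_mul Gm (Lef _)) //.
by have [_ + _ _] := cond_noiseP Gm nef; exact.
Qed.

Let scaled_sqr (W : T -> 'rV[R]_n) : (forall i, measurable_wrt H (fun w => W w 0 i)) ->
  L1 P (fun w => enorm (W w) ^+ 2) ->
  L1 P (fun w => enorm (dfu w *: W w) ^+ 2).
Proof.
move=> mW; apply: L1_dominated.
  apply: measurable_funX; apply: measurable_enorm => i; under eq_fun do rewrite !mxE.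
  by apply: measurable_funM; apply: measurable_wrtW Hm _.
apply: aeW => w; rewrite ger0_norm ?sqr_ge0 // enormZ exprMn.
have /andP[d0 d1] := dfu01 w.
by rewrite ler_piMl ?sqr_ge0 // real_normK ?num_real // expr_le1.
Qed.

Let Ldeh2 : L1 P (fun w => enorm (dfu w *: eh w) ^+ 2).
Proof.
move: Leh2; apply: L1_dominated.
  apply: measurable_funX; apply: measurable_enorm => i; under eq_fun do rewrite !mxE.
  apply: measurable_funM; first exact: measurable_wrtW Hm mHdfu.
  by apply: eq_measurable_fun (meh i) => w _; rewrite !mxE.
apply: aeW => w; rewrite ger0_norm ?sqr_ge0 // enormZ exprMn.
have /andP[d0 d1] := dfu01 w.
by rewrite ler_piMl ?sqr_ge0 // real_normK ?num_real // expr_le1.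
Qed.

Let mGgfx i : measurable_wrt G (fun w => gfx w 0 i).
Proof. by apply: eq_measurable_wrt (mgf (lshift 1 i)) => w; rewrite /gfx !mxE. Qed.

(** With p = q + e_fx and |q| <= Dfx + Dh, the product of g_fx with e_fx averages out. That of dfu
    g_h does not, since [dfu] is correlated with e_fx; it is bounded by Dh |e_fx|, the origin of 2
    sigma Dh. *)
Let p2_le : mean P (fun w => enorm (p w) ^+ 2) <=
  (Dfx + Dh) ^+ 2 + sigma ^+ 2 + 2 * sigma * Dh.
Proof.
have [L1x m1x] := cross_efx mGgfx bgfx.
have Lq := L1D (L1D (L1_cst P ((Dfx + Dh) ^+ 2)) (L1Zl 2 L1x)) (L1Zl (2 * Dh) Lefx).
have Lb := L1D Lq Lefx2.
apply: (@le_trans _ _ (mean P (fun w => (Dfx + Dh) ^+ 2 + 2 * dotv (gfx w) (efx w) +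
    (2 * Dh) * enorm (efx w) + enorm (efx w) ^+ 2))).
  apply: mean_le => //; move: bq bgh; apply: filterS2 => w h1 h2.
  rewrite pE -/(q w) enorm_sqD.
  have h3 : enorm (q w) ^+ 2 <= (Dfx + Dh) ^+ 2.
    by rewrite ler_pXn2r ?nnegrE ?enorm_ge0 // (le_trans (enorm_ge0 _) h1).
  have h4 : dotv (q w) (efx w) <= dotv (gfx w) (efx w) + Dh * enorm (efx w).
    rewrite /q dotvDl lerD2l dotvZl; have /andP[d0 d1] := dfu01 w.
    apply: (@le_trans _ _ (`|dotv (gh w) (efx w)|)).
      apply: (le_trans (ler_norm _)); rewrite normrM ler_piMl //.
      by rewrite ger0_norm.
    by apply: (le_trans (dotv_abs_le _ _)); rewrite ler_wpM2r ?enorm_ge0.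
  move: h3 h4; move: (dotv _ _) (dotv _ _) (enorm (efx w)) (enorm (q w)) => a b c e.
  by lra.
rewrite (meanD Lq Lefx2) (meanD (L1D (L1_cst P _) (L1Zl 2 L1x)) (L1Zl _ Lefx)).
rewrite (meanD (L1_cst P _) (L1Zl 2 L1x)) (meanZl _ L1x) (meanZl _ Lefx) mean_cst m1x.
have := ler_wpM2l Dh0 efx1; move: efx2.
by move: (mean _ _) (mean _ _) => a b; lra.
Qed.

(** The cross term pairs e_h with [dfu *: p], known on [H], and vanishes; |dfu e_h| <= |e_h| gives
    the second sigma^2. *)
Lemma direction_sqr : L1 P (fun w => enorm (dir w) ^+ 2) /\
  mean P (fun w => enorm (dir w) ^+ 2) <=
    (Dfx + Dh) ^+ 2 + 2 * sigma ^+ 2 + 2 * sigma * Dh.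
Proof.
have mdp i : measurable_wrt H (fun w => (dfu w *: p w) 0 i).
  under eq_fun do rewrite !mxE.
  by apply: measurable_wrtM => //; apply: eq_measurable_wrt (mHp i) => w; rewrite !mxE.
have [L0 m0] := cross_eh mdp (scaled_sqr mHp Lp2).
have -> : (fun w => enorm (dir w) ^+ 2) = fun w => enorm (p w) ^+ 2 +
    2 * dotv (dfu w *: p w) (eh w) + enorm (dfu w *: eh w) ^+ 2.
  by apply/funext => w; rewrite dirE enorm_sqD dotvZl dotvZr.
have La := L1D Lp2 (L1Zl 2 L0).
split; first exact: L1D.
rewrite (meanD La Ldeh2) (meanD Lp2 (L1Zl 2 L0)) (meanZl _ L0) m0.
have : mean P (fun w => enorm (dfu w *: eh w) ^+ 2) <= sigma ^+ 2.
  have [_ _ _ h] := cond_noiseP Gm neh; apply: le_trans h.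
  apply: mean_le => //; apply: aeW => w; rewrite enormZ exprMn.
  have /andP[d0 d1] := dfu01 w.
  by rewrite ler_piMl ?sqr_ge0 // real_normK ?num_real // expr_le1.
move: p2_le; move: (mean _ _) (mean _ _) => a b; lra.
Qed.

Hypothesis bgfu : {ae P, forall w, 0 <= gfu w <= 1}.

(** The discrepancy splits into <V, e_fx>, e_fu <V, g_h> and dfu <V, e_h>. The first two vanish
    given the past alone; the third contains the product of e_fu and e_h and requires [H]. *)
Lemma direction_mean (V : T -> 'rV[R]_n) c :
  (forall i, measurable_wrt G (fun w => V w 0 i)) ->
  (forall w, enorm (V w) <= c) ->
  [/\ L1 P (fun w => dotv (V w) (dir w)),
      L1 P (fun w => dotv (V w) (gfx w + gfu w *: gh w)) &
      mean P (fun w => dotv (V w) (dir w)) =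
      mean P (fun w => dotv (V w) (gfx w + gfu w *: gh w))].
Proof.
move=> mV bV.
have mHV i : measurable_wrt H (fun w => V w 0 i) := measurable_wrtS GH (mV i).
have LV2 : L1 P (fun w => enorm (V w) ^+ 2).
  apply: (@L1_bounded _ _ _ _ _ (c ^+ 2)).
    apply: measurable_funX; apply: measurable_enorm => i.
    exact: measurable_wrtW Gm (mV i).
  apply: aeW => w; rewrite ger0_norm ?sqr_ge0 // ler_pXn2r ?nnegrE ?enorm_ge0 //.
  exact: le_trans (enorm_ge0 _) (bV w).
have [La ma] := @cross_efx V c mV (aeW _ bV).
have [Lb mb] : L1 P (fun w => dotv (dfu w *: V w) (eh w)) /\
    mean P (fun w => dotv (dfu w *: V w) (eh w)) = 0.
  apply: cross_eh; last exact: scaled_sqr.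
  by move=> i; under eq_fun do rewrite !mxE; exact: measurable_wrtM.
have mVgh : measurable_wrt G (fun w => dotv (V w) (gh w)) by exact: measurable_dotv.
have bVgh : {ae P, forall w, `|dotv (V w) (gh w)| <= c * Dh}.
  move: bgh; apply: filterS => w h; apply: (le_trans (dotv_abs_le _ _)).
  by apply: ler_pM; rewrite ?enorm_ge0.
have Lc : L1 P (fun w => dotv (V w) (gh w) * ef w 0 (rshift n 0)).
  exact: L1_mul_bounded (measurable_wrtW Gm mVgh) bVgh (Lef _).
have mc : mean P (fun w => dotv (V w) (gh w) * ef w 0 (rshift n 0)) = 0.
  rewrite (null_on_mul Gm (Lef _)) //.
  by have [_ + _ _] := cond_noiseP Gm nef; exact.
have mGgfu : measurable_wrt G gfu.
  by apply: eq_measurable_wrt (mgf (rshift n 0)) => w; rewrite /gfu !mxE.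
have Ld : L1 P (fun w => dotv (V w) (gfx w + gfu w *: gh w)).
  apply: (@L1_bounded _ _ _ _ _ (c * (Dfx + Dh))).
    apply: (measurable_wrtW Gm); apply: measurable_dotv => // i.
    under eq_fun do rewrite !mxE.
    apply: measurable_wrtD; last exact: measurable_wrtM.
    by apply: eq_measurable_wrt (mGgfx i) => w; rewrite !mxE.
  move: bgfx bgh bgfu; apply: filterS3 => w h1 h2 /andP[h3 h4].
  apply: (le_trans (dotv_abs_le _ _)); apply: ler_pM; rewrite ?enorm_ge0 //.
  apply: (le_trans (enormD _ _)); apply: lerD => //.
  by rewrite enormZ ger0_norm // (le_trans _ h2) // ler_piMl // enorm_ge0.
have E : (fun w => dotv (V w) (dir w)) = fun w =>
    dotv (V w) (gfx w + gfu w *: gh w) + dotv (V w) (efx w) +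
    dotv (V w) (gh w) * ef w 0 (rshift n 0) + dotv (dfu w *: V w) (eh w).
  apply/funext => w; rewrite dirE /p dfxE.
  have -> : ef w 0 (rshift n 0) = dfu w - gfu w.
    by rewrite dfuE /efu !mxE addrAC subrr add0r.
  by rewrite !dotvE; ring.
have L2 := L1D Ld La; have L3 := L1D L2 Lc.
split => //; first by rewrite E; exact: L1D.
by rewrite E meanD // meanD // meanD // ma mb mc !addr0.
Qed.

End Direction.

(** * Batch estimates and tracking of the inner risk *)

Section Transfer.
Context {R : realType} {d d' : measure_display}.
Context {T : measurableType d} {S : measurableType d'}.
Variables (P : probability T R) (law : probability S R) (G : set (set T)).
Hypothesis Gm : <<s G >> `<=` measurable.
Variable g : g_sigma_algebraType G * S -> R.
Hypotheses (mg : measurable_fun setT g) (g0 : forall p, 0 <= g p).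

(** Both samples have the same joint law with the past. This moves the second moment bound from the
    extra sample of the oracle assumption to each sample of the batch. *)
Lemma indep_transfer (Z Z' : T -> S) :
  measurable_fun setT Z -> measurable_fun setT Z' ->
  indep_of P law G Z -> indep_of P law G Z' -> L1 P (fun w => g (w, Z' w)) ->
  L1 P (fun w => g (w, Z w)) /\
  mean P (fun w => g (w, Z w)) = mean P (fun w => g (w, Z' w)).
Proof.
move=> mZ mZ' iZ iZ' LZ'.
have E : (\int[P]_w (g (w, Z w))%:E = \int[P]_w (g (w, Z' w))%:E)%E.
  by rewrite (indep_integral_ge0 Gm mZ iZ mg g0) (indep_integral_ge0 Gm mZ' iZ' mg g0).
split; last by rewrite /mean /Rintegral E.
apply/integrableP; split.
  exact/measurable_EFinP/(indep_measurable_fun Gm mZ mg).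
rewrite (eq_integral (fun w => (g (w, Z w))%:E)) => [|w _]; last first.
  by rewrite /= ger0_norm.
by rewrite E mean_fin // ltry.
Qed.

Lemma indep_le (Z : T -> S) (k : T -> R) :
  measurable_fun setT Z -> indep_of P law G Z -> L1 P k ->
  (forall w, L1 law (fun z => g (w, z))) ->
  (forall w, mean law (fun z => g (w, z)) <= k w) ->
  L1 P (fun w => g (w, Z w)) /\ mean P (fun w => g (w, Z w)) <= mean P k.
Proof.
move=> mZ iZ Lk Lg gk.
have k0 w : 0 <= k w by apply: le_trans (gk w); apply: mean_ge0.
have E : (\int[P]_w (g (w, Z w))%:E <= (mean P k)%:E)%E.
  rewrite (indep_integral_ge0 Gm mZ iZ mg g0) -mean_fin //.
  apply: ge0_le_integral => //.
  - by move=> w _; apply: integral_ge0 => z _; rewrite lee_fin.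
  - have mgE : measurable_fun setT (EFin \o g) by exact/measurable_EFinP.
    have gE0 p : (0 <= (EFin \o g) p)%E by rewrite lee_fin.
    have := @measurable_fun_fubini_tonelli_F _ _ _ _ R law _ mgE gE0.
    by move=> h _ A mA; have := h measurableT A mA; exact: Gm.
  - exact: measurable_int Lk.
  - by move=> w _; rewrite mean_fin // lee_fin.
have Lgz : L1 P (fun w => g (w, Z w)).
  apply/integrableP; split.
    exact/measurable_EFinP/(indep_measurable_fun Gm mZ mg).
  rewrite (eq_integral (fun w => (g (w, Z w))%:E)) => [|w _]; last first.
    by rewrite /= ger0_norm.
  exact: le_lt_trans E (ltry _).
by split => //; rewrite -lee_fin -mean_fin.
Qed.

End Transfer.

Section LipschitzVersion.
Context {R : realType} {n d : nat}.
Variable law : probability (d.-tuple R) R.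
Variables (loss : 'rV[R]_n -> d.-tuple R -> R) (X : set 'rV[R]_n).
Variable Lt : d.-tuple R -> R.

(* loss coincides off a null set with a function that is Lipschitz in x for
   every z, which makes it jointly measurable. *)
Definition lipschitz_version (loss' : 'rV[R]_n -> d.-tuple R -> R) : Prop :=
  [/\ forall x, X x -> measurable_fun setT (loss' x),
      forall z x y, X x -> X y -> `|loss' x z - loss' y z| <= `|Lt z| * enorm (x - y) &
      exists N0, [/\ measurable N0, law N0 = 0%E &
        forall z, ~ N0 z -> forall x, loss' x z = loss x z]].

Hypothesis mloss : forall x, X x -> measurable_fun setT (loss x).
Hypothesis lloss : {ae law, forall z, forall x y, X x -> X y ->
    `|loss x z - loss y z| <= Lt z * enorm (x - y)}.

Lemma lipschitz_version_exists : exists loss', lipschitz_version loss'.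
Proof.
have [N0 [mN0 N00 hN0]] := lloss.
have hN z : ~ N0 z -> forall x y, X x -> X y ->
    `|loss x z - loss y z| <= Lt z * enorm (x - y).
  move=> nN; apply: contrapT => h; apply: nN; exact: hN0.
(* The loss is set to 0 on the exceptional set, where [Lt] may be negative: hence the absolute value
   in the Lipschitz bound. *)
exists (fun x z => \1_(~` N0) z * loss x z); split.
- move=> x Xx; apply: measurable_funM; last exact: mloss.
  by apply: measurable_indic; exact: measurableC.
- move=> z x y Xx Xy; rewrite indicE -mulrBr normrM.
  case: (boolP (z \in ~` N0)) => [/set_mem nN|_]; rewrite ?normr1 ?normr0 ?mul1r ?mul0r.
    by apply: (le_trans (hN z nN x y Xx Xy)); rewrite ler_wpM2r ?enorm_ge0 ?ler_norm.
  by rewrite mulr_ge0 ?enorm_ge0.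
- exists N0; split => // z nN x.
  by rewrite indicE mem_set // mul1r.
Qed.

Variable loss' : 'rV[R]_n -> d.-tuple R -> R.
Hypothesis hl' : lipschitz_version loss'.
Hypothesis Lloss : forall x, X x -> L1 law (loss x).

Lemma version_ae : {ae law, forall z, forall x, loss' x z = loss x z}.
Proof.
have [_ _ [N0 [mN0 N00 h]]] := hl'; exists N0; split => // z /= nz.
by apply: contrapT => /h; exact: nz.
Qed.

Lemma version_L1 x : X x -> L1 law (loss' x).
Proof.
move=> Xx; apply: (L1_ae _ _ (Lloss Xx)); first by have [+ _ _] := hl'; exact.
by move: version_ae; apply: filterS => z; exact.
Qed.

Lemma version_mean x : X x -> mean law (loss' x) = risk law loss x.
Proof.
move=> Xx; apply: mean_ae; [exact: version_L1|exact: Lloss|].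
by move: version_ae; apply: filterS => z; exact.
Qed.

(** As [Z] has law [law], it avoids the exceptional set almost surely; the equality holds for all x
    at once, so it may be read at a random iterate. *)
Lemma version_sample {disp : measure_display} {Omega : measurableType disp}
    (P : probability Omega R) (G : set (set Omega)) (Z : Omega -> d.-tuple R) :
  <<s G >> setT -> measurable_fun setT Z -> indep_of P law G Z ->
  {ae P, forall w, forall x, loss' x (Z w) = loss x (Z w)}.
Proof.
move=> GT mZ iZ; have [_ _ [N0 [mN0 N00 h]]] := hl'.
exists (Z @^-1` N0); split.
- by rewrite -[X in measurable X]setTI; exact: mZ.
- by have := iZ _ _ GT mN0; rewrite setTI N00 mule0.
- by move=> w /= nz; apply: contrapT => /h; exact: nz.
Qed.

Hypothesis mLt : measurable_fun setT Lt.

Lemma version_joint_measurable {disp : measure_display} {Omega : measurableType disp}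
    (G : set (set Omega)) (v : Omega -> 'rV[R]_n) :
  (forall w, X (v w)) -> (forall i, measurable_wrt G (fun w => v w 0 i)) ->
  measurable_fun setT
    (fun p : g_sigma_algebraType G * (d.-tuple R) => loss' (v p.1) p.2).
Proof.
move=> Xv mv; have [ml ll _] := hl'.
apply: (measurable_lipschitz_comp (X := X) (K := fun p => `|Lt p.2|)
  (v := fun p : g_sigma_algebraType G * (d.-tuple R) => v p.1)
  (q := fun x p => loss' x p.2)).
- by move=> p; exact: Xv.
- by move=> i; exact: (measurableT_comp (mv i) measurable_fst).
- by move=> x Xx; exact: (measurableT_comp (ml x Xx) measurable_snd).
- by apply: measurableT_comp => //; exact: (measurableT_comp mLt measurable_snd).
- by move=> p x y Xx Xy; exact: ll.
Qed.

End LipschitzVersion.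

(** * Errors at a refresh and at a tracking step *)

Section Process.
Context {R : realType} {n d : nat} {disp : measure_display} {Omega : measurableType disp}.
Variables (law : probability (d.-tuple R) R) (loss : 'rV[R]_n -> d.-tuple R -> R).
Variables (kappa tau : R) (T B b N : nat) (U X : set 'rV[R]_n) (x0 : 'rV[R]_n).
Variables (P : probability Omega R) (s : @process R n d disp Omega).
Hypothesis run : scs_spider P law loss kappa tau T B b U X x0 s N.
Hypothesis Xx0 : X x0.

Local Notation x := (iter_x s).
Local Notation u := (iter_u s).
Local Notation Past k := (gens (past T B b s k)).

Lemma iterate_in k w : (k <= N)%N -> X (x k w).
Proof.
case: k => [_|k kN]; first by rewrite (scs_init run).
by have [] := scs_step run w kN.
Qed.

Lemma measurable_coords (m : nat) (e : Omega -> 'rV[R]_m) :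
  (forall i, measurable_fun setT (fun w => e w 0 i)) ->
  forall f, coords e f -> measurable_fun setT f.
Proof. by move=> me f [i _ <-]. Qed.

Lemma measurable_tcoords (z : Omega -> d.-tuple R) : measurable_fun setT z ->
  forall f, tcoords z f -> measurable_fun setT f.
Proof. by move=> mz f [i _ <-]; exact: (measurableT_comp (measurable_tnth i)). Qed.

Lemma past_measurable k : (k <= N)%N -> <<s Past k >> `<=` measurable.
Proof.
move=> kN; apply: sub_gens_measurable => f [].
  move=> [j /= jk]; apply: measurable_coords => i.
  by apply: (scs_meas_x run); rewrite (leq_trans _ kN).
move=> [j /= jk]; have jN : (j < N)%N by exact: leq_trans kN.
have [ms _] := scs_samples run jN.
move=> [[[[[->|[i /= ib]]|]|]|]|].
- exact: (scs_meas_u run).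
- by apply: measurable_tcoords; have [+ _] := scs_batch run jN; move=> /(_ (Ordinal ib)).
- by apply: measurable_tcoords; exact: (ms true).
- by apply: measurable_tcoords; exact: (ms false).
- by apply: measurable_coords => i; exact: (scs_meas_subgrad1 run).
- by apply: measurable_coords => i; exact: (scs_meas_subgrad2 run).
Qed.

Lemma Fk_measurable k : (k < N)%N -> Fk s k `<=` measurable.
Proof.
move=> kN; apply: (@sub_gens_measurable _ _ _ _) => f [j /= jk].
have jN : (j < N)%N by exact: leq_trans kN.
move=> [|->]; last exact: (scs_meas_u run).
by apply: measurable_coords => i; apply: (scs_meas_x run); exact: ltnW.
Qed.

Lemma past_x k j i : (j <= k)%N -> measurable_wrt (Past k) (fun w => x j w 0 i).
Proof. by move=> jk; apply: gens_measurable; left; exists j => //; exists i. Qed.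

Lemma past_u k j : (j < k)%N -> measurable_wrt (Past k) (u j).
Proof. by move=> jk; apply: gens_measurable; right; exists j => //; do 5 left. Qed.

Lemma past_sub_batch k : <<s Past k >> `<=` <<s gens (past_batch T B b s k) >>.
Proof. by apply: gensS => f pf; left; left. Qed.

Variables (Lt : d.-tuple R -> R) (L sigma M : R).
Hypothesis XU : X `<=` U.
Hypothesis Lloss : forall y, U y -> law.-integrable setT (EFin \o loss y).
Hypothesis mLt : measurable_fun setT Lt.
Hypothesis LLt2 : law.-integrable setT (fun z => (Lt z ^+ 2)%:E).
Hypothesis lloss : {ae law, forall z, forall x y, X x -> X y ->
    `|loss x z - loss y z| <= Lt z * enorm (x - y)}.
Hypothesis LE : L ^+ 2 = (\int[law]_z (Lt z ^+ 2))%R.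

Let LLt : L1 law Lt. Proof. exact: L1_of_sqr. Qed.

Lemma risk_measurable G (v : Omega -> 'rV[R]_n) : (forall w, X (v w)) ->
  (forall i, measurable_wrt G (fun w => v w 0 i)) ->
  measurable_wrt G (fun w => risk law loss (v w)).
Proof.
move=> Xv mv; apply: (@measurable_lipschitz_comp _ _ _ (g_sigma_algebraType G) X v
  (fun y _ => risk law loss y) (fun=> mean law Lt)) => //.
by move=> _ y z Xy Xz; exact: (risk_lipschitz Lloss XU LLt lloss).
Qed.

Definition track_err k w := u k w - risk law loss (x k w).

(** The index is [k.+1] because the past at [k] stops before the k-th batch, from which u^k is
    computed. *)
Lemma track_err_measurable k : (k < N)%N -> measurable_wrt (Past k.+1) (track_err k).
Proof.
move=> kN; apply: measurable_wrtB; first exact: past_u.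
apply: risk_measurable => [w|i]; first exact/iterate_in/ltnW.
exact: past_x.
Qed.

Variable loss' : 'rV[R]_n -> d.-tuple R -> R.
Hypothesis hl' : lipschitz_version law loss X Lt loss'.

Let LlossX y : X y -> L1 law (loss y). Proof. by move=> /XU/Lloss. Qed.

Let PastT k : <<s Past k >> setT.
Proof. exact: (@measurableT _ (g_sigma_algebraType (Past k))). Qed.

Let fresh k (kN : (k < N)%N) := scs_batch run kN.

Let batch_version k : (k < N)%N ->
  {ae P, forall w, forall i : 'I_(batch_size T B b k), forall y,
     loss' y (batch s k i w) = loss y (batch s k i w)}.
Proof.
move=> kN; apply: filter_forall => i.
have := version_sample hl' (@PastT k) (fresh_measurable (fresh kN) i) (fresh_indep (fresh kN) i).
exact.
Qed.

Hypotheses (B0 : (0 < B)%N) (b0 : (0 < b)%N).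

Section Refresh.
Variables (k : nat) (Dl : Omega -> d.-tuple R).
Hypotheses (kN : (k < N)%N) (kT : (k %% T == 0)%N).
Hypothesis fDl : fresh_samples P (sigma_of (past_batch T B b s k)) law (fun _ : unit => Dl).
Hypothesis nDl : cond_noise P (Fk s k) sigma
  (fun w => const_mx (loss (x k w) (Dl w) - risk law loss (x k w)) : 'rV[R]_1).

Let psi (p : g_sigma_algebraType (Past k) * (d.-tuple R)) :=
  loss' (x k p.1) p.2 - risk law loss (x k p.1).

Let Xk w : X (x k w). Proof. exact/iterate_in/ltnW. Qed.

Let mpsi : measurable_fun setT psi.
Proof.
apply: measurable_funB.
  by apply: (version_joint_measurable hl') => // i; exact: past_x.
apply: (measurableT_comp
  (f := fun w : g_sigma_algebraType (Past k) => risk law loss (x k w))) => //.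
by apply: risk_measurable => // i; exact: past_x.
Qed.

(** The error is the mean of [B] centred samples at x^k: [sample_mean_sqr] with [Y = 0]. The bound
    sigma^2, known for [Dl], is transferred to the batch. *)
Lemma refresh_err : L1 P (fun w => track_err k w ^+ 2) /\
  mean P (fun w => track_err k w ^+ 2) <= sigma ^+ 2 / B%:R.
Proof.
have bk : batch_size T B b k = B by rewrite /batch_size kT.
have Pm := past_measurable (ltnW kN).
have mDl : measurable_fun setT Dl by have [/(_ tt)] := fDl.
have iDl : indep_of P law (Past k) Dl.
  apply: (indep_ofS (@past_sub_batch k)).
  exact: (fresh_indep (G := gens (past_batch T B b s k)) fDl tt).
have aeDl := version_sample hl' (@PastT k) mDl iDl.
have [_ _ LDl mDl2] := cond_noiseP (G := gens _) (Fk_measurable kN) nDl.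
have eDl w : enorm (const_mx (loss (x k w) (Dl w) - risk law loss (x k w)) : 'rV[R]_1) ^+ 2
    = (loss (x k w) (Dl w) - risk law loss (x k w)) ^+ 2.
  by rewrite enorm_sqr /dotv big_ord1 mxE expr2.
have psiDl : {ae P, forall w, psi (w, Dl w) ^+ 2 =
    enorm (const_mx (loss (x k w) (Dl w) - risk law loss (x k w)) : 'rV[R]_1) ^+ 2}.
  by move: aeDl; apply: filterS => w h; rewrite eDl /psi /= h.
have mg2 : measurable_fun setT (fun p => psi p ^+ 2) by exact: measurable_funX.
have Lpsi2Dl : L1 P (fun w => psi (w, Dl w) ^+ 2).
  exact: (L1_ae (indep_measurable_fun Pm mDl mg2) psiDl LDl).
have psi2i (i : 'I_(batch_size T B b k)) :=
  indep_transfer Pm mg2 (fun p => sqr_ge0 _) (fresh_measurable (fresh kN) i) mDl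
    (fresh_indep (fresh kN) i) iDl Lpsi2Dl.
have Lpsi w : L1 law (fun z => psi (w, z)).
  exact: (L1B (version_L1 hl' LlossX (Xk w)) (L1_cst law (risk law loss (x k w)))).
have psi0 w : mean law (fun z => psi (w, z)) = 0.
  rewrite /psi /= (meanB (version_L1 hl' LlossX (Xk w)) (L1_cst _ _)).
  by rewrite mean_cst (version_mean hl' LlossX (Xk w)) subrr.
have psi2v (i : 'I_(batch_size T B b k)) :
    mean P (fun w => psi (w, batch s k i w) ^+ 2) <= sigma ^+ 2.
  rewrite (psi2i i).2 (mean_ae _ LDl psiDl) //.
have L0 : L1 P (fun w => (0 : R) ^+ 2) by exact: L1_cst.
have m0 : measurable_wrt (Past k) (fun _ : Omega => 0 : R) by exact: measurable_cst.
have [Ls ms] := sample_mean_sqr Pm (fresh kN) mpsi Lpsi psi0 (fun i => (psi2i i).1) psi2v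
   m0 L0 B%:R^-1.
have Bn0 : (B%:R : R) != 0 by rewrite pnatr_eq0 -lt0n.
have errE : {ae P, forall w, track_err k w ^+ 2 =
    (0 + B%:R^-1 * \sum_(i < batch_size T B b k) psi (w, batch s k i w)) ^+ 2}.
  move: (batch_version kN); apply: filterS => w h.
  rewrite add0r /track_err (scs_refresh run) // /batch_loss; congr (_ ^+ 2).
  rewrite bk in h *; rewrite /psi /= big_split /= sumrN sumr_const card_ord mulrBr.
  congr (_ - _); first by congr (_ * _); apply: eq_bigr => i _; rewrite h.
  by rewrite -[X in _ * X]mulr_natl mulKf.
have merr : measurable_fun setT (fun w => track_err k w ^+ 2).
  apply: measurable_funX; apply: measurable_funB; first exact: (scs_meas_u run).
  by apply: measurable_wrtW Pm _; apply: risk_measurable => // i; exact: past_x.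
split; first exact: (L1_ae merr errE Ls).
rewrite (mean_ae (L1_ae merr errE Ls) Ls errE); apply: (le_trans ms).
rewrite card_ord bk expr0n mean_cst add0r le_eqVlt; apply/orP; left; apply/eqP.
by field.
Qed.

End Refresh.

Section Track.
Variable k : nat.
Hypotheses (kN : (k.+1 < N)%N) (kT : (k.+1 %% T != 0)%N).
Hypothesis Lerr : L1 P (fun w => track_err k w ^+ 2).
Hypothesis Lstep : L1 P (fun w => enorm (x k.+1 w - x k w) ^+ 2).
Variable V : R.
Hypothesis step_le : mean P (fun w => enorm (x k.+1 w - x k w) ^+ 2) <= V.

Let psi (p : g_sigma_algebraType (Past k.+1) * (d.-tuple R)) :=
  (loss' (x k.+1 p.1) p.2 - loss' (x k p.1) p.2) -
  (risk law loss (x k.+1 p.1) - risk law loss (x k p.1)).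

Let Xk1 w : X (x k.+1 w). Proof. exact/iterate_in/ltnW. Qed.

Let Xk w : X (x k w). Proof. by apply: iterate_in; do 2 apply: ltnW. Qed.

Let mpsi : measurable_fun setT psi.
Proof.
have mk i : measurable_wrt (Past k.+1) (fun w => x k w 0 i) by exact: past_x.
have mk1 i : measurable_wrt (Past k.+1) (fun w => x k.+1 w 0 i) by exact: past_x.
apply: measurable_funB.
  by apply: measurable_funB; exact: (version_joint_measurable hl').
apply: (measurableT_comp (f := fun w : g_sigma_algebraType (Past k.+1) =>
  risk law loss (x k.+1 w) - risk law loss (x k w))) => //.
by apply: measurable_funB; exact: risk_measurable.
Qed.

(** The new error is the old one plus the mean of [b] centred increments. With the past frozen,
    their variance is at most their second moment, hence at most L^2 |x^{k+1} - x^k|^2. *)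
Lemma tracking_err : L1 P (fun w => track_err k.+1 w ^+ 2) /\
  mean P (fun w => track_err k.+1 w ^+ 2) <=
    mean P (fun w => track_err k w ^+ 2) + L ^+ 2 * V / b%:R.
Proof.
have bk : batch_size T B b k.+1 = b by rewrite /batch_size (negbTE kT).
have Pm := past_measurable (ltnW kN).
have [ml ll _] := hl'.
pose D w z := loss' (x k.+1 w) z - loss' (x k w) z.
have LD w : L1 law (D w).
  by apply: L1B; exact: (version_L1 hl' LlossX).
have meanDE w : mean law (D w) = risk law loss (x k.+1 w) - risk law loss (x k w).
  by rewrite meanB ?(version_mean hl' LlossX) //; exact: (version_L1 hl' LlossX).
have D2 w z : D w z ^+ 2 <= enorm (x k.+1 w - x k w) ^+ 2 * Lt z ^+ 2.
  rewrite -[D w z ^+ 2]real_normK ?num_real // -[Lt z ^+ 2]real_normK ?num_real //.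
  rewrite -exprMn ler_pXn2r ?nnegrE ?mulr_ge0 ?enorm_ge0 // mulrC.
  exact: ll.
have LD2 w : L1 law (fun z => D w z ^+ 2).
  have : L1 law (fun z => enorm (x k.+1 w - x k w) ^+ 2 * Lt z ^+ 2) by exact: L1Zl.
  apply: L1_dominated; first by apply: measurable_funX; exact: L1_measurable (LD w).
  by apply: aeW => z; rewrite ger0_norm ?sqr_ge0.
have psiE w : (fun z => psi (w, z)) = fun z => D w z - mean law (D w).
  by apply/funext => z; rewrite /psi meanDE.
have Lpsi w : L1 law (fun z => psi (w, z)).
  by rewrite psiE; apply: L1B => //; exact: L1_cst.
have psi0 w : mean law (fun z => psi (w, z)) = 0.
  by rewrite psiE (meanB (LD w) (L1_cst _ _)) mean_cst subrr.
have psi2E w : (fun z => psi (w, z) ^+ 2) = fun z => D w z ^+ 2 -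
    2 * mean law (D w) * D w z + mean law (D w) ^+ 2.
  apply/funext => z; rewrite (_ : psi (w, z) = D w z - mean law (D w)) ?meanDE //.
  by ring.
have La w : L1 law (fun z => D w z ^+ 2 - 2 * mean law (D w) * D w z).
  by apply: L1B => //; exact: L1Zl.
have Lpsi2 w : L1 law (fun z => psi (w, z) ^+ 2).
  by rewrite psi2E; apply: L1D => //; exact: L1_cst.
have mg2 : measurable_fun setT (fun p => psi p ^+ 2) by exact: measurable_funX.
have psi2le w : mean law (fun z => psi (w, z) ^+ 2) <=
    L ^+ 2 * enorm (x k.+1 w - x k w) ^+ 2.
  rewrite psi2E (meanD (La w) (L1_cst _ _)) (meanB (LD2 w) (L1Zl _ (LD w))).
  rewrite (meanZl _ (LD w)) mean_cst.
  have : mean law (fun z => D w z ^+ 2) <= enorm (x k.+1 w - x k w) ^+ 2 * L ^+ 2.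
    by rewrite LE -/(mean _ _) -meanZl //; apply: mean_le => //; [exact: L1Zl|exact: aeW].
  have := sqr_ge0 (mean law (D w)); set m := mean law (D w).
  by move: (mean _ _) (enorm _ ^+ 2) (L ^+ 2) => e f g; rewrite expr2; lra.
have Lk : L1 P (fun w => L ^+ 2 * enorm (x k.+1 w - x k w) ^+ 2) by exact: L1Zl.
have psi2i (i : 'I_(batch_size T B b k.+1)) :=
  indep_le Pm mg2 (fun p => sqr_ge0 _) (fresh_measurable (fresh kN) i)
    (fresh_indep (fresh kN) i) Lk Lpsi2 psi2le.
have psi2v (i : 'I_(batch_size T B b k.+1)) :
    mean P (fun w => psi (w, batch s k.+1 i w) ^+ 2) <= L ^+ 2 * V.
  apply: (le_trans (psi2i i).2); by rewrite meanZl // ler_wpM2l ?sqr_ge0.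
have [Ls ms] := sample_mean_sqr Pm (fresh kN) mpsi Lpsi psi0 (fun i => (psi2i i).1) psi2v
   (track_err_measurable (ltnW kN)) Lerr b%:R^-1.
have bn0 : (b%:R : R) != 0 by rewrite pnatr_eq0 -lt0n.
have errE : {ae P, forall w, track_err k.+1 w ^+ 2 = (track_err k w +
    b%:R^-1 * \sum_(i < batch_size T B b k.+1) psi (w, batch s k.+1 i w)) ^+ 2}.
  move: (batch_version kN); apply: filterS => w h.
  rewrite /track_err (scs_track run) // /batch_loss; congr (_ ^+ 2).
  rewrite bk in h *; rewrite /psi /= !big_split /= !sumrN sumr_const card_ord.
  rewrite -[(_ - _) *+ b]mulr_natl.
  have E y : \sum_(i < b) loss' y (batch s k.+1 i w) = \sum_(i < b) loss y (batch s k.+1 i w).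
    by apply: eq_bigr => i _; rewrite h.
  rewrite !E.
  by move: (\sum_(i < b) _) (\sum_(i < b) _) => p q; field.
have merr : measurable_fun setT (fun w => track_err k.+1 w ^+ 2).
  apply: measurable_funX; apply: measurable_funB; first exact: (scs_meas_u run).
  by apply: measurable_wrtW Pm _; apply: risk_measurable => // i; exact: past_x.
split; first exact: (L1_ae merr errE Ls).
rewrite (mean_ae (L1_ae merr errE Ls) Ls errE); apply: (le_trans ms).
rewrite card_ord bk lerD2l le_eqVlt; apply/orP; left; apply/eqP.
by field.
Qed.

End Track.
End Process.

(** * Descent of the Moreau envelope *)

Section CeilPos.
Context {R : realType}.
Implicit Types r : R.

Lemma ceil_pos_gt0 r : (0 < ceil_pos r)%N.
Proof. by rewrite /ceil_pos leq_max. Qed.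

Lemma le_ceil_pos r : r <= (ceil_pos r)%:R.
Proof.
apply: (le_trans (ceil_ge r)); apply: (@le_trans _ _ (`|Num.ceil r|%N)%:R).
  by rewrite natr_absz ler_int ler_norm.
by rewrite ler_nat leq_maxr.
Qed.

(** Rounding the epoch length up is harmless: a position inside the epoch still does not exceed the
    real value [r]. *)
Lemma lt_ceil_pos r j : 0 <= r -> (0 < j < ceil_pos r)%N -> j%:R <= r.
Proof.
move=> r0 /andP[j0]; rewrite /ceil_pos leq_max => /orP[|jc].
  by rewrite ltnS leqn0 => /eqP j00; rewrite j00 in j0.
have c0 : 0 <= Num.ceil r by rewrite -(ceil0 R) le_ceil.
rewrite leNgt; apply/negP => rj.
have : Num.ceil r <= j%:Z by rewrite ceil_le_int ltW // -pmulrn.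
rewrite -(gez0_abs c0) => h.
by move: jc; rewrite ltnNge; apply/negP; rewrite negbK.
Qed.

(** Half of tau^2 goes to the refresh. For the increments, j L M tau <= sigma and b >= 2 L M sigma /
    tau give j L^2 M^2 tau^2 <= sigma L M tau <= b tau^2 / 2. *)
Lemma batch_bounds (tau L M sigma : R) (j : nat) :
  0 < tau -> 0 <= L -> 0 <= M -> 0 <= sigma ->
  (j < ceil_pos (sigma / (L * M * tau)))%N ->
  sigma ^+ 2 / (ceil_pos (2 * sigma ^+ 2 / tau ^+ 2))%:R +
    j%:R * (L ^+ 2 * (tau ^+ 2 * M ^+ 2) / (ceil_pos (2 * L * M * sigma / tau))%:R)
  <= tau ^+ 2.
Proof.
move=> t0 L0 M0 s0 jT.
have h1 : sigma ^+ 2 / (ceil_pos (2 * sigma ^+ 2 / tau ^+ 2))%:R <= tau ^+ 2 / 2.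
  rewrite ler_pdivrMr ?ltr0n ?ceil_pos_gt0 //.
  have := le_ceil_pos (2 * sigma ^+ 2 / tau ^+ 2).
  rewrite ler_pdivrMr ?exprn_gt0 //; lra.
suff : j%:R * (L ^+ 2 * (tau ^+ 2 * M ^+ 2) /
    (ceil_pos (2 * L * M * sigma / tau))%:R) <= tau ^+ 2 / 2 by lra.
have [->|j0] := posnP j; first by rewrite mul0r divr_ge0 ?sqr_ge0.
have r0 : 0 <= sigma / (L * M * tau).
  by rewrite divr_ge0 // mulr_ge0 ?mulr_ge0 // ltW.
have := lt_ceil_pos r0 (introT andP (conj j0 jT)) => jr.
have j1 : 1 <= j%:R :> R by rewrite ler1n.
have LMt : 0 < L * M * tau.
  (* If L M tau = 0 the quotient is 0 by convention, which would force j <= 0. *)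
  rewrite lt_def mulr_ge0 ?mulr_ge0 ?(ltW t0) // andbT; apply/negP => /eqP e0.
  by move: jr; rewrite e0 invr0 mulr0; lra.
have c0 : 0 < (ceil_pos (2 * L * M * sigma / tau))%:R :> R.
  by rewrite ltr0n ceil_pos_gt0.
rewrite mulrA ler_pdivrMr //.
have := le_ceil_pos (2 * L * M * sigma / tau); rewrite ler_pdivrMr // => h2.
move: jr; rewrite ler_pdivlMr // => h3.
move: (ceil_pos _)%:R h2 c0 => c h2 c0.
have h4 : j%:R * (L * M * tau) * (L * M * tau) <= sigma * (L * M * tau).
  by rewrite ler_wpM2r // ltW.
have h5 : 2 * L * M * sigma * tau <= c * tau * tau by rewrite ler_wpM2r // ltW.
by move: (j%:R) h3 h4 => jj h3 h4; lra.
Qed.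

(** This explains the choice of rhobar: rho/2 + (1 + kappa) delta/2 is exactly rhobar/2, so half of
    the proximal decrease survives the weak convexity defect. *)
Lemma decrease_arith (kappa delta f a g : R) :
  let rho := (1 + 2 * kappa) * delta in
  let rhobar := rho + (1 + kappa) * delta in
  f <= - (rhobar - rho / 2) * g ->
  f + a + (1 + kappa) * delta / 2 * g <= a - rhobar / 2 * g.
Proof. by move=> rho rhobar; rewrite /rhobar /rho; lra. Qed.

(** The remainder is r t^2 (M^2/2 + 1); the stated constant, r (M^2/2 + 2), leaves a slack of r
    t^2. *)
Lemma descent_arith (m1 m0 e g o r t M : R) : 0 <= r -> 0 <= t ->
  m1 <= m0 + r * t * e + r / 2 * t ^+ 2 * o ->
  e <= t - r / 2 * g -> o <= M ^+ 2 ->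
  m1 + t / 2 * (r ^+ 2 * g) <= m0 + 2 * r * (M ^+ 2 / 4 + 1) * t ^+ 2.
Proof.
move=> r0 t0 h1 h2 h3; have rt : 0 <= r * t by rewrite mulr_ge0.
have rt2 : 0 <= r / 2 * t ^+ 2 by rewrite mulr_ge0 ?sqr_ge0 // divr_ge0.
have rtt := mulr_ge0 r0 (sqr_ge0 t).
have := ler_wpM2l rt h2; have := ler_wpM2l rt2 h3; lra.
Qed.

Lemma sum_arith (m0 m1 e k C g r t S : R) :
  m1 + t / 2 * (r ^+ 2 * g) <= m0 + C * t ^+ 2 ->
  m0 + t / 2 * (r ^+ 2 * S) <= e + k * C * t ^+ 2 ->
  m1 + t / 2 * (r ^+ 2 * (S + g)) <= e + (k + 1) * C * t ^+ 2.
Proof. lra. Qed.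

Lemma average_arith (a c e g r t m C : R) : 0 < m -> 0 < t -> c <= a ->
  a + t / 2 * (r ^+ 2 * g) <= e + m * C * t ^+ 2 ->
  r ^+ 2 * (m^-1 * g) <= 2 * ((e - c + m * C * t ^+ 2) / (m * t)).
Proof.
move=> m0 t0 h1 h2; rewrite mulrA ler_pdivlMr ?mulr_gt0 //.
have -> : r ^+ 2 * (m^-1 * g) * (m * t) = r ^+ 2 * g * t by field; rewrite gt_eqF.
lra.
Qed.

End CeilPos.

(** * Descent along the trajectory and the random index *)

Section Step.
Context {R : realType} {n d : nat} {disp : measure_display} {Omega : measurableType disp}.
Variables (law : probability (d.-tuple R) R) (loss : 'rV[R]_n -> d.-tuple R -> R).
Variables (kappa tau : R) (T B b N : nat) (U X : set 'rV[R]_n) (x0 : 'rV[R]_n).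
Variables (P : probability Omega R) (s : @process R n d disp Omega).
Variables (deltat Lt : d.-tuple R -> R) (L sigma Dfx Dh M : R).
Hypothesis kappa01 : 0 <= kappa <= 1.
Hypotheses (cX : convex_set X) (kX : compact X) (cU : convex_set U) (XU : X `<=` U).
Hypothesis Lloss : forall y, U y -> law.-integrable setT (EFin \o loss y).
Hypothesis Ldelta : law.-integrable setT (EFin \o deltat).
Hypothesis wloss :
  {ae law, forall z, 0 <= deltat z /\ weakly_convex U (deltat z) (loss ^~ z)}.
Hypothesis mLt : measurable_fun setT Lt.
Hypothesis LLt2 : law.-integrable setT (fun z => (Lt z ^+ 2)%:E).
Hypothesis lloss : {ae law, forall z, forall x y, X x -> X y ->
    `|loss x z - loss y z| <= Lt z * enorm (x - y)}.
Hypothesis LE : L ^+ 2 = (\int[law]_z (Lt z ^+ 2))%R.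
Hypothesis sigma0 : 0 <= sigma.
Hypothesis hDfx : forall y v g, X y -> subdiff U (semidev law loss kappa ^~ v) y g ->
  enorm g <= Dfx.
Hypothesis hDh : forall y g, X y -> subdiff U (risk law loss) y g -> enorm g <= Dh.
Hypothesis ME : M ^+ 2 = (Dfx + Dh) ^+ 2 + 2 * sigma ^+ 2 + 2 * sigma * Dh.
Hypotheses (tau01 : 0 < tau <= 1) (Xx0 : X x0).
Hypothesis run : scs_spider P law loss kappa tau T B b U X x0 s N.
Hypothesis orac : stochastic_oracles P law loss kappa T B b U s N sigma.

Local Notation x := (iter_x s).
Local Notation u := (iter_u s).
Local Notation h := (risk law loss).
Local Notation F := (mean_semidev law loss kappa).
Local Notation delta := (mean law deltat).
Local Notation dir := (direction loss kappa s).
Local Notation err := (track_err law loss s).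

Definition Fgens k : set (set Omega) :=
  gens (\bigcup_(j in `I_k.+1) (coords (iter_x s j) `|` [set iter_u s j])).

Lemma Fgens_x k j i : (j <= k)%N -> measurable_wrt (Fgens k) (fun w => x j w 0 i).
Proof. by move=> jk; apply: gens_measurable; exists j => //; left; exists i. Qed.

Lemma dir_fu01 k w : 0 <= dir_fu loss kappa s k w <= 1.
Proof. by rewrite /dir_fu; case: ifP => _; have /andP[] := kappa01; lra. Qed.

Lemma ae_exists (Q : Omega -> Prop) : {ae P, forall w, Q w} -> exists w, Q w.
Proof.
move=> [A [mA A0 hA]]; apply: contrapT => nQ.
have AT : A = setT by rewrite -subTset => w _; apply: hA => Qw; apply: nQ; exists w.
by move: A0; rewrite AT probability_setT => /eqP; rewrite onee_eq0.
Qed.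

(** What the oracle assumption contributes to the descent. [V] is a bounded displacement, known at
    time k, from x^k to a point of [X]; [D] is its product with the true direction. *)
Lemma step_direction k : (k < N)%N ->
  [/\ L1 P (fun w => enorm (dir k w) ^+ 2),
      mean P (fun w => enorm (dir k w) ^+ 2) <= M ^+ 2 &
      forall (V : Omega -> 'rV[R]_n) c,
        (forall i, measurable_wrt (Fgens k) (fun w => V w 0 i)) ->
        (forall w, enorm (V w) <= c) -> (forall w, X (x k w + V w)) ->
        L1 P (fun w => dotv (V w) (dir k w)) /\
        exists2 D, L1 P D /\ mean P (fun w => dotv (V w) (dir k w)) = mean P D &
          {ae P, forall w, D w <= F (x k w + V w) - F (x k w) + `|err k w| +
             (1 + kappa) * delta / 2 * enorm (V w) ^+ 2}].
Proof.
move=> kN; have [gf [gh [Dl [Jt]]]] := orac; move=> /(_ k kN).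
move=> [[agf sgf] [agh sgh] _ [nef neh nel neJ] ci].
have Fm : <<s Fgens k >> `<=` measurable by exact: (Fk_measurable run).
have Xk w : X (x k w) by apply: (iterate_in run) => //; exact: ltnW.
have Uk w : U (x k w) := XU (Xk w).
have mcoord m (e : Omega -> 'rV[R]_m) : adapted (Fk s k) e ->
    forall i, measurable_wrt (Fgens k) (fun w => e w 0 i).
  move=> ae i _ A mA; rewrite setTI; apply: ae; apply: sub_sigma_algebra.
  by exists (fun w => e w 0 i); [exists i|exists A => //; rewrite setTI].
have mgf := mcoord _ _ agf; have mgh := mcoord _ _ agh.
have bgfx : {ae P, forall w, enorm (lsubmx (gf k w)) <= Dfx}.
  move: sgf; apply: filterS => w hw; apply: (hDfx (Xk w) (v := u k w)).
  exact: (joint_subgradient_x kappa01 cU Lloss Ldelta wloss (Uk w) hw).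
have bgfu : {ae P, forall w, 0 <= rsubmx (gf k w) 0 0 <= 1}.
  move: sgf; apply: filterS => w hw.
  exact: (joint_subgradient_u kappa01 cU Lloss Ldelta wloss (Uk w) hw).
have bgh : {ae P, forall w, enorm (gh k w) <= Dh}.
  by move: sgh; apply: filterS => w; exact: hDh.
have Dh0 : 0 <= Dh.
  by have [w hw] := ae_exists bgh; exact: le_trans (enorm_ge0 _) hw.
pose ef w := dir_f loss kappa s k w - gf k w.
pose eh w := subgrad2 s k w - gh k w.
pose el w : 'rV[R]_1 := const_mx (loss (x k w) (Dl k w) - h (x k w)).
pose eJ w := Jt k w - gh k w.
pose Hs := tnth [tuple gens (coords ef); gens (coords eh); gens (coords el); gens (coords eJ)].
have noise_gens m (e : Omega -> 'rV[R]_m) : cond_noise P (Fk s k) sigma e ->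
    <<s gens (coords e) >> `<=` measurable.
  move=> ne; apply: sub_gens_measurable; apply: measurable_coords => i.
  by have [+ _ _ _] := cond_noiseP Fm ne => /(_ i)/L1_measurable.
have Hsm i : <<s Hs i >> `<=` measurable.
  have -> : Hs i = nth set0 [:: gens (coords ef); gens (coords eh); gens (coords el);
      gens (coords eJ)] i by rewrite /Hs (tnth_nth set0).
  case: i => -[|[|[|[|//]]]] lti /=; exact: noise_gens.
have ci' : cond_independent P <<s Fgens k >> (fun i => <<s Hs i >>).
  have -> : (fun i => <<s Hs i >>) = tnth [tuple sigma_of (coords ef);
      sigma_of (coords eh); sigma_of (coords el); sigma_of (coords eJ)].
    apply/funext => i; rewrite /Hs !(tnth_nth set0).
    by case: i => -[|[|[|[|//]]]] lti.
  exact: ci.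
have ieh i : null_on P (Fgens k `|` gens (coords ef)) (fun w => eh w 0 i).
  have [Leh Neh _ _] := cond_noiseP Fm neh.
  (* Positions 0 and 1 of the tuple of errors are e_f and e_h. *)
  apply: (cond_independent_null_on (H := Hs) (i1 := ord0) (i2 := lift ord0 ord0) Fm Hsm ci') => //.
  by apply: gens_measurable; exists i.
have [Ld md] := direction_sqr Fm sigma0 Dh0 (dir_fu01 k) nef neh ieh mgf mgh bgfx bgh.
split => //; first by rewrite ME.
move=> V c mV bV XV.
have [LV LD E] := direction_mean Fm (dir_fu01 k) nef neh ieh mgf mgh bgfx bgh bgfu mV bV.
split => //; exists (fun w => dotv (V w)
  (lsubmx (gf k w) + rsubmx (gf k w) 0 0 *: gh k w)) => //.
move: sgf sgh; apply: filterS2 => w h1 h2; rewrite dotvC.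
have := composite_subgradient kappa01 cU Lloss Ldelta wloss (Uk w) h1 h2 (XU (XV w)).
have -> : x k w + V w - x k w = V w by rewrite addrAC subrr add0r.
by rewrite /track_err distrC.
Qed.

(** Nonexpansiveness of the projection against x^k itself, which lies in [X]. *)
Lemma step_length k : (k < N)%N ->
  L1 P (fun w => enorm (x k.+1 w - x k w) ^+ 2) /\
  mean P (fun w => enorm (x k.+1 w - x k w) ^+ 2) <= tau ^+ 2 * M ^+ 2.
Proof.
move=> kN; have [Ld md _] := step_direction kN.
have /andP[t0 _] := tau01.
have le w : enorm (x k.+1 w - x k w) ^+ 2 <= tau ^+ 2 * enorm (dir k w) ^+ 2.
  have Xk : X (x k w) by apply: (iterate_in run) => //; exact: ltnW.
  have := eproj_nonexpansive cX (scs_step run w kN) Xk.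
  rewrite addrAC subrr add0r enormN enormZ gtr0_norm // => hh.
  by rewrite -exprMn ler_pXn2r ?nnegrE ?mulr_ge0 ?enorm_ge0 // ltW.
have Lt2 := L1Zl (tau ^+ 2) Ld.
have Ls : L1 P (fun w => enorm (x k.+1 w - x k w) ^+ 2).
  apply: L1_dominated Lt2; last by apply: aeW => w; rewrite ger0_norm ?sqr_ge0.
  apply: measurable_funX; apply: measurable_enorm => i; under eq_fun do rewrite !mxE.
  by apply: measurable_funB; apply: (scs_meas_x run) => //; exact: ltnW.
split => //; apply: (@le_trans _ _ (mean P (fun w => tau ^+ 2 * enorm (dir k w) ^+ 2))).
  by apply: mean_le => //; exact: aeW.
by rewrite meanZl // ler_wpM2l ?sqr_ge0.
Qed.

Hypotheses (B0 : (0 < B)%N) (b0 : (0 < b)%N).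

Lemma tracking k : (k < N)%N ->
  L1 P (fun w => err k w ^+ 2) /\
  mean P (fun w => err k w ^+ 2) <=
    sigma ^+ 2 / B%:R + (k %% T)%:R * (L ^+ 2 * (tau ^+ 2 * M ^+ 2) / b%:R).
Proof.
have mloss y : X y -> measurable_fun setT (loss y).
  by move=> /XU/Lloss Ly; exact: L1_measurable Ly.
have [loss' hl'] := lipschitz_version_exists mloss lloss.
have refresh j : (j < N)%N -> (j %% T == 0)%N -> L1 P (fun w => err j w ^+ 2) /\
    mean P (fun w => err j w ^+ 2) <= sigma ^+ 2 / B%:R.
  move=> jN jT; have [gf [gh [Dl [Jt]]]] := orac; move=> /(_ j jN).
  move=> [_ _ fDl [_ _ nel _] _].
  exact: (refresh_err run Xx0 XU Lloss mLt LLt2 lloss hl' B0 jN jT fDl nel).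
elim: k => [|k IH] kN.
  have [|L0 h0] := refresh _ kN; first by rewrite mod0n.
  by split => //; rewrite mod0n mul0r addr0.
have [k0|k0] := eqVneq (k.+1 %% T)%N 0%N.
  have [|L0 h0] := refresh _ kN; first by rewrite k0.
  by split => //; rewrite k0 mul0r addr0.
have [IH1 IH2] := IH (ltnW kN).
have [Ls hs] := step_length (ltnW kN).
have [L1' h1] := tracking_err run Xx0 XU Lloss mLt LLt2 lloss LE hl' b0 kN k0 IH1 Ls hs.
split => //; apply: (le_trans h1).
(* Off a refresh [k.+1 %% T] is [(k %% T).+1]: one more increment since the last refresh. *)
move: k0; rewrite modnS; case: ifP => // _ _; rewrite -natr1 mulrDl mul1r addrA.
by rewrite lerD2r.
Qed.

Hypothesis N0 : (0 < N)%N.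
Hypothesis track_le : forall k, (k < N)%N -> mean P (fun w => err k w ^+ 2) <= tau ^+ 2.

Local Notation rho := ((1 + 2 * kappa) * delta).
Local Notation rhobar := (rho + (1 + kappa) * delta).
Local Notation phi := (moreau (constrained X F) rhobar^-1).
Local Notation prox := (proxmap X F rhobar).

Let X0 : X !=set0. Proof. by exists x0. Qed.

Let LLt : L1 law Lt. Proof. exact: L1_of_sqr. Qed.

Let lF y z : X y -> X z -> `|F y - F z| <= `|2 * mean law Lt| * enorm (y - z).
Proof.
move=> Xy Xz; have := mean_semidev_lipschitz kappa01 Lloss XU LLt lloss Xy Xz.
by move=> /le_trans; apply; rewrite ler_wpM2r ?enorm_ge0 ?ler_norm.
Qed.

Let wF y z t : X y -> X z -> 0 <= t <= 1 ->
  F ((1 - t) *: y + t *: z) <=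
    (1 - t) * F y + t * F z + rho / 2 * (t * (1 - t) * enorm (y - z) ^+ 2).
Proof.
by move=> /XU Uy /XU Uz; exact: (mean_semidev_segment kappa01 cU Lloss Ldelta wloss Uy Uz).
Qed.

Let Xprox y : X (prox y). Proof. by have [] := proxmapP rhobar X0 kX lF y. Qed.

Let bounded : exists2 D, 0 <= D & forall y z, X y -> X z ->
  enorm (y - z) <= D /\ `|F y| <= D.
Proof.
have [D D0 hD] := compact_enorm_bounded kX.
have b2 y z : X y -> X z -> enorm (y - z) <= 2 * D.
  move=> Xy Xz; apply: (le_trans (enormD _ _)); rewrite enormN.
  by have := hD _ Xy; have := hD _ Xz; lra.
exists (2 * D + (`|F x0| + `|2 * mean law Lt| * (2 * D))).
  by rewrite !addr_ge0 ?mulr_ge0.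
move=> y z Xy Xz; split.
  by apply: (le_trans (b2 _ _ Xy Xz)); rewrite lerDl addr_ge0 ?mulr_ge0.
rewrite -[F y](subrK (F x0)); apply: (le_trans (ler_normD _ _)).
have := le_trans (lF Xy Xx0) (ler_wpM2l (normr_ge0 _) (b2 _ _ Xy Xx0)).
by move: `|F y - F x0| `|F x0| (_ * (2 * D)) => p q a; lra.
Qed.

Lemma inf_le_envelope y : 0 <= rhobar -> inf (F @` X) <= phi y.
Proof.
move=> r0; rewrite (moreau_prox rhobar X0 kX lF).
apply: (@le_trans _ _ (F (prox y))); last first.
  by rewrite lerDl mulr_ge0 ?sqr_ge0 // divr_ge0.
apply: ge_inf; last by exists (prox y).
have [D D0 hD] := bounded; exists (- D) => _ [z Xz <-].
by have [_] := hD z z Xz Xz; rewrite ler_norml => /andP[].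
Qed.

Section Descent.
Hypothesis delta_gt0 : 0 < delta.

Let rho0 : 0 <= rho.
Proof. by have /andP[k0 k1] := kappa01; apply: mulr_ge0; [lra|exact: ltW]. Qed.

(** rhobar - rho is the strong convexity modulus of the proximal problem; its positivity is where
    delta > 0 is used. *)
Let gap0 : 0 < (1 + kappa) * delta.
Proof. by have /andP[k0 k1] := kappa01; apply: mulr_gt0 => //; lra. Qed.

Let rho_lt : rho < rhobar. Proof. by rewrite ltrDl. Qed.

Let rb0 : 0 < rhobar. Proof. exact: le_lt_trans rho0 rho_lt. Qed.

Let prox_lip y z :
  enorm (prox y - prox z) <= rhobar / (rhobar - rho) * enorm (y - z) :=
  prox_lipschitz X0 cX kX lF wF rho_lt rho0 y z.

Lemma prox_measurable G (v : Omega -> 'rV[R]_n) i : (forall w, X (v w)) ->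
  (forall i, measurable_wrt G (fun w => v w 0 i)) ->
  measurable_wrt G (fun w => prox (v w) 0 i).
Proof.
move=> Xv mv; apply: (@measurable_lipschitz_comp _ _ _ (g_sigma_algebraType G) X v
  (fun y _ => prox y 0 i) (fun=> rhobar / (rhobar - rho))) => //.
move=> _ y z _ _; apply: le_trans (prox_lip y z).
by have := ler_coord_enorm (prox y - prox z) i; rewrite !mxE.
Qed.

Lemma envelope_measurable G (v : Omega -> 'rV[R]_n) : (forall w, X (v w)) ->
  (forall i, measurable_wrt G (fun w => v w 0 i)) ->
  measurable_wrt G (fun w => phi (v w)).
Proof.
move=> Xv mv; have mp i := prox_measurable i Xv mv.
apply: (eq_measurable_wrt (f := fun w => F (prox (v w)) +
    rhobar / 2 * enorm (prox (v w) - v w) ^+ 2)).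
  by move=> w; rewrite (moreau_prox rhobar X0 kX lF).
apply: measurable_wrtD.
  by apply: (@measurable_lipschitz_comp _ _ _ (g_sigma_algebraType G) X
    (fun w => prox (v w)) (fun y _ => F y) (fun=> `|2 * mean law Lt|)).
apply: measurable_wrtM; first exact: measurable_cst.
apply: measurable_funX; apply: measurable_enorm => i.
by under eq_fun do rewrite !mxE; exact: measurable_wrtB.
Qed.

Let Xx k w : (k <= N)%N -> X (x k w). Proof. exact: (iterate_in run). Qed.

Lemma L1_gap k : (k <= N)%N -> L1 P (fun w => enorm (x k w - prox (x k w)) ^+ 2).
Proof.
move=> kN; have [D D0 hD] := bounded.
have Pm := past_measurable run kN.
apply: (@L1_bounded _ _ _ _ _ (D ^+ 2)).
  apply: measurable_funX; apply: measurable_enorm => i; under eq_fun do rewrite !mxE.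
  apply: (measurable_wrtW Pm); apply: measurable_wrtB; first exact: past_x.
  by apply: prox_measurable => [w|j]; [exact: Xx|exact: past_x].
apply: aeW => w; rewrite ger0_norm ?sqr_ge0 // ler_pXn2r ?nnegrE ?enorm_ge0 //.
by have [] := hD (x k w) (prox (x k w)) (Xx w kN) (Xprox _).
Qed.

Lemma L1_envelope k : (k <= N)%N -> L1 P (fun w => phi (x k w)).
Proof.
move=> kN; have [D D0 hD] := bounded.
have Pm := past_measurable run kN.
apply: (@L1_bounded _ _ _ _ _ (D + rhobar / 2 * D ^+ 2)).
  apply: (measurable_wrtW Pm); apply: envelope_measurable => [w|i]; first exact: Xx.
  exact: past_x.
apply: aeW => w; rewrite (moreau_prox rhobar X0 kX lF); apply: (le_trans (ler_normD _ _)).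
have [h1 h2] := hD (prox (x k w)) (x k w) (Xprox _) (Xx w kN).
have r2 : 0 <= rhobar / 2 by rewrite divr_ge0 // ltW.
apply: lerD => //; rewrite normrM !ger0_norm ?sqr_ge0 // ler_wpM2l //.
by rewrite ler_pXn2r ?nnegrE ?enorm_ge0.
Qed.

Lemma envelope_step k : (k < N)%N ->
  mean P (fun w => phi (x k.+1 w)) +
    tau / 2 * (rhobar ^+ 2 * mean P (fun w => enorm (x k w - prox (x k w)) ^+ 2)) <=
  mean P (fun w => phi (x k w)) + 2 * rhobar * (M ^+ 2 / 4 + 1) * tau ^+ 2.
Proof.
move=> kN; have [Ld md hV] := step_direction kN.
have /andP[t0 t1] := tau01.
have [D D0 hD] := bounded.
pose V w := prox (x k w) - x k w.
have Xk w : X (x k w) by exact/Xx/ltnW.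
have mx i : measurable_wrt (Fgens k) (fun w => x k w 0 i) by exact: Fgens_x.
have mV i : measurable_wrt (Fgens k) (fun w => V w 0 i).
  apply: (eq_measurable_wrt (f := fun w => prox (x k w) 0 i - x k w 0 i)).
    by move=> w; rewrite !mxE.
  by apply: measurable_wrtB => //; exact: prox_measurable.
have bV w : enorm (V w) <= D by have [] := hD (prox (x k w)) (x k w) (Xprox _) (Xk w).
have XV w : X (x k w + V w) by rewrite /V addrC subrK.
have [LV [E [LE' mE] hE]] := hV V D mV bV XV.
have [Lerr merr] := tracking kN.
have Lgap : L1 P (fun w => enorm (V w) ^+ 2).
  have := L1_gap (ltnW kN); congr L1; apply/funext => w.
  by rewrite /V enorm_sub.
have gapE : mean P (fun w => enorm (x k w - prox (x k w)) ^+ 2) =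
    mean P (fun w => enorm (V w) ^+ 2).
  by congr mean; apply/funext => w; rewrite /V enorm_sub.
have Lerr1 : L1 P (err k).
  apply: L1_of_sqr Lerr; apply: (measurable_wrtW (past_measurable run kN)).
  exact: (track_err_measurable run Xx0 XU Lloss mLt LLt2 lloss kN).
have Labs := L1_norm Lerr1.
have mabs := mean_norm_le (ltW t0) Lerr1 Lerr (track_le kN).
have E_le : mean P E <= tau - rhobar / 2 * mean P (fun w => enorm (V w) ^+ 2).
  apply: (@le_trans _ _ (mean P (fun w => `|err k w| - rhobar / 2 * enorm (V w) ^+ 2))).
    apply: (mean_le LE' (L1B Labs (L1Zl _ Lgap))).
    move: hE; apply: filterS => w /le_trans; apply.
    have := prox_decrease rhobar X0 cX kX lF wF (Xk w).
    rewrite (_ : x k w + V w = prox (x k w)); last by rewrite /V addrC subrK.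
    by rewrite -/(V w); exact: decrease_arith.
  by rewrite (meanB Labs (L1Zl _ Lgap)) (meanZl _ Lgap) lerD2r.
have phi_le w : phi (x k.+1 w) <= phi (x k w) + rhobar * tau * dotv (V w) (dir k w) +
    rhobar / 2 * tau ^+ 2 * enorm (dir k w) ^+ 2.
  exact: (moreau_descent X0 cX kX lF (ltW rb0) (Xk w) (scs_step run w kN)).
have La := L1D (L1_envelope (ltnW kN)) (L1Zl (rhobar * tau) LV).
have Lb := L1D La (L1Zl (rhobar / 2 * tau ^+ 2) Ld).
have := mean_le (L1_envelope kN) Lb (aeW _ phi_le).
rewrite (meanD La (L1Zl _ Ld)) (meanD (L1_envelope (ltnW kN)) (L1Zl _ LV)).
rewrite (meanZl _ LV) (meanZl _ Ld) mE gapE => h1.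
exact: (descent_arith (ltW rb0) (ltW t0) h1 E_le md).
Qed.

Lemma envelope_sum k : (k <= N)%N ->
  mean P (fun w => phi (x k w)) + tau / 2 * (rhobar ^+ 2 *
    \sum_(j < k) mean P (fun w => enorm (x j w - prox (x j w)) ^+ 2)) <=
  phi x0 + k%:R * (2 * rhobar * (M ^+ 2 / 4 + 1)) * tau ^+ 2.
Proof.
elim: k => [_|k IH kN].
  rewrite big_ord0 !mulr0 addr0 !mul0r addr0 -[leRHS](mean_cst P).
  by under eq_fun do rewrite (scs_init run).
rewrite big_ord_recr /= -[k.+1%:R]natr1.
exact: (sum_arith (envelope_step kN) (IH (ltnW kN))).
Qed.

Lemma mean_gradient (J : Omega -> 'I_N) : uniform_index P s J ->
  ('E_P[(fun w => enorm (gradient phi (x (J w) w)) ^+ 2)%R] <=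
   (2 * ((phi x0 - inf (F @` X) + N%:R * (2 * rhobar * (M ^+ 2 / 4 + 1)) * tau ^+ 2) /
      (N%:R * tau)))%:E)%E.
Proof.
move=> hJ; pose Gn i w := enorm (x i w - prox (x i w)) ^+ 2.
have /andP[t0 t1] := tau01.
have N1 : (N.-1 < N)%N by rewrite prednK.
have Fm : <<s Fgens N.-1 >> `<=` measurable by exact: (Fk_measurable run).
have LG (i : 'I_N) : L1 P (Gn i) by apply: L1_gap; exact: ltnW.
have mJ i : measurable (J @^-1` [set i]) by have [] := hJ i.
have indepJ (i : 'I_N) : mean P (fun w => \1_(J @^-1` [set i]) w * Gn i w) =
    N%:R^-1 * mean P (Gn i).
  (* Independence of [J] from F_{N-1} means that this centred indicator is null there, and x^i is
     known at time N-1 for every i < N. *)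
  pose e w := \1_(J @^-1` [set i]) w - N%:R^-1 : R.
  have LJ : L1 P (\1_(J @^-1` [set i])) by exact: integrable_indic.
  have Le : L1 P e by apply: L1B => //; exact: L1_cst.
  have Ne : null_on P (Fgens N.-1) e.
    move=> A GA; have mA := Fm _ GA; rewrite /e; under eq_fun do rewrite mulrBr.
    rewrite meanB; [|exact: L1_indic_mul|by apply: L1_indic_mul => //; exact: L1_cst].
    have -> : (fun w => \1_A w * \1_(J @^-1` [set i]) w : R) = \1_(A `&` J @^-1` [set i]).
      by apply/funext => w; rewrite indicI.
    under [X in _ - mean _ X]eq_fun do rewrite mulrC.
    rewrite meanZl; last exact: integrable_indic.
    rewrite !mean_indic //; last exact: measurableI.
    have [_ PJ /(_ A GA) ->] := hJ i.
    rewrite PJ fineM ?fin_num_measure //= mulrC subrr //.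
  have mG : measurable_wrt (Fgens N.-1) (Gn i).
    have iN : (i <= N.-1)%N by rewrite -ltnS prednK.
    apply: measurable_funX; apply: measurable_enorm => j; under eq_fun do rewrite !mxE.
    apply: measurable_wrtB; first exact: Fgens_x.
    by apply: prox_measurable => [w|l]; [exact/Xx/ltnW|exact: Fgens_x].
  have LGJ : L1 P (fun w => \1_(J @^-1` [set i]) w * Gn i w) by exact: L1_indic_mul.
  have LGN : L1 P (fun w => N%:R^-1 * Gn i w) by exact: L1Zl.
  have E : (fun w => Gn i w * e w) =
      fun w => \1_(J @^-1` [set i]) w * Gn i w - N%:R^-1 * Gn i w.
    by apply/funext => w; rewrite /e mulrC mulrBl.
  have := null_on_mul Fm Le Ne mG; rewrite E => /(_ (L1B LGJ LGN)).
  by rewrite meanB // meanZl // => /eqP; rewrite subr_eq0 => /eqP.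
(* The gradient at the random index becomes a finite sum over fixed indices, each weighted by an
   indicator of [J]. *)
have gradE w : enorm (gradient phi (x (J w) w)) ^+ 2 =
    rhobar ^+ 2 * \sum_(i < N) \1_(J @^-1` [set i]) w * Gn i w.
  rewrite (gradient_moreau X0 cX kX lF wF rho_lt rho0) enormZ exprMn real_normK ?num_real //.
  congr (_ * _); rewrite (bigD1 (J w)) //= big1 => [|i iJ].
    by rewrite addr0 indicE mem_set // mul1r.
  rewrite indicE memNset ?mul0r //= => Jwi.
  by move: iJ; rewrite -Jwi eqxx.
have LS : L1 P (fun w => \sum_(i < N) \1_(J @^-1` [set i]) w * Gn i w).
  by apply: L1_sum => i _; exact: L1_indic_mul.
rewrite unlock; under eq_integral do rewrite gradE.
rewrite mean_fin; last exact: L1Zl.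
rewrite lee_fin meanZl // mean_sum => [|i _]; last exact: L1_indic_mul.
under eq_bigr do rewrite indepJ.
rewrite -mulr_sumr.
have := envelope_sum (leqnn N).
(* Closes the telescoped sum, which ends at x^N, one iterate beyond the sampled ones. *)
have : inf (F @` X) <= mean P (fun w => phi (x N w)).
  rewrite -(mean_cst P (inf _)); apply: mean_le; [exact: L1_cst|exact: L1_envelope|].
  by apply: aeW => w; apply: inf_le_envelope; exact: ltW.
have Np : 0 < N%:R :> R by rewrite ltr0n.
by move=> h1 h2; exact: (average_arith Np t0 h1 h2).
Qed.

End Descent.

(** With rhobar = 0 the gradient vanishes identically, and the right-hand side is nonnegative
    because the envelope lies above inf F. *)
Lemma mean_gradient0 (J : Omega -> 'I_N) : delta = 0 ->
  ('E_P[(fun w => enorm (gradient phi (x (J w) w)) ^+ 2)%R] <=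
   (2 * ((phi x0 - inf (F @` X) + N%:R * (2 * rhobar * (M ^+ 2 / 4 + 1)) * tau ^+ 2) /
      (N%:R * tau)))%:E)%E.
Proof.
move=> d0; have r0 : rhobar = 0 by rewrite d0 !mulr0 addr0.
have gradE w : enorm (gradient phi (x (J w) w)) ^+ 2 = 0.
  by rewrite (gradient_moreau0 X0 kX lF) // enorm0 expr0n.
rewrite unlock; under eq_integral do rewrite gradE.
have /andP[t0 _] := tau01.
have h : inf (F @` X) <= phi x0 by apply: inf_le_envelope; rewrite r0.
rewrite integral0 lee_fin mulr_ge0 // divr_ge0 ?mulr_ge0 ?(ltW t0) //.
by rewrite [X in _ + X](_ : _ = 0) ?addr0 ?subr_ge0 // r0; ring.
Qed.

End Step.

Theorem theorem10 (R : realType) (n d : nat)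
  (law : probability (d.-tuple R) R)
  (loss : 'rV[R]_n -> d.-tuple R -> R) (kappa : R)
  (X U : set 'rV[R]_n) (deltat Lt : d.-tuple R -> R)
  (delta L sigma Dfx Dh M tau : R) (N : nat) (x0 : 'rV[R]_n)
  (disp : measure_display) (Omega : measurableType disp)
  (P : probability Omega R)
  (s : @process R n d disp Omega) (J : Omega -> 'I_N) :
  0 <= kappa <= 1 ->
  (* A1 *)
  convex_set X -> compact X ->
  (* A4, on the neighborhood U of X *)
  open U -> convex_set U -> X `<=` U ->
  (forall x, U x -> law.-integrable setT (EFin \o loss x)) ->
  law.-integrable setT (EFin \o deltat) ->
  {ae law, forall z, 0 <= deltat z /\ weakly_convex U (deltat z) (loss ^~ z)} ->
  delta = (\int[law]_z deltat z)%R ->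
  (* A5 *)
  measurable_fun setT Lt ->
  law.-integrable setT (fun z => (Lt z ^+ 2)%:E) ->
  {ae law, forall z, forall x y, X x -> X y ->
    `|loss x z - loss y z| <= Lt z * enorm (x - y)} ->
  0 <= L -> L ^+ 2 = (\int[law]_z (Lt z ^+ 2))%R ->
  (* constants *)
  0 <= sigma ->
  (forall x v g, X x -> subdiff U (semidev law loss kappa ^~ v) x g ->
    enorm g <= Dfx) ->
  (forall x g, X x -> subdiff U (risk law loss) x g -> enorm g <= Dh) ->
  0 <= M ->
  M ^+ 2 = (Dfx + Dh) ^+ 2 + 2 * sigma ^+ 2 + 2 * sigma * Dh ->
  (* the algorithm *)
  (0 < N)%N -> 0 < tau <= 1 -> X x0 ->
  let B := ceil_pos (2 * sigma ^+ 2 / tau ^+ 2) in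
  let b := ceil_pos (2 * L * M * sigma / tau) in
  let T := ceil_pos (sigma / (L * M * tau)) in
  scs_spider P law loss kappa tau T B b U X x0 s N ->
  (* A3 *)
  stochastic_oracles P law loss kappa T B b U s N sigma ->
  uniform_index P s J ->
  let F := mean_semidev law loss kappa in
  let rho := (1 + 2 * kappa) * delta in
  let rhobar := rho + (1 + kappa) * delta in
  let phi_env := moreau (constrained X F) rhobar^-1 in
  let C4 := 2 * rhobar * (M ^+ 2 / 4 + 1) in
  ('E_P[(fun w => enorm (gradient phi_env (iter_x s (J w) w)) ^+ 2)%R] <=
   (2 * ((phi_env x0 - inf (F @` X) + N%:R * C4 * tau ^+ 2) / (N%:R * tau)))%:E)%E.
Proof.
move=> kappa01 cX kX _ cU XU Lloss Ldelta wloss deltaE mLt LLt2 lloss L0 LE sigma0.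
move=> hDfx hDh M0 ME N0 tau01 Xx0 B b T run orac hJ; cbv zeta.
have dE : mean law deltat = delta by rewrite deltaE.
have d0 := delta_ge0 Ldelta wloss; rewrite dE in d0.
have B0 : (0 < B)%N by exact: ceil_pos_gt0.
have b0 : (0 < b)%N by exact: ceil_pos_gt0.
have T0 : (0 < T)%N by exact: ceil_pos_gt0.
rewrite -dE.
(* rhobar = (2 + 3 kappa) delta, so the degenerate Moreau parameter occurs exactly at delta = 0. *)
have [dz|dn] := eqVneq delta 0.
  apply: (mean_gradient0 P s M kappa01 kX XU Lloss mLt LLt2 lloss tau01 Xx0).
  by rewrite dE.
apply: (mean_gradient kappa01 cX kX cU XU Lloss Ldelta wloss mLt LLt2 lloss LE sigma0
  hDfx hDh ME tau01 Xx0 run orac B0 b0 N0) => //.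
  move=> k kN; have [_ h] := tracking kappa01 cX cU XU Lloss Ldelta wloss mLt LLt2 lloss
    LE sigma0 hDfx hDh ME tau01 Xx0 run orac B0 b0 kN.
  apply: (le_trans h); have /andP[t0 _] := tau01.
  by apply: batch_bounds => //; rewrite ltn_mod.
by rewrite dE lt_def dn.
Qed.
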